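(* Let $\mathcal B$ be a Krull–Schmidt exact category with enough projectives and enough injectives, and let $(\mathcal U_1,\mathcal V_1)$ and $(\mathcal U_2,\mathcal V_2)$ be cotorsion pairs on $\mathcal B$. If $\mathcal W_1\subseteq\mathcal K_2\subseteq\mathcal K_1$, then: (a) There is an isomorphism $\beta_{21}\beta_{12}\simeq\operatorname{id}_{\mathcal H_1/\mathcal W_1}$ of functors from $\mathcal H_1/\mathcal W_1$ to $\mathcal H_1/\mathcal W_1$. (b) $(\mathcal H_2\cap\mathcal K_1)/\mathcal W_2$ is a Serre subcategory of $\mathcal H_2/\mathcal W_2$. (c) The localization of $\mathcal H_2/\mathcal W_2$ by the Serre subcategory $(\mathcal H_2\cap\mathcal K_1)/\mathcal W_2$ is equivalent to $\mathcal H_1/\mathcal W_1$.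
   Context: Exact category is meant in the sense of Quillen; short exact sequences are written $A\rightarrowtail B\twoheadrightarrow C$. A cotorsion pair on $\mathcal B$ is a pair $(\mathcal U,\mathcal V)$ of full additive subcategories closed under direct summands such that $\operatorname{Ext}^1_{\mathcal B}(\mathcal U,\mathcal V)=0$ and every $B\in\mathcal B$ admits short exact sequences $V_B\rightarrowtail U_B\twoheadrightarrow B$ and $B\rightarrowtail V^B\twoheadrightarrow U^B$ with $U_B,U^B\in\mathcal U$, $V_B,V^B\in\mathcal V$. Put $\mathcal W=\mathcal U\cap\mathcal V$. $\mathcal B^+$ consists of the objects $B$ admitting a short exact sequence $V_B\rightarrowtail W_B\twoheadrightarrow B$ with $V_B\in\mathcal V$, $W_B\in\mathcal W$; $\mathcal B^-$ consists of the objects $B$ admitting a short exact sequence $B\rightarrowtail W^B\twoheadrightarrow U^B$ with $W^B\in\mathcal W$, $U^B\in\mathcal U$; $\mathcal H=\mathcal B^+\cap\mathcal B^-$. $\mathcal B/\mathcal W$ is the ideal quotient, $\pi:\mathcal B\to\mathcal B/\mathcal W$ the canonical functor, and $\mathcal H/\mathcal W\subseteq\mathcal B/\mathcal W$ (the heart) is an abelian category. Associated half exact functor $H:\mathcal B\to\mathcal H/\mathcal W$. For $B\in\mathcal B$ take short exact sequences $V_B\rightarrowtail U_B\stackrel{u_B}{\twoheadrightarrow}B$ and $U_B\stackrel{w'}{\rightarrowtail}W^0\twoheadrightarrow U^0$ with $U_B,U^0\in\mathcal U$, $V_B\in\mathcal V$, $W^0\in\mathcal W$, and let $\alpha_B:B\rightarrowtail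 B^+$ be the push-out of $w'$ along $u_B$; then $B^+\in\mathcal B^+$ and $\underline{\alpha_B}$ is universal in $\mathcal B/\mathcal W$ among morphisms from $B$ to objects of $\mathcal B^+$, so $B\mapsto B^+$ defines a functor $\sigma^+:\mathcal B/\mathcal W\to\mathcal B^+/\mathcal W$ (left adjoint to the inclusion). Dually there is $\sigma^-:\mathcal B/\mathcal W\to\mathcal B^-/\mathcal W$, right adjoint to the inclusion. Then $H:=\sigma^+\circ\sigma^-\circ\pi\simeq\sigma^-\circ\sigma^+\circ\pi$. It is half exact (sends short exact sequences $A\rightarrowtail B\twoheadrightarrow C$ to sequences exact at the middle term), and $H(X)=0$ iff $X\in\mathcal K$, where $\mathcal K=\operatorname{add}(\mathcal U*\mathcal V)$ is the full subcategory of objects $X$ for which there are an object $Y$ and a short exact sequence $U\rightarrowtail X\oplus Y\twoheadrightarrow V$ with $U\in\mathcal U$, $V\in\mathcal V$. For $k=1,2$ the data of $(\mathcal U_k,\mathcal V_k)$ are denoted $\mathcal W_k,\mathcal H_k,\pi_k,H_k,\mathcal K_k$. If $\{i,j\}=\{1,2\}$ and $\mathcal W_i\subseteq\mathcal K_j$, then $H_j=h_{ij}\pi_i$ for a functor $h_{ij}:\mathcal B/\mathcal W_i\to\mathcal H_j/\mathcal W_j$, and $\beta_{ij}:=h_{ij}\iota_i:\mathcal H_i/\mathcal W_i\to\mathcal H_j/\mathcal W_j$, where $\iota_i:\mathcal H_i/\mathcal W_i\hookrightarrow\mathcal B/\mathcal W_i$ is the inclusion. (Under the hypotheses of the theorem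 both $\beta_{12}$ and $\beta_{21}$ are defined, since $\mathcal W_2\subseteq\mathcal K_2\subseteq\mathcal K_1$.) *)

(* Defs.v *)
From Stdlib Require Import Setoid Morphisms RelationClasses List ClassicalEpsilon.
From Stdlib Require Import ssreflect.

Set Implicit Arguments.
Unset Strict Implicit.
Set Primitive Projections.

Declare Scope cat_scope.
Delimit Scope cat_scope with cat.
Local Open Scope cat_scope.

(** Hom-sets are setoids: [f ≈ g] is equality of morphisms.  The ideal
    quotient B/W then keeps the morphisms of B and coarsens their equality. *)

Record Category := MkCategory {
  obj :> Type;
  hom : obj -> obj -> Type;
  heq : forall X Y, hom X Y -> hom X Y -> Prop;
  idm : forall X, hom X X;
  comp : forall X Y Z, hom Y Z -> hom X Y -> hom X Z;
  heq_equiv : forall X Y, Equivalence (@heq X Y);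
  comp_heq : forall X Y Z (g g' : hom Y Z) (f f' : hom X Y),
    heq g g' -> heq f f' -> heq (comp g f) (comp g' f');
  comp_assoc : forall X Y Z T (h : hom Z T) (g : hom Y Z) (f : hom X Y),
    heq (comp h (comp g f)) (comp (comp h g) f);
  comp_idl : forall X Y (f : hom X Y), heq (comp (idm Y) f) f;
  comp_idr : forall X Y (f : hom X Y), heq (comp f (idm X)) f
}.

Arguments hom {c} X Y.
Arguments heq {c X Y} f g.
Arguments idm {c} X.
Arguments comp {c X Y Z} g f.
Arguments heq_equiv {c} X Y.

Notation "f ≈ g" := (heq f g) (at level 70, no associativity) : cat_scope.
Notation "g ∘ f" := (comp g f) (at level 40, left associativity) : cat_scope.

#[export] Instance heq_Equivalence (C : Category) (X Y : C) :
  Equivalence (@heq C X Y) := heq_equiv X Y.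

#[export] Hint Extern 0 (heq _ _) => reflexivity : core.

#[export] Instance comp_Proper (C : Category) (X Y Z : C) :
  Proper (@heq C Y Z ==> @heq C X Y ==> @heq C X Z) (@comp C X Y Z).
Proof. move=> g g' hg f f' hf; exact: comp_heq. Qed.

Definition is_iso (C : Category) (X Y : C) (f : hom X Y) : Prop :=
  exists g : hom Y X, g ∘ f ≈ idm X /\ f ∘ g ≈ idm Y.

Definition isomorphic (C : Category) (X Y : C) : Prop :=
  exists f : hom X Y, is_iso f.

Definition is_zero (C : Category) (Z : C) : Prop :=
  forall X : C, (exists f : hom X Z, forall g, g ≈ f) /\
                (exists f : hom Z X, forall g, g ≈ f).

Definition zero_mor (C : Category) (X Y : C) (f : hom X Y) : Prop :=
  exists Z : C, is_zero Z /\ exists (a : hom X Z) (b : hom Z Y), f ≈ b ∘ a.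

Definition is_kernel (C : Category) (K X Y : C) (k : hom K X) (f : hom X Y) : Prop :=
  zero_mor (f ∘ k) /\
  forall (T : C) (t : hom T X), zero_mor (f ∘ t) ->
    exists u : hom T K, k ∘ u ≈ t /\ forall u', k ∘ u' ≈ t -> u' ≈ u.

Definition is_cokernel (C : Category) (X Y Q : C) (q : hom Y Q) (f : hom X Y) : Prop :=
  zero_mor (q ∘ f) /\
  forall (T : C) (t : hom Y T), zero_mor (t ∘ f) ->
    exists u : hom Q T, u ∘ q ≈ t /\ forall u', u' ∘ q ≈ t -> u' ≈ u.

Definition short_exact (C : Category) (X Y Z : C) (f : hom X Y) (g : hom Y Z) : Prop :=
  is_kernel f g /\ is_cokernel g f.

(** The squares are [h ∘ f ≈ k ∘ g] and [f ∘ h ≈ g ∘ k] respectively. *)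

Definition is_pushout (C : Category) (A B D P : C)
    (f : hom A B) (g : hom A D) (h : hom B P) (k : hom D P) : Prop :=
  h ∘ f ≈ k ∘ g /\
  forall (T : C) (x : hom B T) (y : hom D T), x ∘ f ≈ y ∘ g ->
    exists z : hom P T, (z ∘ h ≈ x /\ z ∘ k ≈ y) /\
      forall z', z' ∘ h ≈ x -> z' ∘ k ≈ y -> z' ≈ z.

Definition is_pullback (C : Category) (A B D P : C)
    (f : hom B A) (g : hom D A) (h : hom P B) (k : hom P D) : Prop :=
  f ∘ h ≈ g ∘ k /\
  forall (T : C) (x : hom T B) (y : hom T D), f ∘ x ≈ g ∘ y ->
    exists z : hom T P, (h ∘ z ≈ x /\ k ∘ z ≈ y) /\
      forall z', h ∘ z' ≈ x -> k ∘ z' ≈ y -> z' ≈ z.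

Definition op_cat (C : Category) : Category := {|
  obj := C;
  hom := fun X Y => @hom C Y X;
  heq := fun X Y => @heq C Y X;
  idm := @idm C;
  comp := fun X Y Z g f => @comp C Z Y X f g;
  heq_equiv := fun X Y => @heq_equiv C Y X;
  comp_heq := fun X Y Z g g' f f' hg hf => comp_heq hf hg;
  comp_assoc := fun X Y Z T h g f => symmetry (comp_assoc f g h);
  comp_idl := fun X Y f => comp_idr f;
  comp_idr := fun X Y f => comp_idl f
|}.

Record Functor (C D : Category) := MkFunctor {
  fobj :> C -> D;
  fmap : forall X Y : C, hom X Y -> hom (fobj X) (fobj Y);
  fmap_heq : forall (X Y : C) (f g : hom X Y), f ≈ g -> fmap f ≈ fmap g;
  fmap_id : forall X : C, fmap (idm X) ≈ idm (fobj X);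
  fmap_comp : forall (X Y Z : C) (g : hom Y Z) (f : hom X Y),
    fmap (g ∘ f) ≈ fmap g ∘ fmap f
}.

Definition functor_id (C : Category) : Functor C C.
Proof.
  refine {| fobj := fun X => X; fmap := fun X Y f => f |}; by [] || reflexivity.
Defined.

Definition functor_comp (C D E : Category) (G : Functor D E) (F : Functor C D) :
  Functor C E.
Proof.
  refine {| fobj := fun X => G (F X); fmap := fun X Y f => fmap G (fmap F f) |}.
  - abstract (move=> X Y f g h; apply: fmap_heq; exact: fmap_heq).
  - abstract (move=> X; rewrite -(fmap_id G); apply: fmap_heq; exact: fmap_id).
  - abstract (move=> X Y Z g f; rewrite -(fmap_comp G); apply: fmap_heq; exact: fmap_comp).
Defined.

Definition naturally_isomorphic (C D : Category) (F G : Functor C D) : Prop :=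
  exists eta : forall X : C, hom (F X) (G X),
    (forall X, is_iso (eta X)) /\
    forall (X Y : C) (f : hom X Y), eta Y ∘ fmap F f ≈ fmap G f ∘ eta X.

Definition equivalent_categories (C D : Category) : Prop :=
  exists (F : Functor C D) (G : Functor D C),
    naturally_isomorphic (functor_comp G F) (functor_id C) /\
    naturally_isomorphic (functor_comp F G) (functor_id D).

Definition full_sub (C : Category) (P : C -> Prop) : Category := {|
  obj := {X : C | P X};
  hom := fun X Y => @hom C (proj1_sig X) (proj1_sig Y);
  heq := fun X Y => @heq C (proj1_sig X) (proj1_sig Y);
  idm := fun X => @idm C (proj1_sig X);
  comp := fun X Y Z => @comp C (proj1_sig X) (proj1_sig Y) (proj1_sig Z);
  heq_equiv := fun X Y => @heq_equiv C (proj1_sig X) (proj1_sig Y);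
  comp_heq := fun X Y Z => @comp_heq C (proj1_sig X) (proj1_sig Y) (proj1_sig Z);
  comp_assoc := fun X Y Z T =>
    @comp_assoc C (proj1_sig X) (proj1_sig Y) (proj1_sig Z) (proj1_sig T);
  comp_idl := fun X Y => @comp_idl C (proj1_sig X) (proj1_sig Y);
  comp_idr := fun X Y => @comp_idr C (proj1_sig X) (proj1_sig Y)
|}.

Definition full_incl (C : Category) (P : C -> Prop) : Functor (full_sub P) C.
Proof.
  refine {| fobj := fun X : full_sub P => proj1_sig X;
            fmap := fun X Y f => f |}; by [] || reflexivity.
Defined.

Definition functor_into (C D : Category) (P : D -> Prop) (F : Functor C D)
    (hF : forall X, P (F X)) : Functor C (full_sub P).
Proof.
  refine {| fobj := (fun X => exist P (F X) (hF X)) : C -> full_sub P;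
            fmap := fun X Y f => fmap F f |}.
  - move=> X Y f g; exact: fmap_heq.
  - move=> X; exact: fmap_id.
  - move=> X Y Z g f; exact: fmap_comp.
Defined.

(** A full subcategory is given by a predicate on objects.  In an abelian
    category, [short_exact f g] says that 0 -> X -> Y -> Z -> 0 is exact. *)
Definition serre_subcategory (A : Category) (S : A -> Prop) : Prop :=
  (exists X, S X) /\
  forall (X Y Z : A) (f : hom X Y) (g : hom Y Z), short_exact f g ->
    (S Y <-> S X /\ S Z).

Section Localization.
Variables (C : Category) (Sigma : forall X Y : C, hom X Y -> Prop).

(** The localization C[Sigma^-1] of Gabriel and Zisman: formal composites of
    morphisms of C and formal inverses of members of Sigma, modulo the
    relations that make C -> C[Sigma^-1] a functor and these inverses inverse. *)
Inductive zigzag : C -> C -> Type :=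
| zz_mor : forall X Y : C, hom X Y -> zigzag X Y
| zz_inv : forall (X Y : C) (s : hom X Y), Sigma s -> zigzag Y X
| zz_comp : forall X Y Z : C, zigzag Y Z -> zigzag X Y -> zigzag X Z.

Inductive zz_eq : forall X Y : C, zigzag X Y -> zigzag X Y -> Prop :=
| zz_refl : forall X Y (p : zigzag X Y), zz_eq p p
| zz_sym : forall X Y (p q : zigzag X Y), zz_eq p q -> zz_eq q p
| zz_trans : forall X Y (p q r : zigzag X Y), zz_eq p q -> zz_eq q r -> zz_eq p r
| zz_congr : forall X Y Z (p p' : zigzag Y Z) (q q' : zigzag X Y),
    zz_eq p p' -> zz_eq q q' -> zz_eq (zz_comp p q) (zz_comp p' q')
| zz_assoc : forall X Y Z T (p : zigzag Z T) (q : zigzag Y Z) (r : zigzag X Y),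
    zz_eq (zz_comp p (zz_comp q r)) (zz_comp (zz_comp p q) r)
| zz_idl : forall X Y (p : zigzag X Y), zz_eq (zz_comp (zz_mor (idm Y)) p) p
| zz_idr : forall X Y (p : zigzag X Y), zz_eq (zz_comp p (zz_mor (idm X))) p
| zz_mor_heq : forall X Y (f g : hom X Y), f ≈ g -> zz_eq (zz_mor f) (zz_mor g)
| zz_mor_comp : forall X Y Z (g : hom Y Z) (f : hom X Y),
    zz_eq (zz_mor (g ∘ f)) (zz_comp (zz_mor g) (zz_mor f))
| zz_inv_l : forall X Y (s : hom X Y) (hs : Sigma s),
    zz_eq (zz_comp (zz_inv hs) (zz_mor s)) (zz_mor (idm X))
| zz_inv_r : forall X Y (s : hom X Y) (hs : Sigma s),
    zz_eq (zz_comp (zz_mor s) (zz_inv hs)) (zz_mor (idm Y)).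

Definition localization : Category.
Proof.
  refine {| obj := C; hom := zigzag; heq := zz_eq;
            idm := fun X => zz_mor (idm X); comp := zz_comp |}.
  - move=> X Y; split; [exact: zz_refl | exact: zz_sym | exact: zz_trans].
  - exact: zz_congr.
  - exact: zz_assoc.
  - exact: zz_idl.
  - exact: zz_idr.
Defined.

End Localization.

(** The Serre quotient inverts the morphisms with kernel and cokernel in [S]. *)
Definition serre_iso (A : Category) (S : A -> Prop) (X Y : A) (f : hom X Y) : Prop :=
  (exists (K : A) (k : hom K X), is_kernel k f /\ S K) /\
  (exists (Q : A) (q : hom Y Q), is_cokernel q f /\ S Q).

Definition serre_localization (A : Category) (S : A -> Prop) : Category :=
  localization (@serre_iso A S).

Record AdditiveCategory := MkAdditive {
  acat :> Category;
  hzero : forall X Y : acat, hom X Y;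
  hadd : forall X Y : acat, hom X Y -> hom X Y -> hom X Y;
  hopp : forall X Y : acat, hom X Y -> hom X Y;
  hadd_heq : forall (X Y : acat) (f f' g g' : hom X Y),
    f ≈ f' -> g ≈ g' -> hadd f g ≈ hadd f' g';
  hopp_heq : forall (X Y : acat) (f f' : hom X Y), f ≈ f' -> hopp f ≈ hopp f';
  hadd_assoc : forall (X Y : acat) (f g h : hom X Y),
    hadd f (hadd g h) ≈ hadd (hadd f g) h;
  hadd_comm : forall (X Y : acat) (f g : hom X Y), hadd f g ≈ hadd g f;
  hadd_0l : forall (X Y : acat) (f : hom X Y), hadd (hzero X Y) f ≈ f;
  hadd_oppr : forall (X Y : acat) (f : hom X Y), hadd f (hopp f) ≈ hzero X Y;
  comp_addl : forall (X Y Z : acat) (g g' : hom Y Z) (f : hom X Y),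
    hadd g g' ∘ f ≈ hadd (g ∘ f) (g' ∘ f);
  comp_addr : forall (X Y Z : acat) (g : hom Y Z) (f f' : hom X Y),
    g ∘ hadd f f' ≈ hadd (g ∘ f) (g ∘ f');
  zobj : acat;
  zobj_zero : is_zero zobj;
  bip : acat -> acat -> acat;
  in1 : forall X Y, hom X (bip X Y);
  in2 : forall X Y, hom Y (bip X Y);
  pr1 : forall X Y, hom (bip X Y) X;
  pr2 : forall X Y, hom (bip X Y) Y;
  pr1_in1 : forall X Y, pr1 X Y ∘ in1 X Y ≈ idm X;
  pr2_in2 : forall X Y, pr2 X Y ∘ in2 X Y ≈ idm Y;
  pr1_in2 : forall X Y, pr1 X Y ∘ in2 X Y ≈ hzero Y X;
  pr2_in1 : forall X Y, pr2 X Y ∘ in1 X Y ≈ hzero X Y;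
  bip_id : forall X Y,
    hadd (in1 X Y ∘ pr1 X Y) (in2 X Y ∘ pr2 X Y) ≈ idm (bip X Y)
}.

Arguments hzero {a} X Y.
Arguments hadd {a X Y} f g.
Arguments hopp {a X Y} f.
Arguments zobj {a}.
Arguments bip {a} X Y.
Arguments in1 {a} X Y.
Arguments in2 {a} X Y.
Arguments pr1 {a} X Y.
Arguments pr2 {a} X Y.

Notation "f + g" := (hadd f g) : cat_scope.
Notation "- f" := (hopp f) : cat_scope.
Notation "f - g" := (hadd f (hopp g)) : cat_scope.
Notation "X ⊕ Y" := (bip X Y) (at level 50, left associativity) : cat_scope.

#[export] Instance hadd_Proper (A : AdditiveCategory) (X Y : A) :
  Proper (@heq A X Y ==> @heq A X Y ==> @heq A X Y) (@hadd A X Y).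
Proof. move=> f f' hf g g' hg; exact: hadd_heq. Qed.

#[export] Instance hopp_Proper (A : AdditiveCategory) (X Y : A) :
  Proper (@heq A X Y ==> @heq A X Y) (@hopp A X Y).
Proof. move=> f f' hf; exact: hopp_heq. Qed.

(** [is_iso] picks out the units of End(X): the non-units of End(X) are closed under
    addition and End(X) is nonzero. *)
Definition local_endomorphism_ring (A : AdditiveCategory) (X : A) : Prop :=
  ~ (idm X ≈ hzero X X) /\
  forall f g : hom X X, ~ is_iso f -> ~ is_iso g -> ~ is_iso (f + g).

Definition direct_sum (A : AdditiveCategory) (l : list A) : A :=
  fold_right (fun X Y => X ⊕ Y) zobj l.

Definition krull_schmidt (A : AdditiveCategory) : Prop :=
  forall X : A, exists l : list A,
    isomorphic X (direct_sum l) /\ Forall (@local_endomorphism_ring A) l.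

(** As [P] ranges over predicates that are closed under isomorphism below, the
    chosen zero object and direct sums stand for all of them. *)
Definition additive_sub (A : AdditiveCategory) (P : A -> Prop) : Prop :=
  P zobj /\ forall X Y : A, P X -> P Y -> P (X ⊕ Y).

Definition summand_closed (A : AdditiveCategory) (P : A -> Prop) : Prop :=
  forall X Y Z : A, isomorphic Z (X ⊕ Y) -> P Z -> P X.

Section AdditiveFacts.
Variable A : AdditiveCategory.
Implicit Types X Y Z T : A.

Lemma hadd_0r X Y (f : hom X Y) : f + hzero X Y ≈ f.
Proof. by rewrite hadd_comm hadd_0l. Qed.

Lemma hadd_oppl X Y (f : hom X Y) : - f + f ≈ hzero X Y.
Proof. by rewrite hadd_comm hadd_oppr. Qed.

Lemma hadd_cancel X Y (f g h : hom X Y) : f + h ≈ g + h -> f ≈ g.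
Proof.
  move=> e; rewrite -(hadd_0r f) -(hadd_0r g) -(hadd_oppr h) !hadd_assoc.
  by rewrite e.
Qed.

Lemma comp_0l X Y Z (f : hom X Y) : hzero Y Z ∘ f ≈ hzero X Z.
Proof.
  apply: (@hadd_cancel _ _ _ _ (hzero Y Z ∘ f)).
  by rewrite -comp_addl !hadd_0l.
Qed.

Lemma comp_0r X Y Z (g : hom Y Z) : g ∘ hzero X Y ≈ hzero X Z.
Proof.
  apply: (@hadd_cancel _ _ _ _ (g ∘ hzero X Y)).
  by rewrite -comp_addr !hadd_0l.
Qed.

Lemma opp_unique X Y (f g : hom X Y) : f + g ≈ hzero X Y -> g ≈ - f.
Proof.
  move=> e; apply: (@hadd_cancel _ _ _ _ f).
  by rewrite hadd_oppl hadd_comm.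
Qed.

Lemma comp_oppl X Y Z (g : hom Y Z) (f : hom X Y) : (- g) ∘ f ≈ - (g ∘ f).
Proof. by apply: opp_unique; rewrite -comp_addl hadd_oppr comp_0l. Qed.

Lemma comp_oppr X Y Z (g : hom Y Z) (f : hom X Y) : g ∘ (- f) ≈ - (g ∘ f).
Proof. by apply: opp_unique; rewrite -comp_addr hadd_oppr comp_0r. Qed.

Lemma hopp_0 X Y : - hzero X Y ≈ hzero X Y.
Proof. by symmetry; apply: opp_unique; rewrite hadd_0l. Qed.

Lemma hopp_opp X Y (f : hom X Y) : - - f ≈ f.
Proof. by symmetry; apply: opp_unique; rewrite hadd_oppl. Qed.

Lemma hadd_swap X Y (a b c d : hom X Y) : (a + b) + (c + d) ≈ (a + c) + (b + d).
Proof.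
  rewrite -!hadd_assoc; apply: hadd_heq; first by [].
  by rewrite !hadd_assoc (hadd_comm b c).
Qed.

Lemma hopp_add X Y (f g : hom X Y) : - (f + g) ≈ - f - g.
Proof.
  symmetry; apply: opp_unique.
  by rewrite hadd_swap !hadd_oppr hadd_0l.
Qed.

Lemma hsub_0r X Y (f : hom X Y) : f - hzero X Y ≈ f.
Proof. by rewrite hopp_0 hadd_0r. Qed.

Lemma hsub_eq0 X Y (f g : hom X Y) : f - g ≈ hzero X Y <-> f ≈ g.
Proof.
  split=> e; last by rewrite e hadd_oppr.
  by apply: (@hadd_cancel _ _ _ _ (- g)); rewrite hadd_oppr.
Qed.

Lemma hsub_comp_l X Y Z (g g' : hom Y Z) (f : hom X Y) :
  (g - g') ∘ f ≈ g ∘ f - g' ∘ f.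
Proof. by rewrite comp_addl comp_oppl. Qed.

Lemma hsub_comp_r X Y Z (g : hom Y Z) (f f' : hom X Y) :
  g ∘ (f - f') ≈ g ∘ f - g ∘ f'.
Proof. by rewrite comp_addr comp_oppr. Qed.

Lemma zero_mor_iff X Y (f : hom X Y) : zero_mor f <-> f ≈ hzero X Y.
Proof.
  split=> [[Z [hZ [a [b e]]]]|e].
  - have [[f0 h0] _] := hZ X.
    by rewrite e (h0 a) -(h0 (hzero X Z)) comp_0r.
  - exists zobj; split; first exact: zobj_zero.
    by exists (hzero _ _), (hzero _ _); rewrite e comp_0r.
Qed.

Lemma kernelP K X Y (k : hom K X) (f : hom X Y) :
  is_kernel k f <->
  f ∘ k ≈ hzero K Y /\
  forall T (t : hom T X), f ∘ t ≈ hzero T Y ->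
    exists u : hom T K, k ∘ u ≈ t /\ forall u', k ∘ u' ≈ t -> u' ≈ u.
Proof.
  split=> -[h1 h2]; split; try by apply/zero_mor_iff.
  all: by move=> T t /zero_mor_iff; apply: h2.
Qed.

Lemma cokernelP X Y Q (q : hom Y Q) (f : hom X Y) :
  is_cokernel q f <->
  q ∘ f ≈ hzero X Q /\
  forall T (t : hom Y T), t ∘ f ≈ hzero X T ->
    exists u : hom Q T, u ∘ q ≈ t /\ forall u', u' ∘ q ≈ t -> u' ≈ u.
Proof.
  split=> -[h1 h2]; split; try by apply/zero_mor_iff.
  all: by move=> T t /zero_mor_iff; apply: h2.
Qed.

End AdditiveFacts.

Lemma op_zero (C : Category) (Z : C) : is_zero Z -> @is_zero (op_cat C) Z.
Proof. by move=> h X; have [] := h X. Qed.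

Definition op_add (A : AdditiveCategory) : AdditiveCategory := {|
  acat := op_cat A;
  hzero := (fun X Y => @hzero A Y X) : forall X Y : op_cat A, hom X Y;
  hadd := fun X Y f g => @hadd A Y X f g;
  hopp := fun X Y f => @hopp A Y X f;
  hadd_heq := fun X Y f f' g g' => @hadd_heq A Y X f f' g g';
  hopp_heq := fun X Y f f' => @hopp_heq A Y X f f';
  hadd_assoc := fun X Y => @hadd_assoc A Y X;
  hadd_comm := fun X Y => @hadd_comm A Y X;
  hadd_0l := fun X Y => @hadd_0l A Y X;
  hadd_oppr := fun X Y => @hadd_oppr A Y X;
  comp_addl := fun X Y Z g g' f => @comp_addr A Z Y X f g g';
  comp_addr := fun X Y Z g f f' => @comp_addl A Z Y X f f' g;
  zobj := (@zobj A : op_cat A);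
  zobj_zero := op_zero (@zobj_zero A);
  bip := (@bip A : op_cat A -> op_cat A -> op_cat A);
  in1 := @pr1 A; in2 := @pr2 A; pr1 := @in1 A; pr2 := @in2 A;
  pr1_in1 := @pr1_in1 A; pr2_in2 := @pr2_in2 A;
  pr1_in2 := fun X Y => @pr2_in1 A X Y; pr2_in1 := fun X Y => @pr1_in2 A X Y;
  bip_id := @bip_id A
|}.

Lemma op_kernel (A : AdditiveCategory) (K X Y : A) (k : hom K X) (f : hom X Y) :
  is_kernel k f -> @is_cokernel (op_add A) Y X K k f.
Proof. by move=> /kernelP h; apply/cokernelP. Qed.

Lemma op_cokernel (A : AdditiveCategory) (X Y Q : A) (q : hom Y Q) (f : hom X Y) :
  is_cokernel q f -> @is_kernel (op_add A) Q Y X q f.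
Proof. by move=> /cokernelP h; apply/kernelP. Qed.

(** Equality in B/W: the difference factors through an object of W. *)
Definition quot_eq (A : AdditiveCategory) (W : A -> Prop) (X Y : A) (f g : hom X Y) : Prop :=
  exists Z : A, W Z /\ exists (a : hom X Z) (b : hom Z Y), f - g ≈ b ∘ a.

Section Quotient.
Variables (A : AdditiveCategory) (W : A -> Prop) (hW : additive_sub W).
Implicit Types X Y Z : A.

Lemma quot_eq_heq X Y (f g : hom X Y) : f ≈ g -> quot_eq W f g.
Proof using hW.
  move=> e; exists zobj; split; first exact: (proj1 hW).
  exists (hzero _ _), (hzero _ _).
  by rewrite comp_0r; apply/hsub_eq0.
Qed.

Lemma quot_eq_sym X Y (f g : hom X Y) : quot_eq W f g -> quot_eq W g f.
Proof using Type.
  move=> [Z [hZ [a [b e]]]]; exists Z; split=> //; exists a, (- b).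
  by rewrite comp_oppl -e hopp_add hopp_opp hadd_comm.
Qed.

Lemma quot_eq_add X Y (f f' g g' : hom X Y) :
  quot_eq W f f' -> quot_eq W g g' -> quot_eq W (f + g) (f' + g').
Proof using hW.
  move=> [Z [hZ [a [b e]]]] [Z' [hZ' [a' [b' e']]]].
  exists (Z ⊕ Z'); split; first exact: (proj2 hW).
  exists (in1 Z Z' ∘ a + in2 Z Z' ∘ a'), (b ∘ pr1 Z Z' + b' ∘ pr2 Z Z').
  rewrite comp_addl !comp_addr -!comp_assoc.
  rewrite !(comp_assoc (pr1 Z Z')) !(comp_assoc (pr2 Z Z')).
  rewrite pr1_in1 pr1_in2 pr2_in1 pr2_in2 !comp_0l !comp_0r !comp_idl hadd_0l hadd_0r.
  by rewrite hopp_add hadd_swap e e'.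
Qed.

Lemma quot_eq_trans X Y (f g h : hom X Y) :
  quot_eq W f g -> quot_eq W g h -> quot_eq W f h.
Proof using hW.
  move=> h1 h2; have [Z [hZ [a [b e]]]] := quot_eq_add h1 h2.
  exists Z; split=> //; exists a, b; rewrite -e.
  by rewrite hopp_add (hadd_comm (- g)) hadd_swap hadd_oppr hadd_0r.
Qed.

Lemma quot_eq_compr X Y Z (f : hom X Y) (g g' : hom Y Z) :
  quot_eq W g g' -> quot_eq W (g ∘ f) (g' ∘ f).
Proof using Type.
  move=> [T [hT [a [b e]]]]; exists T; split=> //; exists (a ∘ f), b.
  by rewrite comp_assoc -e hsub_comp_l.
Qed.

Lemma quot_eq_compl X Y Z (f f' : hom X Y) (g : hom Y Z) :
  quot_eq W f f' -> quot_eq W (g ∘ f) (g ∘ f').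
Proof using Type.
  move=> [T [hT [a [b e]]]]; exists T; split=> //; exists a, (g ∘ b).
  by rewrite -comp_assoc -e hsub_comp_r.
Qed.

Lemma quot_eq_equiv X Y : Equivalence (@quot_eq A W X Y).
Proof using hW.
  split.
  - by move=> f; apply: quot_eq_heq.
  - by move=> f g; apply: quot_eq_sym.
  - by move=> f g h; apply: quot_eq_trans.
Qed.

Lemma quot_eq_comp X Y Z (g g' : hom Y Z) (f f' : hom X Y) :
  quot_eq W g g' -> quot_eq W f f' -> quot_eq W (g ∘ f) (g' ∘ f').
Proof using hW.
  move=> h1 h2; apply: (@quot_eq_trans _ _ _ (g' ∘ f)).
  - exact: quot_eq_compr.
  - exact: quot_eq_compl.
Qed.

Definition quotient : Category := {|
  obj := A;
  hom := @hom A;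
  heq := @quot_eq A W;
  idm := @idm A;
  comp := @comp A;
  heq_equiv := quot_eq_equiv;
  comp_heq := @quot_eq_comp;
  comp_assoc := fun X Y Z T h g f => quot_eq_heq (comp_assoc h g f);
  comp_idl := fun X Y f => quot_eq_heq (comp_idl f);
  comp_idr := fun X Y f => quot_eq_heq (comp_idr f)
|}.

Definition quot_proj : Functor A quotient.
Proof using Type.
  refine {| fobj := (fun X => X) : A -> quotient; fmap := fun X Y f => f |}.
  - move=> X Y f g; exact: quot_eq_heq.
  - by move=> X; apply: quot_eq_heq.
  - by move=> X Y Z g f; apply: quot_eq_heq.
Defined.

(** The functor h with F = h π, which acts as [F] on objects and morphisms. *)
Definition quot_descend (D : Category) (F : Functor A D)
    (hF : forall (X Y : A) (f g : hom X Y), quot_eq W f g -> fmap F f ≈ fmap F g) :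
  Functor quotient D := {|
  fobj := (fun X => F X) : quotient -> D;
  fmap := fun X Y f => @fmap A D F X Y f;
  fmap_heq := hF;
  fmap_id := @fmap_id A D F;
  fmap_comp := @fmap_comp A D F
|}.

End Quotient.

Record ExactCategory := MkExact {
  ecat :> AdditiveCategory;
  conflation : forall A B C : ecat, hom A B -> hom B C -> Prop;
  conf_kernel : forall (A B C : ecat) (i : hom A B) (p : hom B C),
    conflation i p -> is_kernel i p;
  conf_cokernel : forall (A B C : ecat) (i : hom A B) (p : hom B C),
    conflation i p -> is_cokernel p i;
  conf_iso : forall (A B C A' B' C' : ecat)
      (i : hom A B) (p : hom B C) (i' : hom A' B') (p' : hom B' C')
      (a : hom A A') (b : hom B B') (c : hom C C'),
    is_iso a -> is_iso b -> is_iso c -> b ∘ i ≈ i' ∘ a -> c ∘ p ≈ p' ∘ b ->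
    conflation i p -> conflation i' p';
  conf_split : forall A C : ecat, conflation (in1 A C) (pr2 A C);
  inflation_comp : forall (A B D : ecat) (i : hom A B) (j : hom B D),
    (exists (C : ecat) (p : hom B C), conflation i p) ->
    (exists (C : ecat) (q : hom D C), conflation j q) ->
    exists (C : ecat) (r : hom D C), conflation (j ∘ i) r;
  deflation_comp : forall (B C D : ecat) (p : hom B C) (q : hom C D),
    (exists (A : ecat) (i : hom A B), conflation i p) ->
    (exists (A : ecat) (j : hom A C), conflation j q) ->
    exists (A : ecat) (k : hom A B), conflation k (q ∘ p);
  inflation_pushout : forall (A B A' : ecat) (i : hom A B) (f : hom A A'),
    (exists (C : ecat) (p : hom B C), conflation i p) ->
    exists (B' : ecat) (f' : hom B B') (i' : hom A' B'), is_pushout i f f' i' /\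
      exists (C : ecat) (p' : hom B' C), conflation i' p';
  deflation_pullback : forall (B C C' : ecat) (p : hom B C) (f : hom C' C),
    (exists (A : ecat) (i : hom A B), conflation i p) ->
    exists (B' : ecat) (f' : hom B' B) (p' : hom B' C'), is_pullback p f f' p' /\
      exists (A : ecat) (i' : hom A B'), conflation i' p'
}.

Arguments conflation {e A B C} i p.

Definition inflation (B : ExactCategory) (X Y : B) (i : hom X Y) : Prop :=
  exists (Z : B) (p : hom Y Z), conflation i p.

Definition deflation (B : ExactCategory) (Y Z : B) (p : hom Y Z) : Prop :=
  exists (X : B) (i : hom X Y), conflation i p.

Definition projective (B : ExactCategory) (P : B) : Prop :=
  forall (Y Z : B) (p : hom Y Z) (f : hom P Z), deflation p ->
    exists g : hom P Y, p ∘ g ≈ f.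

Definition injective (B : ExactCategory) (I : B) : Prop :=
  forall (X Y : B) (i : hom X Y) (f : hom X I), inflation i ->
    exists g : hom Y I, g ∘ i ≈ f.

Definition enough_projectives (B : ExactCategory) : Prop :=
  forall X : B, exists (P : B) (p : hom P X), projective P /\ deflation p.

Definition enough_injectives (B : ExactCategory) : Prop :=
  forall X : B, exists (I : B) (i : hom X I), injective I /\ inflation i.

(** Ext^1(C, A) is the group of equivalence classes of conflations
    [A -> E -> C]; its zero element is the class of the split one. *)
Definition extension_equiv (B : ExactCategory) (A C E E' : B)
    (i : hom A E) (p : hom E C) (i' : hom A E') (p' : hom E' C) : Prop :=
  exists h : hom E E', is_iso h /\ h ∘ i ≈ i' /\ p' ∘ h ≈ p.

Definition ext1_zero (B : ExactCategory) (C A : B) : Prop :=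
  forall (E : B) (i : hom A E) (p : hom E C), conflation i p ->
    extension_equiv i p (in1 A C) (pr2 A C).

Record CotorsionPair (B : ExactCategory) := MkCotorsionPair {
  cU : B -> Prop;
  cV : B -> Prop;
  cU_additive : additive_sub cU;
  cV_additive : additive_sub cV;
  cU_summand : summand_closed cU;
  cV_summand : summand_closed cV;
  cotorsion_ext : forall X Y : B, cU X -> cV Y -> ext1_zero X Y;
  cotorsion_right : forall X : B, exists (V U : B) (v : hom V U) (u : hom U X),
    cV V /\ cU U /\ conflation v u;
  cotorsion_left : forall X : B, exists (V U : B) (v : hom X V) (u : hom V U),
    cV V /\ cU U /\ conflation v u
}.

Section CotorsionDefs.
Variables (B : ExactCategory) (c : CotorsionPair B).

Definition cW (X : B) : Prop := cU c X /\ cV c X.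

Definition cBplus (X : B) : Prop :=
  exists (V W : B) (v : hom V W) (w : hom W X), cV c V /\ cW W /\ conflation v w.

Definition cBminus (X : B) : Prop :=
  exists (W U : B) (w : hom X W) (u : hom W U), cW W /\ cU c U /\ conflation w u.

Definition cH (X : B) : Prop := cBplus X /\ cBminus X.

Definition cK (X : B) : Prop :=
  exists (Y U V : B) (i : hom U (X ⊕ Y)) (p : hom (X ⊕ Y) V),
    cU c U /\ cV c V /\ conflation i p.

Lemma cW_additive : additive_sub cW.
Proof.
  split.
  - split; [exact: (proj1 (cU_additive c)) | exact: (proj1 (cV_additive c))].
  - move=> X Y [h1 h2] [h3 h4]; split.
    + exact: (proj2 (cU_additive c)).
    + exact: (proj2 (cV_additive c)).
Qed.

Definition quotW : Category := quotient cW_additive.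

Definition heart : Category := full_sub (cH : quotW -> Prop).

Definition heart_incl : Functor heart quotW := full_incl (cH : quotW -> Prop).

(** [plus_v, plus_u] is V_X -> U_X -> X, [plus_w, plus_q] is U_X -> W^0 -> U^0
    and [plus_alpha : X -> X⁺] is the pushout of [plus_w] along [plus_u]. *)
Record PlusData (X : B) := MkPlusData {
  plus_V : B; plus_U : B; plus_W0 : B; plus_U0 : B; plus_obj : B;
  plus_v : hom plus_V plus_U;
  plus_u : hom plus_U X;
  plus_w : hom plus_U plus_W0;
  plus_q : hom plus_W0 plus_U0;
  plus_b : hom plus_W0 plus_obj;
  plus_alpha : hom X plus_obj;
  plus_hV : cV c plus_V;
  plus_hU : cU c plus_U;
  plus_hW0 : cW plus_W0;
  plus_hU0 : cU c plus_U0;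
  plus_conf1 : conflation plus_v plus_u;
  plus_conf2 : conflation plus_w plus_q;
  plus_po : is_pushout plus_w plus_u plus_b plus_alpha
}.

(** [minus_v, minus_u] is X -> V^X -> U^X, [minus_q, minus_w] is V_0 -> W_0 -> V^X
    and [minus_gamma : X⁻ -> X] is the pullback of [minus_w] along [minus_v]. *)
Record MinusData (X : B) := MkMinusData {
  minus_U : B; minus_V : B; minus_W0 : B; minus_V0 : B; minus_obj : B;
  minus_u : hom minus_V minus_U;
  minus_v : hom X minus_V;
  minus_w : hom minus_W0 minus_V;
  minus_q : hom minus_V0 minus_W0;
  minus_b : hom minus_obj minus_W0;
  minus_gamma : hom minus_obj X;
  minus_hU : cU c minus_U;
  minus_hV : cV c minus_V;
  minus_hW0 : cW minus_W0;
  minus_hV0 : cV c minus_V0;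
  minus_conf1 : conflation minus_v minus_u;
  minus_conf2 : conflation minus_q minus_w;
  minus_pb : is_pullback minus_w minus_v minus_b minus_gamma
}.

End CotorsionDefs.

Lemma op_iso (C : Category) (X Y : C) (f : hom X Y) :
  is_iso f -> @is_iso (op_cat C) Y X f.
Proof. by move=> [g [h1 h2]]; exists g. Qed.

Lemma iso_inv_r (C : Category) (X Y : C) (f : hom X Y) : is_iso f ->
  exists g : hom Y X, is_iso g /\ g ∘ f ≈ idm X /\ f ∘ g ≈ idm Y.
Proof. by move=> [g [h1 h2]]; exists g; split=> //; exists f. Qed.

Lemma conf_heq (B : ExactCategory) (X Y Z : B) (i i' : hom X Y) (p p' : hom Y Z) :
  i ≈ i' -> p ≈ p' -> conflation i p -> conflation i' p'.
Proof.
  move=> hi hp; have ids (T : B) : is_iso (idm T) by exists (idm T); rewrite comp_idl.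
  apply: (conf_iso (ids _) (ids _) (ids _)); by rewrite comp_idl comp_idr.
Qed.

Lemma swap_iso (A : AdditiveCategory) (X Y : A) :
  is_iso (in1 X Y ∘ pr2 Y X + in2 X Y ∘ pr1 Y X).
Proof.
  have half (P Q : A) :
    (in1 P Q ∘ pr2 Q P + in2 P Q ∘ pr1 Q P) ∘ (in1 Q P ∘ pr2 P Q + in2 Q P ∘ pr1 P Q)
      ≈ idm (P ⊕ Q).
  { rewrite comp_addl !comp_addr -!comp_assoc.
    rewrite !(comp_assoc (pr1 Q P)) !(comp_assoc (pr2 Q P)).
    rewrite pr1_in1 pr1_in2 pr2_in1 pr2_in2 !comp_0l !comp_0r !comp_idl hadd_0l hadd_0r.
    exact: bip_id. }
  by exists (in1 Y X ∘ pr2 X Y + in2 Y X ∘ pr1 X Y); split; apply: half.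
Qed.

Lemma conf_split_op (B : ExactCategory) (X Y : B) : conflation (in2 X Y) (pr1 X Y).
Proof.
  have ids (T : B) : is_iso (idm T) by exists (idm T); rewrite comp_idl.
  apply: (conf_iso (ids _) (swap_iso X Y) (ids _) _ _ (conf_split Y X)).
  - by rewrite comp_addl -!comp_assoc pr2_in1 pr1_in1 comp_0r hadd_0l.
  - by rewrite comp_addr !comp_assoc pr1_in1 pr1_in2 comp_0l hadd_0r comp_idl.
Qed.

Lemma conf_iso_rev (B : ExactCategory) (X Y Z X' Y' Z' : B)
    (i : hom X Y) (p : hom Y Z) (i' : hom X' Y') (p' : hom Y' Z')
    (a : hom X' X) (b : hom Y' Y) (d : hom Z' Z) :
  is_iso a -> is_iso b -> is_iso d -> i ∘ a ≈ b ∘ i' -> p ∘ b ≈ d ∘ p' ->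
  conflation i p -> conflation i' p'.
Proof.
  move=> /iso_inv_r [a' [ia [a1 a2]]] /iso_inv_r [b' [ib [b1 b2]]].
  move=> /iso_inv_r [d' [id' [d1 d2]]] e1 e2; apply: (conf_iso ia ib id').
  - by rewrite -(comp_idr i) -a2 (comp_assoc i) e1 !comp_assoc b1 comp_idl.
  - by rewrite -(comp_idr p) -b2 (comp_assoc p) e2 !comp_assoc d1 comp_idl.
Qed.

Definition op_exact (B : ExactCategory) : ExactCategory.
Proof.
  refine {| ecat := op_add B;
            conflation := fun X Y Z (i : @hom (op_cat B) X Y) (p : @hom (op_cat B) Y Z) =>
              @conflation B Z Y X p i |}.
  - move=> X Y Z i p h; exact: (op_cokernel (conf_cokernel h)).
  - move=> X Y Z i p h; exact: (op_kernel (conf_kernel h)).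
  - move=> X Y Z X' Y' Z' i p i' p' a b d ha hb hd e1 e2.
    apply: (@conf_iso_rev B); [exact: op_iso hd | exact: op_iso hb | exact: op_iso ha | | ].
    + exact: e2.
    + exact: e1.
  - move=> X Y; exact: (conf_split_op X Y).
  - move=> X Y Z i j h1 h2; exact: (deflation_comp h2 h1).
  - move=> X Y Z i j h1 h2; exact: (inflation_comp h2 h1).
  - move=> X Y Z i f h; exact: (deflation_pullback f h).
  - move=> X Y Z i f h; exact: (inflation_pushout f h).
Defined.

Lemma idm_iso (C : Category) (X : C) : is_iso (idm X).
Proof. by exists (idm X); rewrite comp_idl. Qed.
#[export] Hint Resolve idm_iso : core.

Section ExactFacts.
Variable B : ExactCategory.
Implicit Types X Y Z T : B.

Lemma conf_comp0 X Y Z (i : hom X Y) (p : hom Y Z) :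
  conflation i p -> p ∘ i ≈ hzero X Z.
Proof. by move=> /conf_kernel /kernelP []. Qed.

Lemma defl_epi X Y Z T (i : hom X Y) (p : hom Y Z) (a b : hom Z T) :
  conflation i p -> a ∘ p ≈ b ∘ p -> a ≈ b.
Proof.
  move=> h e; have e0 := conf_comp0 h.
  have [_ h2] := proj1 (cokernelP _ _) (conf_cokernel h).
  have [|u [_ hu]] := h2 T (b ∘ p); first by rewrite -comp_assoc e0 comp_0r.
  by rewrite (hu a e) (hu b).
Qed.

Lemma infl_mono X Y Z T (i : hom X Y) (p : hom Y Z) (a b : hom T X) :
  conflation i p -> i ∘ a ≈ i ∘ b -> a ≈ b.
Proof.
  move=> h e; have e0 := conf_comp0 h.
  have [_ h2] := proj1 (kernelP _ _) (conf_kernel h).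
  have [|u [_ hu]] := h2 T (i ∘ b); first by rewrite comp_assoc e0 comp_0l.
  by rewrite (hu a e) (hu b).
Qed.

Lemma conf_factor X Y Z T (i : hom X Y) (p : hom Y Z) (t : hom Y T) :
  conflation i p -> t ∘ i ≈ hzero X T -> exists u : hom Z T, u ∘ p ≈ t.
Proof.
  move=> /conf_cokernel /cokernelP [_ h] e.
  by have [u [hu _]] := h T t e; exists u.
Qed.

Lemma conf_lift X Y Z T (i : hom X Y) (p : hom Y Z) (t : hom T Y) :
  conflation i p -> p ∘ t ≈ hzero T Z -> exists u : hom T X, i ∘ u ≈ t.
Proof.
  move=> /conf_kernel /kernelP [_ h] e.
  by have [u [hu _]] := h T t e; exists u.
Qed.

Lemma cokernel_conf X Y Z (i : hom X Y) (q : hom Y Z) :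
  inflation i -> is_cokernel q i -> conflation i q.
Proof.
  move=> [Z' [p h]] /cokernelP [e0 hq].
  have [z ez] := conf_factor h e0.
  have [z' [ez' _]] := hq Z' p (conf_comp0 h).
  have iz : is_iso z.
  { exists z'; split.
    - by apply: (defl_epi h); rewrite -comp_assoc ez ez' comp_idl.
    - have [u [_ hu]] := hq Z q e0.
      transitivity u; [|symmetry]; apply: hu; last exact: comp_idl.
      by rewrite -comp_assoc ez' ez. }
  apply: (conf_iso (idm_iso _) (idm_iso _) iz _ _ h).
  - by rewrite comp_idl comp_idr.
  - by rewrite ez comp_idr.
Qed.

Lemma pushout_inflation X Y X' Y' (i : hom X Y) (f : hom X X') (f' : hom Y Y')
    (i' : hom X' Y') : inflation i -> is_pushout i f f' i' -> inflation i'.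
Proof.
  move=> hi [e h].
  have [P [g [j [[e' h'] [Q [q hq]]]]]] := inflation_pushout f hi.
  have [z [[z1 z2] _]] := h' _ _ _ e.
  have [z' [[z1' z2'] _]] := h _ _ _ e'.
  have iz : z ∘ z' ≈ idm Y'.
  { have [u [_ hu]] := h _ _ _ e.
    transitivity u; [|symmetry]; apply: hu; try exact: comp_idl.
    - by rewrite -comp_assoc z1' z1.
    - by rewrite -comp_assoc z2' z2. }
  have iz' : z' ∘ z ≈ idm P.
  { have [u [_ hu]] := h' _ _ _ e'.
    transitivity u; [|symmetry]; apply: hu; try exact: comp_idl.
    - by rewrite -comp_assoc z1 z1'.
    - by rewrite -comp_assoc z2 z2'. }
  exists Q, (q ∘ z').
  have hz : is_iso z by exists z'.
  apply: (conf_iso (idm_iso _) hz (idm_iso _) _ _ hq).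
  - by rewrite z2 comp_idr.
  - by rewrite -comp_assoc iz' comp_idl comp_idr.
Qed.

Lemma pushout_conf X Y Z X' Y' (i : hom X Y) (p : hom Y Z) (f : hom X X')
    (f' : hom Y Y') (i' : hom X' Y') :
  conflation i p -> is_pushout i f f' i' ->
  exists p' : hom Y' Z, conflation i' p' /\ p' ∘ f' ≈ p.
Proof.
  move=> hc hpo; have hi : inflation i by exists Z, p.
  have hi' := pushout_inflation hi hpo.
  case: hpo => e h.
  have [|p' [[e1 e2] _]] := h Z p (hzero X' Z); first by rewrite (conf_comp0 hc) comp_0l.
  exists p'; split=> //; apply: cokernel_conf => //.
  apply/cokernelP; split=> // T t et.
  have [|u hu] := @conf_factor _ _ _ T _ _ (t ∘ f') hc.
  { by rewrite -comp_assoc e comp_assoc et comp_0l. }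
  exists u; split.
  - have [|z [_ hz]] := h T (t ∘ f') (hzero X' T).
    { by rewrite -comp_assoc e comp_assoc et !comp_0l. }
    transitivity z; [|symmetry]; apply: hz => //.
    + by rewrite -comp_assoc e1.
    + by rewrite -comp_assoc e2 comp_0r.
  - move=> u' hu'; apply: (defl_epi hc).
    by rewrite hu -hu' -comp_assoc e1.
Qed.

Lemma noether_conf X Y Z D P (i : hom X Y) (p : hom Y Z) (j : hom Y D)
    (d : hom D P) (k : hom Z P) :
  conflation i p -> inflation j -> is_pushout j p d k -> conflation (j ∘ i) d.
Proof.
  move=> hc hj [e h]; apply: cokernel_conf.
  { by apply: inflation_comp => //; exists Z, p. }
  apply/cokernelP; split.
  { by rewrite comp_assoc e -comp_assoc (conf_comp0 hc) comp_0r. }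
  move=> T t et.
  have [|y hy] := @conf_factor _ _ _ T _ _ (t ∘ j) hc; first by rewrite -comp_assoc.
  have [|z [[z1 z2] hz]] := h T t y; first by rewrite hy.
  exists z; split=> // z' hz'; apply: hz => //.
  by apply: (defl_epi hc); rewrite hy -comp_assoc -e comp_assoc hz'.
Qed.

End ExactFacts.

Section ExactFactsOp.
Variable B : ExactCategory.
Implicit Types X Y Z T : B.

Lemma pullback_deflation Y Z Y' Z' (p : hom Y Z) (f : hom Z' Z) (f' : hom Y' Y)
    (p' : hom Y' Z') : deflation p -> is_pullback p f f' p' -> deflation p'.
Proof. exact: (@pushout_inflation (op_exact B)). Qed.

Lemma pullback_conf X Y Z Y' Z' (i : hom X Y) (p : hom Y Z) (f : hom Z' Z)
    (f' : hom Y' Y) (p' : hom Y' Z') :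
  conflation i p -> is_pullback p f f' p' ->
  exists i' : hom X Y', conflation i' p' /\ f' ∘ i' ≈ i.
Proof. exact: (@pushout_conf (op_exact B) Z Y X). Qed.

Lemma noether_conf_op X Y Z D P (i : hom X Y) (p : hom Y Z) (x : hom D Y)
    (d : hom P D) (k : hom P X) :
  conflation i p -> deflation x -> is_pullback x i d k -> conflation d (p ∘ x).
Proof. exact: (@noether_conf (op_exact B) Z Y X D P p i x d k). Qed.

Lemma section_complement X Y Z (i : hom X Y) (p : hom Y Z) (s : hom Z Y) :
  conflation i p -> p ∘ s ≈ idm Z ->
  exists r : hom Y X, r ∘ i ≈ idm X /\ r ∘ s ≈ hzero Z X /\ i ∘ r + s ∘ p ≈ idm Y.
Proof.
  move=> h es.
  have [|r hr] := @conf_lift _ _ _ _ Y _ _ (idm Y - s ∘ p) h.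
  { by rewrite hsub_comp_r comp_assoc es comp_idr comp_idl; apply/hsub_eq0. }
  exists r; split; [|split].
  - apply: (infl_mono h); rewrite comp_assoc hr hsub_comp_l -comp_assoc.
    by rewrite (conf_comp0 h) comp_0r hsub_0r comp_idl comp_idr.
  - apply: (infl_mono h); rewrite comp_assoc hr hsub_comp_l -comp_assoc es.
    by rewrite comp_0r comp_idl comp_idr; apply/hsub_eq0.
  - by rewrite hr -hadd_assoc hadd_oppl hadd_0r.
Qed.

Lemma section_sum X Y Z (i : hom X Y) (p : hom Y Z) (s : hom Z Y) :
  conflation i p -> p ∘ s ≈ idm Z -> isomorphic Y (Z ⊕ X) /\ isomorphic Y (X ⊕ Z).
Proof.
  move=> h es; have [r [r1 [r2 r3]]] := section_complement h es.
  have e0 := conf_comp0 h.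
  split.
  - exists (in1 Z X ∘ p + in2 Z X ∘ r), (s ∘ pr1 Z X + i ∘ pr2 Z X); split.
    + rewrite comp_addl !comp_addr -!comp_assoc.
      rewrite !(comp_assoc (pr1 Z X)) !(comp_assoc (pr2 Z X)).
      rewrite pr1_in1 pr1_in2 pr2_in1 pr2_in2 !comp_0l !comp_0r !comp_idl hadd_0l hadd_0r.
      by rewrite hadd_comm.
    + rewrite comp_addl !comp_addr -!comp_assoc.
      rewrite !(comp_assoc p) !(comp_assoc r) es e0 r1 r2.
      by rewrite !comp_0l !comp_0r !comp_idl hadd_0l hadd_0r bip_id.
  - exists (in1 X Z ∘ r + in2 X Z ∘ p), (i ∘ pr1 X Z + s ∘ pr2 X Z); split.
    + rewrite comp_addl !comp_addr -!comp_assoc.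
      rewrite !(comp_assoc (pr1 X Z)) !(comp_assoc (pr2 X Z)).
      by rewrite pr1_in1 pr1_in2 pr2_in1 pr2_in2 !comp_0l !comp_0r !comp_idl hadd_0l hadd_0r.
    + rewrite comp_addl !comp_addr -!comp_assoc.
      rewrite !(comp_assoc p) !(comp_assoc r) es e0 r1 r2.
      by rewrite !comp_0l !comp_0r !comp_idl hadd_0l hadd_0r bip_id.
Qed.

Lemma ext1_zero_section X Z : ext1_zero Z X <->
  forall Y (i : hom X Y) (p : hom Y Z), conflation i p -> exists s, p ∘ s ≈ idm Z.
Proof.
  split=> h Y i p hc.
  - have [f [[g [g1 g2]] [h1 h2]]] := h _ _ _ hc.
    exists (g ∘ in2 X Z); rewrite -h2 -comp_assoc (comp_assoc f) g2 comp_idl.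
    exact: pr2_in2.
  - have [s es] := h _ _ _ hc.
    have [r [r1 [r2 r3]]] := section_complement hc es.
    have e0 := conf_comp0 hc.
    exists (in1 X Z ∘ r + in2 X Z ∘ p); split; [|split].
    + exists (i ∘ pr1 X Z + s ∘ pr2 X Z); split.
      * rewrite comp_addl !comp_addr -!comp_assoc.
        rewrite !(comp_assoc (pr1 X Z)) !(comp_assoc (pr2 X Z)).
        by rewrite pr1_in1 pr1_in2 pr2_in1 pr2_in2 !comp_0l !comp_0r !comp_idl hadd_0l hadd_0r.
      * rewrite comp_addl !comp_addr -!comp_assoc.
        rewrite !(comp_assoc p) !(comp_assoc r) es e0 r1 r2.
        by rewrite !comp_0l !comp_0r !comp_idl hadd_0l hadd_0r bip_id.
    + by rewrite comp_addl -!comp_assoc r1 e0 comp_0r hadd_0r comp_idr.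
    + by rewrite comp_addr !comp_assoc pr2_in1 pr2_in2 comp_0l hadd_0l comp_idl.
Qed.

End ExactFactsOp.

Lemma ext1_zero_op (B : ExactCategory) (X Z : B) : @ext1_zero B Z X -> @ext1_zero (op_exact B) X Z.
Proof.
  move=> /ext1_zero_section h; apply/ext1_zero_section => Y p i hc.
  have [s es] := h Y i p hc.
  by have [r [r1 _]] := @section_complement B X Y Z i p s hc es; exists r.
Qed.

Lemma ext1_lift (B : ExactCategory) (U V W Y : B) (v : hom V W) (w : hom W Y) (f : hom U Y) :
  ext1_zero U V -> conflation v w -> exists g : hom U W, w ∘ g ≈ f.
Proof.
  move=> /ext1_zero_section h hc.
  have [|P [f' [w' [hpb hd]]]] := @deflation_pullback B _ _ _ w f; first by exists V, v.
  have [v' [hc' e1]] := pullback_conf hc hpb.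
  have [s es] := h _ _ _ hc'.
  by exists (f' ∘ s); rewrite comp_assoc (proj1 hpb) -comp_assoc es comp_idr.
Qed.

Lemma ext1_extend (B : ExactCategory) (U V X Y : B) (i : hom X Y) (p : hom Y U)
    (f : hom X V) :
  ext1_zero U V -> conflation i p -> exists g : hom Y V, g ∘ i ≈ f.
Proof. move=> /ext1_zero_op; exact: (@ext1_lift (op_exact B)). Qed.

Lemma op_isomorphic (C : Category) (X Y : C) :
  @isomorphic (op_cat C) X Y -> isomorphic X Y.
Proof. by move=> [f [g [h1 h2]]]; exists g, f. Qed.

Definition op_cotorsion (B : ExactCategory) (c : CotorsionPair B) :
  CotorsionPair (op_exact B).
Proof.
  refine {| cU := (@cV B c : op_exact B -> Prop);
            cV := (@cU B c : op_exact B -> Prop) |}.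
  - exact: (cV_additive c).
  - exact: (cU_additive c).
  - move=> X Y Z /op_isomorphic; exact: (@cV_summand B c).
  - move=> X Y Z /op_isomorphic; exact: (@cU_summand B c).
  - move=> X Y hX hY; apply: ext1_zero_op; exact: (cotorsion_ext hY hX).
  - move=> X; have [V [U [v [u [h1 [h2 h3]]]]]] := cotorsion_left c X.
    by exists U, V, u, v.
  - move=> X; have [V [U [v [u [h1 [h2 h3]]]]]] := cotorsion_right c X.
    by exists U, V, u, v.
Defined.

Section CotorsionFacts.
Variables (B : ExactCategory) (c : CotorsionPair B).
Implicit Types X Y Z T U V : B.

Lemma U_lift U V W Y (v : hom V W) (w : hom W Y) (f : hom U Y) :
  cU c U -> cV c V -> conflation v w -> exists g : hom U W, w ∘ g ≈ f.
Proof. move=> hU hV; exact: ext1_lift (cotorsion_ext hU hV). Qed.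

Lemma V_extend U V X Y (i : hom X Y) (p : hom Y U) (f : hom X V) :
  cU c U -> cV c V -> conflation i p -> exists g : hom Y V, g ∘ i ≈ f.
Proof. move=> hU hV; exact: ext1_extend (cotorsion_ext hU hV). Qed.

Lemma U_of_section X Y Z (i : hom X Y) (p : hom Y Z) (s : hom Z Y) :
  cU c Y -> conflation i p -> p ∘ s ≈ idm Z -> cU c Z.
Proof.
  move=> hY h es; have [h1 _] := section_sum h es.
  exact: (cU_summand h1 hY).
Qed.

Lemma U_of_ext X : (forall V, cV c V -> ext1_zero X V) -> cU c X.
Proof.
  move=> h; have [V [U [v [u [hV [hU hc]]]]]] := cotorsion_right c X.
  have [s es] := proj1 (ext1_zero_section _ _) (h V hV) _ _ _ hc.
  exact: (U_of_section hU hc es).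
Qed.

Lemma U_extension U X U' (i : hom U X) (p : hom X U') :
  conflation i p -> cU c U -> cU c U' -> cU c X.
Proof.
  move=> hc hU hU'; apply: U_of_ext => V hV; apply/ext1_zero_section => P v x hx.
  have hdx : deflation x by exists V, v.
  have [P' [d [k [hpb _]]]] := deflation_pullback i hdx.
  have hd := noether_conf_op hc hdx hpb.
  have [v' [hv' e1]] := pullback_conf hx hpb.
  have [s es] := proj1 (ext1_zero_section _ _) (cotorsion_ext hU hV) _ _ _ hv'.
  have [r' [r1 _]] := section_complement hv' es.
  have [r er] := V_extend r' hU' hV hd.
  have erv : r ∘ v ≈ idm V by rewrite -e1 comp_assoc er.
  have [|y ey] := @conf_factor B _ _ _ P _ _ (idm P - v ∘ r) hx.
  { by rewrite hsub_comp_l -comp_assoc erv comp_idl comp_idr; apply/hsub_eq0. }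
  exists y; apply: (defl_epi hx).
  rewrite -comp_assoc ey hsub_comp_r comp_assoc (conf_comp0 hx) comp_0l hsub_0r.
  by rewrite comp_idl comp_idr.
Qed.

End CotorsionFacts.

Lemma V_extension (B : ExactCategory) (c : CotorsionPair B) (V X V' : B)
    (i : hom V X) (p : hom X V') : conflation i p -> cV c V -> cV c V' -> cV c X.
Proof. move=> h hV hV'; exact: (@U_extension _ (op_cotorsion c) V' X V p i h hV' hV). Qed.

Lemma op_cW (B : ExactCategory) (c : CotorsionPair B) (X : B) :
  cW (op_cotorsion c) X <-> cW c X.
Proof. by split=> -[h1 h2]. Qed.

Lemma op_cBplus (B : ExactCategory) (c : CotorsionPair B) (X : B) :
  cBplus (op_cotorsion c) X <-> cBminus c X.
Proof.
  split.
  - by move=> [V [W [v [w [h1 [h2 h3]]]]]]; exists W, V, w, v; split=> //; apply/op_cW.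
  - by move=> [V [W [v [w [h1 [h2 h3]]]]]]; exists W, V, w, v; split=> //; split=> //; apply/op_cW.
Qed.

Lemma op_quot_eq (B : ExactCategory) (c : CotorsionPair B) (X Y : B) (f g : hom X Y) :
  @quot_eq (op_exact B) (cW (op_cotorsion c)) Y X f g <-> quot_eq (cW c) f g.
Proof.
  by split=> -[Z [hZ [a [b e]]]]; exists Z; (split; first exact/op_cW); exists b, a.
Qed.

Lemma pushout_sym (C : Category) (X Y Z P : C) (f : hom X Y) (g : hom X Z)
    (h : hom Y P) (k : hom Z P) : is_pushout f g h k -> is_pushout g f k h.
Proof.
  move=> [e hp]; split; first by symmetry.
  move=> T x y exy; have [z [[z1 z2] hz]] := hp T y x (symmetry exy).
  by exists z; split=> // z' h1 h2; apply: hz.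
Qed.

Section PlusFacts.
Variables (B : ExactCategory) (c : CotorsionPair B).
Implicit Types X Y Z T U V : B.

Lemma plus_inhabited X : inhabited (PlusData c X).
Proof.
  have [V [U [v [u [hV [hU h1]]]]]] := cotorsion_right c X.
  have [W [U0 [w [q [hW [hU0 h2]]]]]] := cotorsion_left c U.
  have [|P [b [a [hpo _]]]] := @inflation_pushout B _ _ _ w u; first by exists U0, q.
  have hW' : cW c W by split=> //; apply: (U_extension h2).
  exact: (inhabits (MkPlusData hV hU hW' hU0 h1 h2 hpo)).
Qed.

Lemma plus_obj_Bplus X (d : PlusData c X) : cBplus c (plus_obj d).
Proof.
  exists (plus_V d), (plus_W0 d), (plus_w d ∘ plus_v d), (plus_b d).
  split; first exact: plus_hV.
  split; first exact: plus_hW0.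
  apply: (noether_conf (plus_conf1 d) _ (plus_po d)).
  by exists (plus_U0 d), (plus_q d); exact: plus_conf2.
Qed.

Lemma plus_alpha_conf X (d : PlusData c X) :
  exists p : hom (plus_obj d) (plus_U0 d), conflation (plus_alpha d) p.
Proof.
  have [p [hp _]] := pushout_conf (plus_conf2 d) (plus_po d).
  by exists p.
Qed.

Lemma plus_extend X Y (d : PlusData c X) (f : hom X Y) : cBplus c Y ->
  exists g : hom (plus_obj d) Y, g ∘ plus_alpha d ≈ f.
Proof.
  move=> [V [W [v [w [hV [[hWU hWV] hc]]]]]].
  have [l hl] := U_lift (f ∘ plus_u d) (plus_hU d) hV hc.
  have [m hm] := V_extend l (plus_hU0 d) hWV (plus_conf2 d).
  have [|z [[_ hz] _]] := proj2 (plus_po d) Y (w ∘ m) f.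
  { by rewrite -comp_assoc hm. }
  by exists z.
Qed.

Lemma plus_unique X Y (d : PlusData c X) (g g' : hom (plus_obj d) Y) : cBplus c Y ->
  quot_eq (cW c) (g ∘ plus_alpha d) (g' ∘ plus_alpha d) -> quot_eq (cW c) g g'.
Proof.
  move=> [V [W [v [w [hV [hW hc]]]]]] [Z [hZ [a [b e]]]].
  have [p hp] := plus_alpha_conf d.
  have [a' ha'] := V_extend a (plus_hU0 d) (proj2 hZ) hp.
  have [|t ht] := @conf_factor B _ _ _ Y _ _ (g - g' - b ∘ a') hp.
  { by rewrite hsub_comp_l hsub_comp_l e -comp_assoc ha'; apply/hsub_eq0. }
  have [l hl] := U_lift t (plus_hU0 d) hV hc.
  have hW' := cW_additive c.
  have e1 : quot_eq (cW c) (b ∘ a') (hzero _ _).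
  { by exists Z; split=> //; exists a', b; rewrite hsub_0r. }
  have e2 : quot_eq (cW c) (w ∘ (l ∘ p)) (hzero _ _).
  { by exists W; split=> //; exists (l ∘ p), w; rewrite hsub_0r. }
  have [T [hT [x [y exy]]]] := quot_eq_add hW' e2 e1.
  exists T; split=> //; exists x, y; rewrite -exy comp_assoc hl ht.
  by rewrite hadd_0l hsub_0r -hadd_assoc hadd_oppl hadd_0r.
Qed.

Lemma plus_obj_Bminus X (d : PlusData c X) : cBminus c X -> cBminus c (plus_obj d).
Proof.
  move=> [W [U [w [u [hW [hU hc]]]]]].
  have [p hp] := plus_alpha_conf d.
  have [|P [f' [i' [hpo _]]]] := @inflation_pushout B _ _ _ w (plus_alpha d).
  { by exists U, u. }
  have [p' [hc1 _]] := pushout_conf hc hpo.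
  have [r [hc2 _]] := pushout_conf hp (pushout_sym hpo).
  have hP : cU c P := U_extension hc2 (proj1 hW) (plus_hU0 d).
  have [V [U' [v [q [hV [hU' h2]]]]]] := cotorsion_left c P.
  have hW' : cW c V by split=> //; apply: (U_extension h2).
  have hv : inflation v by exists U', q.
  have [C [e [k [hpo2 _]]]] := inflation_pushout p' hv.
  have hce := noether_conf hc1 hv hpo2.
  have [s [hc3 _]] := pushout_conf h2 hpo2.
  exists V, C, (v ∘ i'), e; split=> //; split=> //.
  exact: (U_extension hc3 hU hU').
Qed.

Lemma U_to_Bplus X Y (f : hom X Y) : cU c X -> cBplus c Y ->
  quot_eq (cW c) f (hzero X Y).
Proof.
  move=> hX [V [W [v [w [hV [hW hc]]]]]].
  have [l hl] := U_lift f hX hV hc.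
  by exists W; split=> //; exists l, w; rewrite hsub_0r hl.
Qed.

Lemma Bminus_UV X U V (i : hom U X) (p : hom X V) :
  cBminus c X -> cU c U -> cV c V -> conflation i p -> cU c X.
Proof.
  move=> [W [U' [w [u [hW [hU' hc]]]]]] hU hV hx.
  have [e' he'] := V_extend p hU' hV hc.
  have [V' [U2 [v [q [hV' [hU2 h2]]]]]] := cotorsion_right c V.
  have [l hl] := U_lift e' (proj1 hW) hV' h2.
  have hp : deflation p by exists U, i.
  have [X' [f' [p' [hpb _]]]] := deflation_pullback q hp.
  have [i' [hc' _]] := pullback_conf hx hpb.
  have hX' : cU c X' := U_extension hc' hU hU2.
  have hpb' : is_pullback q p p' f' := @pushout_sym (op_cat B) _ _ _ _ _ _ _ _ hpb.
  have [j [hj _]] := pullback_conf h2 hpb'.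
  have [|s [[s1 _] _]] := proj2 hpb X (idm X) (l ∘ w).
  { by rewrite comp_idr comp_assoc hl he'. }
  exact: (U_of_section hX' hj s1).
Qed.

End PlusFacts.

Section MinusFacts.
Variables (B : ExactCategory) (c : CotorsionPair B).
Implicit Types X Y Z T U V : B.

Definition minus_of_plus_op X (d : PlusData (op_cotorsion c) (X : op_exact B)) :
  MinusData c X :=
  @MkMinusData B c X (plus_V d) (plus_U d) (plus_W0 d) (plus_U0 d) (plus_obj d)
    (plus_v d) (plus_u d) (plus_w d) (plus_q d) (plus_b d) (plus_alpha d)
    (plus_hV d) (plus_hU d) (proj1 (op_cW c _) (plus_hW0 d)) (plus_hU0 d)
    (plus_conf1 d) (plus_conf2 d) (plus_po d).

Definition plus_op_of_minus X (d : MinusData c X) :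
  PlusData (op_cotorsion c) (X : op_exact B) :=
  @MkPlusData (op_exact B) (op_cotorsion c) X
    (minus_U d) (minus_V d) (minus_W0 d) (minus_V0 d) (minus_obj d)
    (minus_u d) (minus_v d) (minus_w d) (minus_q d) (minus_b d) (minus_gamma d)
    (minus_hU d) (minus_hV d) (proj2 (op_cW c _) (minus_hW0 d)) (minus_hV0 d)
    (minus_conf1 d) (minus_conf2 d) (minus_pb d).

Lemma minus_inhabited X : inhabited (MinusData c X).
Proof.
  have [d] := plus_inhabited (op_cotorsion c) (X : op_exact B).
  exact: (inhabits (minus_of_plus_op d)).
Qed.

Lemma minus_obj_Bminus X (d : MinusData c X) : cBminus c (minus_obj d).
Proof. apply/op_cBplus; exact: (plus_obj_Bplus (plus_op_of_minus d)). Qed.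

Lemma minus_lift X Y (d : MinusData c X) (f : hom Y X) : cBminus c Y ->
  exists g : hom Y (minus_obj d), minus_gamma d ∘ g ≈ f.
Proof.
  move=> /op_cBplus hY.
  exact: (@plus_extend (op_exact B) (op_cotorsion c) X Y (plus_op_of_minus d) f hY).
Qed.

Lemma minus_unique X Y (d : MinusData c X) (g g' : hom Y (minus_obj d)) : cBminus c Y ->
  quot_eq (cW c) (minus_gamma d ∘ g) (minus_gamma d ∘ g') -> quot_eq (cW c) g g'.
Proof.
  move=> /op_cBplus hY /op_quot_eq e; apply/op_quot_eq.
  exact: (@plus_unique (op_exact B) (op_cotorsion c) X Y (plus_op_of_minus d) g g' hY e).
Qed.

Lemma minus_gamma_conf X (d : MinusData c X) :
  exists i : hom (minus_V0 d) (minus_obj d), conflation i (minus_gamma d).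
Proof. exact: (plus_alpha_conf (plus_op_of_minus d)). Qed.

Lemma minus_obj_UV X (d : MinusData c X) U V (i : hom U X) (p : hom X V) :
  cU c U -> cV c V -> conflation i p -> cU c (minus_obj d).
Proof.
  move=> hU hV hc; have [j hj] := minus_gamma_conf d.
  have hg : deflation (minus_gamma d) by exists (minus_V0 d), j.
  have [P [k [g' [hpb _]]]] := deflation_pullback i hg.
  have [j' [hj' _]] := pullback_conf hj hpb.
  have hk := noether_conf_op hc hg hpb.
  have [s es] := U_lift (idm U) hU (minus_hV0 d) hj'.
  have [r [r1 [r2 r3]]] := section_complement hj' es.
  have hs : conflation s r.
  { apply: (conf_iso (i := in1 U (minus_V0 d)) (p := pr2 U (minus_V0 d))
      (a := idm U) (b := s ∘ pr1 _ _ + j' ∘ pr2 _ _) (c := idm _)) => //.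
    - exists (in1 _ _ ∘ g' + in2 _ _ ∘ r); split.
      + rewrite comp_addl !comp_addr -!comp_assoc.
        rewrite !(comp_assoc g') !(comp_assoc r) es (conf_comp0 hj') r1 r2.
        by rewrite !comp_0l !comp_0r !comp_idl hadd_0l hadd_0r bip_id.
      + rewrite comp_addl !comp_addr -!comp_assoc.
        rewrite !(comp_assoc (pr1 _ _)) !(comp_assoc (pr2 _ _)).
        rewrite pr1_in1 pr1_in2 pr2_in1 pr2_in2 !comp_0l !comp_0r !comp_idl hadd_0l hadd_0r.
        by rewrite hadd_comm.
    - by rewrite comp_addl -!comp_assoc pr1_in1 pr2_in1 comp_0r hadd_0r.
    - by rewrite comp_addr !comp_assoc r1 r2 comp_0l hadd_0l comp_idl.
    - exact: conf_split. }
  have hik : inflation k by exists V, (p ∘ minus_gamma d).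
  have [V' [e [m [hpo _]]]] := inflation_pushout r hik.
  have hc' := noether_conf hs hik hpo.
  have [q [hm _]] := pushout_conf hk hpo.
  have hV' : cV c V' := V_extension hm (minus_hV0 d) hV.
  exact: (Bminus_UV (minus_obj_Bminus d) hU hV' hc').
Qed.

End MinusFacts.

Section Reflector.
Variables (C : Category) (P : C -> Prop) (R : C -> C).
Variables (hR : forall X, P (R X)) (eta : forall X, hom X (R X)).
Variable extend : forall X Y (f : hom X Y), P Y ->
  exists g : hom (R X) Y, g ∘ eta X ≈ f.
Variable unique : forall X Y (g g' : hom (R X) Y), P Y ->
  g ∘ eta X ≈ g' ∘ eta X -> g ≈ g'.

Definition reflector_map X Y (f : hom X Y) : hom (R X) (R Y) :=
  proj1_sig (constructive_indefinite_description _ (extend (eta Y ∘ f) (hR Y))).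

Lemma reflector_mapE X Y (f : hom X Y) : reflector_map f ∘ eta X ≈ eta Y ∘ f.
Proof using Type. by rewrite /reflector_map; case: constructive_indefinite_description. Qed.

Definition reflector : Functor C (full_sub P).
Proof using C P R hR eta extend unique.
  refine {| fobj := (fun X => exist P (R X) (hR X)) : C -> full_sub P;
            fmap := reflector_map |}.
  - move=> X Y f g e; apply: unique; first exact: hR.
    by rewrite !reflector_mapE e.
  - move=> X; apply: unique; first exact: hR.
    by rewrite reflector_mapE; transitivity (eta X); [exact: comp_idr | symmetry; exact: comp_idl].
  - move=> X Y Z g f; apply: unique; first exact: hR.
    rewrite reflector_mapE; transitivity (reflector_map g ∘ (reflector_map f ∘ eta X)).
    + by rewrite reflector_mapE !comp_assoc reflector_mapE.
    + exact: comp_assoc.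
Defined.

End Reflector.

Section Coreflector.
Variables (C : Category) (P : C -> Prop) (R : C -> C).
Variables (hR : forall X, P (R X)) (eps : forall X, hom (R X) X).
Variable lift : forall X Y (f : hom Y X), P Y ->
  exists g : hom Y (R X), eps X ∘ g ≈ f.
Variable unique : forall X Y (g g' : hom Y (R X)), P Y ->
  eps X ∘ g ≈ eps X ∘ g' -> g ≈ g'.

Definition coreflector_map X Y (f : hom X Y) : hom (R X) (R Y) :=
  proj1_sig (constructive_indefinite_description _ (lift (f ∘ eps X) (hR X))).

Lemma coreflector_mapE X Y (f : hom X Y) : eps Y ∘ coreflector_map f ≈ f ∘ eps X.
Proof using Type. by rewrite /coreflector_map; case: constructive_indefinite_description. Qed.

Definition coreflector : Functor C (full_sub P).
Proof using C P R hR eps lift unique.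
  refine {| fobj := (fun X => exist P (R X) (hR X)) : C -> full_sub P;
            fmap := coreflector_map |}.
  - move=> X Y f g e; apply: unique; first exact: hR.
    by rewrite !coreflector_mapE e.
  - move=> X; apply: unique; first exact: hR.
    by rewrite coreflector_mapE; transitivity (eps X); [exact: comp_idl | symmetry; exact: comp_idr].
  - move=> X Y Z g f; apply: unique; first exact: hR.
    rewrite coreflector_mapE; transitivity (eps Z ∘ coreflector_map g ∘ coreflector_map f).
    + by rewrite coreflector_mapE -!comp_assoc coreflector_mapE.
    + symmetry; exact: comp_assoc.
Defined.

End Coreflector.

Section HalfExactFunctor.
Variables (B : ExactCategory) (c : CotorsionPair B).

Definition plus_data (X : B) : PlusData c X :=
  proj1_sig (constructive_indefinite_description (fun _ => True)
    (match plus_inhabited c X with inhabits d => ex_intro _ d I end)).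

Definition minus_data (X : B) : MinusData c X :=
  proj1_sig (constructive_indefinite_description (fun _ => True)
    (match minus_inhabited c X with inhabits d => ex_intro _ d I end)).

Lemma sigma_plus_extend (X Y : quotW c) (f : hom X Y) : cBplus c Y ->
  exists g : @hom (quotW c) (plus_obj (plus_data X)) Y, g ∘ plus_alpha (plus_data X) ≈ f.
Proof.
  move=> hY; have [g hg] := plus_extend (plus_data X) f hY.
  by exists g; apply: quot_eq_heq => //; exact: cW_additive.
Qed.

Lemma sigma_minus_lift (X Y : quotW c) (f : hom Y X) : cBminus c Y ->
  exists g : @hom (quotW c) Y (minus_obj (minus_data X)),
    @comp (quotW c) _ _ _ (minus_gamma (minus_data X)) g ≈ f.
Proof.
  move=> hY; have [g hg] := minus_lift (minus_data X) f hY.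
  by exists g; apply: quot_eq_heq => //; exact: cW_additive.
Qed.

Definition sigma_plus : Functor (quotW c) (full_sub (cBplus c : quotW c -> Prop)) :=
  @reflector (quotW c) (cBplus c) (fun X => plus_obj (plus_data X))
    (fun X => plus_obj_Bplus (plus_data X)) (fun X => plus_alpha (plus_data X))
    sigma_plus_extend (fun X Y => @plus_unique B c X Y (plus_data X)).

Definition sigma_minus : Functor (quotW c) (full_sub (cBminus c : quotW c -> Prop)) :=
  @coreflector (quotW c) (cBminus c) (fun X => minus_obj (minus_data X))
    (fun X => minus_obj_Bminus (minus_data X)) (fun X => minus_gamma (minus_data X))
    sigma_minus_lift (fun X Y => @minus_unique B c X Y (minus_data X)).

Definition sigma_sigma : Functor B (quotW c) :=
  functor_comp (full_incl (cBplus c : quotW c -> Prop))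
    (functor_comp sigma_plus
      (functor_comp (full_incl (cBminus c : quotW c -> Prop))
        (functor_comp sigma_minus (quot_proj (cW_additive c))))).

Lemma sigma_sigma_H (X : B) : cH c (sigma_sigma X).
Proof.
  split; first exact: plus_obj_Bplus.
  apply: plus_obj_Bminus; exact: minus_obj_Bminus.
Qed.

(** H = σ⁺ σ⁻ π. *)
Definition half_exact : Functor B (heart c) :=
  @functor_into B (quotW c) (cH c) sigma_sigma sigma_sigma_H.

Lemma sigma_plus_add (X Y : B) (f g : hom X Y) :
  quot_eq (cW c) (@fmap _ _ sigma_plus X Y (f + g))
    ((@fmap _ _ sigma_plus X Y f : @hom B _ _) + @fmap _ _ sigma_plus X Y g).
Proof.
  apply: (plus_unique (d := plus_data X)); first exact: plus_obj_Bplus.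
  have E h := @reflector_mapE (quotW c) (cBplus c) (fun X => plus_obj (plus_data X))
    (fun X => plus_obj_Bplus (plus_data X)) (fun X => plus_alpha (plus_data X))
    sigma_plus_extend X Y h.
  have hW := cW_additive c.
  apply: (quot_eq_trans hW (E (f + g))).
  apply: (quot_eq_trans hW (quot_eq_heq hW (comp_addr _ _ _))).
  apply: (quot_eq_trans hW (quot_eq_add hW (quot_eq_sym (E f)) (quot_eq_sym (E g)))).
  by apply: quot_eq_heq => //; rewrite comp_addl.
Qed.

Lemma sigma_minus_add (X Y : B) (f g : hom X Y) :
  quot_eq (cW c) (@fmap _ _ sigma_minus X Y (f + g))
    ((@fmap _ _ sigma_minus X Y f : @hom B _ _) + @fmap _ _ sigma_minus X Y g).
Proof.
  apply: (minus_unique (d := minus_data Y)); first exact: minus_obj_Bminus.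
  have E h := @coreflector_mapE (quotW c) (cBminus c) (fun X => minus_obj (minus_data X))
    (fun X => minus_obj_Bminus (minus_data X)) (fun X => minus_gamma (minus_data X))
    sigma_minus_lift X Y h.
  have hW := cW_additive c.
  apply: (quot_eq_trans hW (E (f + g))).
  apply: (quot_eq_trans hW (quot_eq_heq hW (comp_addl _ _ _))).
  apply: (quot_eq_trans hW (quot_eq_add hW (quot_eq_sym (E f)) (quot_eq_sym (E g)))).
  by apply: quot_eq_heq => //; rewrite comp_addr.
Qed.

Lemma half_exact_add (X Y : B) (f g : hom X Y) :
  quot_eq (cW c) (fmap half_exact (f + g))
    ((fmap half_exact f : @hom B _ _) + fmap half_exact g).
Proof.
  apply: (quot_eq_trans (cW_additive c) _ (sigma_plus_add _ _)).
  exact: (fmap_heq sigma_plus (sigma_minus_add f g)).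
Qed.

Lemma half_exact_UV (X U V : B) (i : hom U X) (p : hom X V) :
  cU c U -> cV c V -> conflation i p ->
  quot_eq (cW c) (fmap half_exact (idm X)) (hzero _ _).
Proof.
  move=> hU hV hc; have hW := cW_additive c.
  have hM := minus_obj_UV (minus_data X) hU hV hc.
  set M := minus_obj (minus_data X) in hM.
  apply: (quot_eq_trans hW (fmap_id half_exact X)).
  apply: (plus_unique (d := plus_data M)); first exact: plus_obj_Bplus.
  have hB := plus_obj_Bplus (plus_data M).
  apply: (quot_eq_trans hW (U_to_Bplus _ hM hB)).
  apply: quot_eq_sym; exact: (U_to_Bplus _ hM hB).
Qed.

Lemma comp_quot_0 (X Y Z T : B) (h : hom Z T) (g : hom Y Z) (f : hom X Y) :
  quot_eq (cW c) g (hzero Y Z) -> quot_eq (cW c) (h ∘ (g ∘ f)) (hzero X T).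
Proof.
  move=> e; have hW := cW_additive c.
  apply: (quot_eq_trans hW (quot_eq_compl h (quot_eq_compr f e))).
  by apply: quot_eq_heq => //; rewrite comp_0l comp_0r.
Qed.

Lemma half_exact_0 (X Y Z T : B) (h : hom Z T) (f : hom X Z) :
  quot_eq (cW c) (fmap half_exact (idm Z)) (hzero _ _) ->
  quot_eq (cW c) (fmap half_exact (h ∘ f)) (hzero _ _).
Proof.
  move=> e; have hW := cW_additive c.
  have e1 : h ∘ f ≈ h ∘ (idm Z ∘ f) by rewrite comp_idl.
  apply: (quot_eq_trans hW (fmap_heq half_exact e1)).
  apply: (quot_eq_trans hW (fmap_comp half_exact h (idm Z ∘ f))).
  apply: (quot_eq_trans hW
    (quot_eq_compl (fmap half_exact h) (fmap_comp half_exact (idm Z) f))).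
  exact: comp_quot_0.
Qed.

Lemma half_exact_K (X : B) : cK c X ->
  quot_eq (cW c) (fmap half_exact (idm X)) (hzero _ _).
Proof.
  move=> [Y [U [V [i [p [hU [hV hc]]]]]]]; have hW := cW_additive c.
  apply: (quot_eq_trans hW (fmap_heq half_exact (symmetry (pr1_in1 X Y)))).
  apply: half_exact_0 => //; exact: (half_exact_UV hU hV hc).
Qed.

Lemma half_exact_ideal (W : B -> Prop) (hW : forall X, W X -> cK c X)
    (X Y : B) (f g : hom X Y) :
  quot_eq W f g -> fmap half_exact f ≈ fmap half_exact g.
Proof.
  move=> [Z [hZ [a [b e]]]]; have hc := cW_additive c.
  have e1 : f ≈ g + b ∘ a.
  { by rewrite -e hadd_comm -hadd_assoc hadd_oppl hadd_0r. }
  apply: (quot_eq_trans hc (fmap_heq half_exact e1)).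
  apply: (quot_eq_trans hc (half_exact_add g (b ∘ a))).
  apply: (quot_eq_trans hc (quot_eq_add hc (quot_eq_heq hc (reflexivity _)) _)).
  - by apply: half_exact_0 => //; apply: half_exact_K; apply: hW.
  - by apply: quot_eq_heq => //; rewrite hadd_0r.
Qed.

Lemma cW_cK (X : B) : cW c X -> cK c X.
Proof.
  move=> [hX _]; exists zobj, X, zobj, (in1 X zobj), (pr2 X zobj).
  split=> //; split; first exact: (proj1 (cV_additive c)).
  exact: conf_split.
Qed.

End HalfExactFunctor.

Section Beta.
Variables (B : ExactCategory) (ci cj : CotorsionPair B).
Variable hW : forall X : B, cW ci X -> cK cj X.

Definition h_functor : Functor (quotW ci) (heart cj) :=
  quot_descend (cW_additive ci) (half_exact_ideal hW).

Definition beta : Functor (heart ci) (heart cj) :=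
  functor_comp h_functor (heart_incl ci).

End Beta.

(* Main.v *)
From Stdlib Require Import Setoid Morphisms RelationClasses ClassicalEpsilon.
From Stdlib Require Import ssreflect.
Require Import Defs.

(** Fix one cotorsion pair (U, V), with half exact functor H, and the span
    X <- X⁻ -> H X.  Two constructions turn H into a tool for exactness.  If
    M ↣ W ↠ U is a conflation with W in W and U in U, and C is its pushout
    along f : M -> X, then H X -> H C is a cokernel of H f
    ([half_exact_cokernel]): a morphism from X to an object of the heart that
    dies on M modulo W extends to C, because Ext¹(U, W) = 0.  Dually, pullbacks
    of V ↣ W ↠ N compute kernels ([half_exact_kernel]).  Moreover H X is zero
    exactly when X lies in K ([half_exact_zero]), and a morphism of the heart
    with zero kernel and zero cokernel is invertible ([heart_balanced]), since
    it then fits into a conflation with outer terms in V and U, which splits.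

    The record [heart_functor] collects these properties.  It is self-dual, so
    each of its consequences yields a dual one.  The main consequences are that
    a conflation A ↣ B ↠ C with F C zero is sent to an epimorphism F A -> F B,
    and that F C is the cokernel of F A -> F B as soon as F B -> F C is an
    epimorphism.

    Now let K₂ be contained in K₁.  Then H₁ kills U₂ and V₂.  The morphism
    X⁻ -> X of the second pair has its kernel in V₂, and X⁻ ↣ W₀ ⊕ X has its
    cokernel in V₂; so H₁ inverts X⁻ -> X, and dually X -> X⁺.  It follows that
    H₁ applied to X <- X⁻ -> H₂ X gives β₂₁ H₂ ≅ H₁ ([beta_half_exact]), and (a)
    is the restriction of this isomorphism to the first heart.  Likewise H₁
    sends the pushout and pullback squares of the second pair to cokernels and
    kernels, so that β₂₁ is exact.  As β₂₁ vanishes exactly on the objects in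
    K₁, these form a Serre subcategory, and the morphisms with kernel and
    cokernel in it are those that β₂₁ inverts.  Hence β₂₁ factors through the
    localization, where β₁₂ is inverse to it: H₂ sends the span Y <- Y⁻ -> H₁ Y
    of the first pair to two morphisms inverted by β₂₁, and this connects
    H₂ Y ≅ Y to β₁₂ β₂₁ Y. *)

Set Implicit Arguments.
Unset Strict Implicit.
Local Open Scope cat_scope.

(** * Zero morphisms, kernels and cokernels in a plain category *)

(** Monomorphisms and epimorphisms, tested against zero morphisms only, because
    a heart carries no chosen addition of morphisms. *)
Definition zmono (C : Category) (X Y : C) (f : hom X Y) : Prop :=
  forall (T : C) (t : hom T X), zero_mor (f ∘ t) -> zero_mor t.

Definition zepi (C : Category) (X Y : C) (f : hom X Y) : Prop :=
  forall (T : C) (t : hom Y T), zero_mor (t ∘ f) -> zero_mor t.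

Section PlainCategory.
Variable C : Category.
Implicit Types X Y Z T : C.

Lemma zero_mor_heq X Y (f g : hom X Y) : f ≈ g -> zero_mor f -> zero_mor g.
Proof.
  by move=> e [Z [hZ [a [b h]]]]; exists Z; split=> //; exists a, b; rewrite -e.
Qed.

Lemma zero_mor_compl X Y Z (g : hom Y Z) (f : hom X Y) : zero_mor f -> zero_mor (g ∘ f).
Proof.
  move=> [O [hO [a [b h]]]]; exists O; split=> //; exists a, (g ∘ b).
  by rewrite h comp_assoc.
Qed.

Lemma zero_mor_compr X Y Z (g : hom Y Z) (f : hom X Y) : zero_mor g -> zero_mor (g ∘ f).
Proof.
  move=> [O [hO [a [b h]]]]; exists O; split=> //; exists (a ∘ f), b.
  by rewrite h comp_assoc.
Qed.

Lemma zero_mor_src X Y (f : hom X Y) : is_zero X -> zero_mor f.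
Proof. by move=> h; exists X; split=> //; exists (idm X), f; rewrite comp_idr. Qed.

Lemma zero_mor_tgt X Y (f : hom X Y) : is_zero Y -> zero_mor f.
Proof. by move=> h; exists Y; split=> //; exists f, (idm Y); rewrite comp_idl. Qed.

Lemma zero_mor_unique X Y (f g : hom X Y) : zero_mor f -> zero_mor g -> f ≈ g.
Proof.
  move=> [Z [hZ [a [b ->]]]] [Z' [hZ' [a' [b' ->]]]].
  have [[k _] _] := hZ' Z.
  have [[u hu] _] := hZ' X; have [_ [v hv]] := hZ Y.
  by rewrite (hu a') -(hu (k ∘ a)) comp_assoc (hv b) (hv (b' ∘ k)).
Qed.

Lemma is_zero_of_id X : zero_mor (idm X) -> is_zero X.
Proof.
  move=> [Z [hZ [a [b e]]]] T; have [[f hf] [g hg]] := hZ T; split.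
  - exists (b ∘ f) => t; rewrite -(comp_idl t) e -comp_assoc.
    by rewrite (hf (a ∘ t)).
  - exists (g ∘ a) => t; rewrite -(comp_idr t) e comp_assoc.
    by rewrite (hg (t ∘ b)).
Qed.

Lemma is_iso_comp X Y Z (g : hom Y Z) (f : hom X Y) :
  is_iso g -> is_iso f -> is_iso (g ∘ f).
Proof.
  move=> [g' [g1 g2]] [f' [f1 f2]]; exists (f' ∘ g'); split.
  - by rewrite comp_assoc -(comp_assoc f') g1 comp_idr f1.
  - by rewrite comp_assoc -(comp_assoc g) f2 comp_idr g2.
Qed.

Lemma is_iso_heq X Y (f g : hom X Y) : f ≈ g -> is_iso f -> is_iso g.
Proof. by move=> e [h [h1 h2]]; exists h; rewrite -e. Qed.

Lemma is_iso_of_comp_l X Y Z (g : hom Y Z) (f : hom X Y) :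
  is_iso g -> is_iso (g ∘ f) -> is_iso f.
Proof.
  move=> [g' [g1 g2]] h; apply: (@is_iso_heq _ _ (g' ∘ (g ∘ f))).
  - by rewrite comp_assoc g1 comp_idl.
  - by apply: is_iso_comp => //; exists g.
Qed.

Lemma is_iso_of_comp_r X Y Z (g : hom Y Z) (f : hom X Y) :
  is_iso f -> is_iso (g ∘ f) -> is_iso g.
Proof.
  move=> [f' [f1 f2]] h; apply: (@is_iso_heq _ _ (g ∘ f ∘ f')).
  - by rewrite -comp_assoc f2 comp_idr.
  - by apply: is_iso_comp => //; exists f.
Qed.

Lemma is_zero_iso X Y (f : hom X Y) : is_iso f -> is_zero X -> is_zero Y.
Proof.
  move=> [g [_ h]] hX; apply: is_zero_of_id; apply: (zero_mor_heq h).
  exact/zero_mor_compr/zero_mor_src.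
Qed.

Lemma zepi_comp X Y Z (g : hom Y Z) (f : hom X Y) : zepi g -> zepi f -> zepi (g ∘ f).
Proof.
  move=> hg hf T t ht; apply: hg; apply: hf; apply: zero_mor_heq ht.
  exact: comp_assoc.
Qed.

Lemma zepi_of_comp X Y Z (g : hom Y Z) (f : hom X Y) : zepi (g ∘ f) -> zepi g.
Proof.
  move=> h T t ht; apply: h; apply: (zero_mor_heq (symmetry (comp_assoc _ _ _))).
  exact: zero_mor_compr.
Qed.

Lemma zepi_heq X Y (f g : hom X Y) : f ≈ g -> zepi f -> zepi g.
Proof. by move=> e h T t ht; apply: h; apply: zero_mor_heq ht; rewrite e. Qed.

Lemma zepi_split X Y (f : hom X Y) (s : hom Y X) : f ∘ s ≈ idm Y -> zepi f.
Proof.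
  move=> e T t /(fun h => zero_mor_compr s h); apply: zero_mor_heq.
  by rewrite -comp_assoc e comp_idr.
Qed.

Lemma zmono_split X Y (f : hom X Y) (r : hom Y X) : r ∘ f ≈ idm X -> zmono f.
Proof.
  move=> e T t /(zero_mor_compl r); apply: zero_mor_heq.
  by rewrite comp_assoc e comp_idl.
Qed.

Lemma cokernel_iso X Y Q X' Y' Q' (f : hom X Y) (q : hom Y Q) (f' : hom X' Y')
    (q' : hom Y' Q') (a : hom X X') (b : hom Y Y') (d : hom Q Q') :
  is_iso a -> is_iso b -> is_iso d -> b ∘ f ≈ f' ∘ a -> d ∘ q ≈ q' ∘ b ->
  is_cokernel q f -> is_cokernel q' f'.
Proof.
  move=> [a' [a1 a2]] [b' [b1 b2]] [d' [d1 d2]] e1 e2 [h0 h].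
  have e1' : b' ∘ f' ≈ f ∘ a'.
  { by rewrite -(comp_idr f') -a2 (comp_assoc f') -e1 !comp_assoc b1 comp_idl. }
  have e2' : q' ≈ d ∘ q ∘ b' by rewrite e2 -comp_assoc b2 comp_idr.
  split.
  - apply: (@zero_mor_heq _ _ (d ∘ (q ∘ f) ∘ a')).
    + by rewrite e2' -!comp_assoc e1'.
    + exact/zero_mor_compr/zero_mor_compl.
  - move=> T t ht; have [|u [hu hu']] := h T (t ∘ b).
    { apply: (@zero_mor_heq _ _ (t ∘ f' ∘ a)); last exact: zero_mor_compr.
      by rewrite -!comp_assoc e1. }
    exists (u ∘ d'); split.
    + by rewrite e2' !comp_assoc -(comp_assoc u) d1 comp_idr hu -comp_assoc b2 comp_idr.
    + move=> v hv; have <- : v ∘ d ≈ u.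
      * by apply: hu'; rewrite -comp_assoc e2 comp_assoc hv.
      * by rewrite -comp_assoc d2 comp_idr.
Qed.

Lemma cokernel_unique X Y Q Q' (f : hom X Y) (q : hom Y Q) (q' : hom Y Q') :
  is_cokernel q f -> is_cokernel q' f -> exists e : hom Q Q', is_iso e /\ e ∘ q ≈ q'.
Proof.
  move=> [z h] [z' h'].
  have [u [hu _]] := h _ _ z'; have [v [hv _]] := h' _ _ z.
  exists u; split=> //; exists v; split.
  - have [w [_ hw]] := h _ _ z; transitivity w; [|symmetry]; apply: hw; last exact: comp_idl.
    by rewrite -comp_assoc hu hv.
  - have [w [_ hw]] := h' _ _ z'; transitivity w; [|symmetry]; apply: hw; last exact: comp_idl.
    by rewrite -comp_assoc hv hu.
Qed.

Lemma cokernel_zepi X Y Q (f : hom X Y) (q : hom Y Q) : is_cokernel q f -> zepi q.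
Proof.
  move=> [z h] T t ht; have [|u [_ hu]] := h T (t ∘ q).
  { exact/zero_mor_compr. }
  have [Z [hZ _]] := z; have [[a _] _] := hZ Q; have [_ [b _]] := hZ T.
  have h0 : zero_mor (b ∘ a) by exists Z; split=> //; exists a, b.
  apply: (zero_mor_heq _ h0).
  transitivity u; [|symmetry; exact: hu].
  by apply: hu; apply: zero_mor_unique ht; apply: zero_mor_compr.
Qed.

Lemma zepi_of_cokernel_zero X Y Q (f : hom X Y) (q : hom Y Q) :
  is_cokernel q f -> is_zero Q -> zepi f.
Proof.
  move=> [z h] hQ T t ht; have [u [hu _]] := h T t ht.
  apply: (zero_mor_heq hu); exact/zero_mor_compr/zero_mor_src.
Qed.

Lemma cokernel_of_zepi_zero X Y Q (f : hom X Y) (q : hom Y Q) :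
  is_cokernel q f -> zepi f -> is_zero Q.
Proof.
  move=> hq hf; apply: is_zero_of_id; apply: (cokernel_zepi hq).
  apply: zero_mor_compl; apply: hf; exact: (proj1 hq).
Qed.

End PlainCategory.

(** * Duality *)

Lemma op_zero_mor (C : Category) (X Y : C) (f : hom X Y) :
  @zero_mor (op_cat C) Y X f <-> zero_mor f.
Proof.
  split=> -[Z [hZ [a [b e]]]]; exists Z; (split; last by exists b, a).
  - by move=> T; have [] := hZ T.
  - exact: op_zero.
Qed.

Lemma op_is_zero (C : Category) (X : C) : @is_zero (op_cat C) X <-> is_zero X.
Proof. by split=> h T; have [] := h T. Qed.

Lemma op_is_iso (C : Category) (X Y : C) (f : hom X Y) :
  @is_iso (op_cat C) Y X f <-> is_iso f.
Proof. by split=> -[g [h1 h2]]; exists g. Qed.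

Lemma op_zepi (C : Category) (X Y : C) (f : hom X Y) :
  @zepi (op_cat C) Y X f <-> zmono f.
Proof. by split=> h T t /op_zero_mor ht; apply/op_zero_mor; apply: h. Qed.

Lemma op_zmono (C : Category) (X Y : C) (f : hom X Y) :
  @zmono (op_cat C) Y X f <-> zepi f.
Proof. by split=> h T t /op_zero_mor ht; apply/op_zero_mor; apply: h. Qed.

Lemma op_is_cokernel (C : Category) (X Y Z : C) (k : hom X Y) (f : hom Y Z) :
  @is_cokernel (op_cat C) Z Y X k f <-> is_kernel k f.
Proof.
  split=> -[h0 h]; (split; first exact/op_zero_mor); move=> T t ht;
    exact: (h T t (proj2 (op_zero_mor _) ht)) || exact: (h T t (proj1 (op_zero_mor _) ht)).
Qed.

Lemma op_is_kernel (C : Category) (X Y Z : C) (f : hom X Y) (q : hom Y Z) :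
  @is_kernel (op_cat C) Z Y X q f <-> is_cokernel q f.
Proof.
  split=> -[h0 h]; (split; first exact/op_zero_mor); move=> T t ht;
    exact: (h T t (proj2 (op_zero_mor _) ht)) || exact: (h T t (proj1 (op_zero_mor _) ht)).
Qed.

Section PlainCategoryOp.
Variable C : Category.
Implicit Types X Y Z T : C.

Lemma kernel_iso K X Y K' X' Y' (k : hom K X) (f : hom X Y) (k' : hom K' X')
    (f' : hom X' Y') (a : hom K K') (b : hom X X') (d : hom Y Y') :
  is_iso a -> is_iso b -> is_iso d -> b ∘ k ≈ k' ∘ a -> d ∘ f ≈ f' ∘ b ->
  is_kernel k f -> is_kernel k' f'.
Proof.
  move=> [a' [a1 a2]] [b' [b1 b2]] [d' [d1 d2]] e1 e2 /op_is_cokernel h.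
  apply/op_is_cokernel.
  apply: (@cokernel_iso (op_cat C) Y X K Y' X' K' f k f' k' d' b' a') => //=.
  - by exists d.
  - by exists b.
  - by exists a.
  - by rewrite -(comp_idr f') -b2 (comp_assoc f') -e2 !comp_assoc d1 comp_idl.
  - by rewrite -(comp_idr k') -a2 (comp_assoc k') -e1 !comp_assoc b1 comp_idl.
Qed.

Lemma kernel_zmono K X Y (f : hom X Y) (k : hom K X) : is_kernel k f -> zmono k.
Proof. by move=> /op_is_cokernel h; apply/op_zepi; apply: (cokernel_zepi h). Qed.

Lemma zmono_of_kernel_zero K X Y (f : hom X Y) (k : hom K X) :
  is_kernel k f -> is_zero K -> zmono f.
Proof.
  move=> /op_is_cokernel h /op_is_zero hK; apply/op_zepi.
  exact: (zepi_of_cokernel_zero h hK).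
Qed.

Lemma kernel_of_zmono_zero K X Y (f : hom X Y) (k : hom K X) :
  is_kernel k f -> zmono f -> is_zero K.
Proof.
  move=> /op_is_cokernel h /op_zepi hf; apply/op_is_zero.
  exact: (cokernel_of_zepi_zero h hf).
Qed.

End PlainCategoryOp.

Lemma functor_iso (C D : Category) (F : Functor C D) (X Y : C) (f : hom X Y) :
  is_iso f -> is_iso (fmap F f).
Proof.
  move=> [g [h1 h2]]; exists (fmap F g).
  by rewrite -!fmap_comp (fmap_heq F h1) (fmap_heq F h2) !fmap_id.
Qed.

Definition op_functor (C D : Category) (F : Functor C D) :
  Functor (op_cat C) (op_cat D) := {|
  fobj := (fun X => F X) : op_cat C -> op_cat D;
  fmap := fun X Y f => @fmap C D F Y X f;
  fmap_heq := fun X Y f g => @fmap_heq C D F Y X f g;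
  fmap_id := fun X => @fmap_id C D F X;
  fmap_comp := fun X Y Z g f => @fmap_comp C D F Z Y X f g
|}.

Lemma naturally_isomorphic_sym (C D : Category) (F G : Functor C D) :
  naturally_isomorphic F G -> naturally_isomorphic G F.
Proof.
  move=> [eta [hi hn]].
  pose inv X := constructive_indefinite_description _ (hi X).
  exists (fun X => proj1_sig (inv X)); split.
  - by move=> X; case: (inv X) => g [h1 h2] /=; exists (eta X).
  - move=> X Y f; case: (inv X) (inv Y) => [g [h1 h2]] [g' [h1' h2']] /=.
    by rewrite -(comp_idr (fmap G f)) -h2 (comp_assoc (fmap G f)) -hn !comp_assoc h1' comp_idl.
Qed.

Lemma naturally_isomorphic_trans (C D : Category) (F G K : Functor C D) :
  naturally_isomorphic F G -> naturally_isomorphic G K -> naturally_isomorphic F K.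
Proof.
  move=> [eta [hi hn]] [eta' [hi' hn']].
  exists (fun X => eta' X ∘ eta X); split; first by move=> X; apply: is_iso_comp.
  by move=> X Y f; rewrite -comp_assoc hn comp_assoc hn' comp_assoc.
Qed.

(** * Pushouts and pullbacks in exact categories *)

Lemma pullback_sym (C : Category) (X Y Z P : C) (f : hom X Z) (g : hom Y Z)
    (h : hom P X) (k : hom P Y) : is_pullback f g h k -> is_pullback g f k h.
Proof. exact: (@pushout_sym (op_cat C)). Qed.

Section ExactSquares.
Variable B : ExactCategory.
Implicit Types X Y Z T U V W : B.

Lemma hadd_eq0 X Y (f g : hom X Y) : f + g ≈ hzero X Y -> f ≈ - g.
Proof. by rewrite hadd_comm; apply: opp_unique. Qed.

(** Let E be the pullback of p and p'.  The morphism g splits E ↠ Y, which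
    makes E the sum of X' and Y, while E ↠ Y' has kernel X.  So Y' is the
    quotient of X' ⊕ Y by X. *)
Lemma pushout_of_conflations X Y Z X' Y' (i : hom X Y) (p : hom Y Z) (i' : hom X' Y')
    (p' : hom Y' Z) (f : hom X X') (g : hom Y Y') :
  conflation i p -> conflation i' p' -> g ∘ i ≈ i' ∘ f -> p' ∘ g ≈ p ->
  is_pushout i f g i'.
Proof.
  move=> h h' sq e.
  have hd : deflation p by exists X, i.
  have [E [e2 [e1 [hpb _]]]] := deflation_pullback p' hd.
  have [k [hk ek]] := pullback_conf h hpb.
  have [l [hl el]] := pullback_conf h' (pullback_sym hpb).
  have [s [[s2 s1] _]] : exists s, (e2 ∘ s ≈ idm Y /\ e1 ∘ s ≈ g) /\
      forall s', e2 ∘ s' ≈ idm Y -> e1 ∘ s' ≈ g -> s' ≈ s.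
  { by apply: (proj2 hpb); rewrite comp_idr e. }
  have [r [r1 [r2 r3]]] := section_complement hl s2.
  have rk : r ∘ k ≈ - f.
  { apply: (infl_mono h'); rewrite comp_oppr -sq -el -comp_assoc.
    rewrite (comp_assoc l); apply: hadd_eq0; rewrite -s1 -(comp_assoc e1) -ek.
    rewrite (comp_assoc s) -comp_addr -comp_addl r3 comp_idl.
    exact: (conf_comp0 hk). }
  split=> // T x y exy.
  have [|z hz] := @conf_factor _ _ _ _ T _ _ (y ∘ r + x ∘ e2) hk.
  { rewrite comp_addl -!comp_assoc rk ek comp_oppr exy hadd_comm.
    exact: hadd_oppr. }
  have ex : z ∘ g ≈ x.
  { rewrite -s1 comp_assoc hz comp_addl -!comp_assoc r2 s2 comp_0r comp_idr.
    exact: hadd_0l. }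
  have ey : z ∘ i' ≈ y.
  { rewrite -el comp_assoc hz comp_addl -!comp_assoc r1 (conf_comp0 hl) comp_0r comp_idr.
    exact: hadd_0r. }
  exists z; split=> // z' ex' ey'; apply: (defl_epi hk).
  rewrite -(comp_idr (z' ∘ e1)) -(comp_idr (z ∘ e1)) -r3 !comp_addr.
  rewrite -!comp_assoc !(comp_assoc e1) el s1 !comp_assoc.
  by rewrite ex ey ex' ey'.
Qed.

Lemma pullback_conflation P Y Z Z' (p : hom Y Z) (f : hom Z' Z) (f' : hom P Y)
    (p' : hom P Z') :
  deflation p -> is_pullback p f f' p' ->
  conflation (in1 Y Z' ∘ f' + in2 Y Z' ∘ p') (f ∘ pr2 Y Z' - p ∘ pr1 Y Z').
Proof.
  move=> [K [k hp]] [sq h]; set j := (_ + _); set e := (_ - _).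
  have pj1 : pr1 _ _ ∘ j ≈ f'.
  { by rewrite comp_addr !comp_assoc pr1_in1 pr1_in2 comp_0l comp_idl hadd_0r. }
  have pj2 : pr2 _ _ ∘ j ≈ p'.
  { by rewrite comp_addr !comp_assoc pr2_in1 pr2_in2 comp_0l comp_idl hadd_0l. }
  have ee T (t : hom T (Y ⊕ Z')) : e ∘ t ≈ f ∘ (pr2 _ _ ∘ t) - p ∘ (pr1 _ _ ∘ t).
  { by rewrite hsub_comp_l !comp_assoc. }
  have jm T (a b : hom T P) : j ∘ a ≈ j ∘ b -> a ≈ b.
  { move=> eab; have [|z [_ hz]] := h T (f' ∘ a) (p' ∘ a); first by rewrite !comp_assoc sq.
    rewrite (hz a) //; symmetry; apply: hz.
    - by rewrite -pj1 -!comp_assoc eab.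
    - by rewrite -pj2 -!comp_assoc eab. }
  have hker : is_kernel j e.
  { apply/kernelP; split; first by rewrite ee pj1 pj2 sq; apply/hsub_eq0.
    move=> T t; rewrite ee => /hsub_eq0 et.
    have [z [[z1 z2] hz]] := h T _ _ (symmetry et).
    exists z; split.
    - by rewrite comp_addl -!comp_assoc z1 z2 !comp_assoc -comp_addl bip_id comp_idl.
    - move=> z' hz'; apply: hz; first by rewrite -pj1 -comp_assoc hz'.
      by rewrite -pj2 -comp_assoc hz'. }
  (* e is p ⊕ 1, a pullback of p, followed by a split deflation. *)
  have hd : deflation e.
  { pose m := in1 Z Z' ∘ (p ∘ pr1 Y Z') + in2 Z Z' ∘ pr2 Y Z'.
    pose e0 := f ∘ pr2 Z Z' - pr1 Z Z'.
    have m1 : pr1 _ _ ∘ m ≈ p ∘ pr1 _ _.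
    { by rewrite comp_addr !comp_assoc pr1_in1 pr1_in2 comp_0l comp_idl hadd_0r. }
    have m2 : pr2 _ _ ∘ m ≈ pr2 _ _.
    { by rewrite comp_addr !comp_assoc pr2_in1 pr2_in2 comp_0l !comp_0l comp_idl hadd_0l. }
    have hm : is_pullback p (pr1 Z Z') (pr1 Y Z') m.
    { split; first by rewrite m1.
      move=> T x y exy; exists (in1 _ _ ∘ x + in2 _ _ ∘ (pr2 _ _ ∘ y)); split; first split.
      - by rewrite comp_addr !comp_assoc pr1_in1 pr1_in2 !comp_0l comp_idl hadd_0r.
      - rewrite comp_addl -!comp_assoc !comp_addr !(comp_assoc (pr1 _ _)) !(comp_assoc (pr2 _ _)).
        rewrite pr1_in1 pr1_in2 pr2_in1 pr2_in2 !comp_0l !comp_0r !comp_idl hadd_0l.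
        by rewrite !hadd_0r exy !comp_assoc -comp_addl bip_id comp_idl.
      - move=> z' h1 h2; rewrite -(comp_idl z') -bip_id comp_addl -!comp_assoc h1.
        by rewrite -h2 (comp_assoc (pr2 _ _)) m2. }
    have hdm : deflation m by apply: (pullback_deflation _ hm); exists K, k.
    have hde : deflation e0.
    { pose b := (in1 Z Z' ∘ (f ∘ pr2 Z Z') + in2 Z Z' ∘ pr2 Z Z') - in1 Z Z' ∘ pr1 Z Z'.
      have b1 : pr1 _ _ ∘ b ≈ e0.
      { rewrite hsub_comp_r comp_addr !comp_assoc pr1_in1 pr1_in2 !comp_idl comp_0l.
        by rewrite hadd_0r. }
      have b2 : pr2 _ _ ∘ b ≈ pr2 _ _.
      { rewrite hsub_comp_r comp_addr !comp_assoc pr2_in1 pr2_in2 !comp_0l comp_idl.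
        by rewrite hsub_0r hadd_0l. }
      have e0b : e0 ∘ b ≈ pr1 _ _.
      { rewrite hsub_comp_l -comp_assoc b2 b1 hopp_add hopp_opp hadd_assoc.
        by rewrite hadd_oppr hadd_0l. }
      have bb : b ∘ b ≈ idm _.
      { rewrite -(comp_idl (b ∘ b)) -bip_id comp_addl -!comp_assoc.
        by rewrite !(comp_assoc (pr1 _ _)) !(comp_assoc (pr2 _ _)) b1 b2 e0b b2. }
      have ib : is_iso b by exists b.
      exists Z', (b ∘ in2 _ _).
      apply: (conf_iso (idm_iso _) ib (idm_iso _) _ _ (conf_split_op Z Z')).
      - by rewrite comp_idr.
      - by rewrite comp_idl e0b. }
    have [K' [k' hk']] := deflation_comp hdm hde.
    exists K', k'; apply: (conf_heq (reflexivity k') _ hk').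
    by rewrite hsub_comp_l -comp_assoc m1 m2. }
  exact: (@cokernel_conf (op_exact B) Z _ P e j hd (op_kernel hker)).
Qed.

End ExactSquares.

Section ExactSquaresOp.
Variable B : ExactCategory.
Implicit Types X Y Z T U V W : B.

Lemma pushout_conflation X Y X' P (i : hom X Y) (f : hom X X') (f' : hom Y P)
    (i' : hom X' P) :
  inflation i -> is_pushout i f f' i' ->
  conflation (in2 Y X' ∘ f - in1 Y X' ∘ i) (f' ∘ pr1 Y X' + i' ∘ pr2 Y X').
Proof. exact: (@pullback_conflation (op_exact B) P Y X X' i f f' i'). Qed.

End ExactSquaresOp.

(** * Morphisms of the shape X -> X⁺ or X⁻ -> X *)

Section PlusLike.
Variables (B : ExactCategory) (c : CotorsionPair B).

(** The shape of the units X -> X⁺, without the condition that U -> X is a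
    deflation with kernel in V.  This makes it stable under pushouts, and under
    pullbacks along deflations with kernel in V. *)
Definition plus_like (X Y : B) (a : hom X Y) : Prop :=
  exists (U W U0 : B) (w : hom U W) (q : hom W U0) (u : hom U X) (b : hom W Y),
    cU c U /\ cW c W /\ cU c U0 /\ conflation w q /\ is_pushout w u b a.

Definition minus_like (Y X : B) (g : hom Y X) : Prop :=
  exists (V W V0 : B) (w : hom W V) (q : hom V0 W) (v : hom X V) (b : hom Y W),
    cV c V /\ cW c W /\ cV c V0 /\ conflation q w /\ is_pullback w v b g.

Lemma plus_data_like X (d : PlusData c X) : plus_like (plus_alpha d).
Proof.
  exists (plus_U d), (plus_W0 d), (plus_U0 d), (plus_w d), (plus_q d), (plus_u d), (plus_b d).
  split; first exact: plus_hU; split; first exact: plus_hW0; split; first exact: plus_hU0.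
  split; [exact: plus_conf2 | exact: plus_po].
Qed.

Lemma plus_like_conf X Y (a : hom X Y) : plus_like a ->
  exists (U : B) (p : hom Y U), cU c U /\ conflation a p.
Proof.
  move=> [U [W [U0 [w [q [u [b [_ [_ [hU0 [hc hpo]]]]]]]]]]].
  by have [p [hp _]] := pushout_conf hc hpo; exists U0, p.
Qed.

Lemma plus_like_extend X Y T (a : hom X Y) (f : hom X T) : plus_like a -> cBplus c T ->
  exists g : hom Y T, g ∘ a ≈ f.
Proof.
  move=> [U [W0 [U0 [w0 [q [u [b [hU [_ [hU0 [h2 hpo]]]]]]]]]]].
  move=> [V [W [v [w [hV [[_ hW] hc]]]]]].
  have [l hl] := U_lift (f ∘ u) hU hV hc.
  have [m hm] := V_extend l hU0 hW h2.
  have [|z [[_ hz] _]] := proj2 hpo T (w ∘ m) f.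
  { by rewrite -comp_assoc hm. }
  by exists z.
Qed.

(** The difference of g and g' factors through U modulo W, and every morphism
    from U to an object of B⁺ is zero modulo W. *)
Lemma U_cokernel_unique X Y U T (a : hom X Y) (p : hom Y U) (g g' : hom Y T) :
  conflation a p -> cU c U -> cBplus c T ->
  quot_eq (cW c) (g ∘ a) (g' ∘ a) -> quot_eq (cW c) g g'.
Proof.
  move=> hp hU hT [Z [hZ [x [b e]]]].
  have [x' hx'] := V_extend x hU (proj2 hZ) hp.
  have [|t ht] := @conf_factor B _ _ _ T _ _ (g - g' - b ∘ x') hp.
  { by rewrite !hsub_comp_l e -comp_assoc hx'; apply/hsub_eq0. }
  have [O [hO [y [z e2]]]] := U_to_Bplus t hU hT.
  have e1 : quot_eq (cW c) (b ∘ x' + t ∘ p) (hzero Y T).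
  { exists (Z ⊕ O); split; first exact: (proj2 (cW_additive c)).
    exists (in1 Z O ∘ x' + in2 Z O ∘ (y ∘ p)), (b ∘ pr1 Z O + z ∘ pr2 Z O).
    rewrite hsub_0r comp_addl !comp_addr -!comp_assoc.
    rewrite !(comp_assoc (pr1 Z O)) !(comp_assoc (pr2 Z O)).
    rewrite pr1_in1 pr1_in2 pr2_in1 pr2_in2 !comp_0l !comp_0r !comp_idl hadd_0l hadd_0r.
    by rewrite (comp_assoc z) -e2 hsub_0r. }
  case: e1 => [Q [hQ [s [r e3]]]]; exists Q; split=> //; exists s, r; rewrite -e3 hsub_0r ht.
  by rewrite (hadd_comm (b ∘ x')) -hadd_assoc hadd_oppl hadd_0r.
Qed.

Lemma Bminus_of_conf X Y U (a : hom X Y) (p : hom Y U) :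
  conflation a p -> cU c U -> cBminus c Y -> cBminus c X.
Proof.
  move=> hp hU [W [U' [w [u [hW [hU' hc]]]]]].
  have hw : inflation w by exists U', u.
  have [U2 [d [k [hpo _]]]] := inflation_pushout p hw.
  have [p' [hk _]] := pushout_conf hc hpo.
  exists W, U2, (w ∘ a), d; split=> //; split; last exact: (noether_conf hp hw hpo).
  exact: (U_extension hk).
Qed.

(** The pushout of X ↣ W along X ↣ Y lies in U, hence embeds into an object of
    W with cokernel in U; the composite embeds Y. *)
Lemma Bminus_extension X Y U (a : hom X Y) (p : hom Y U) :
  conflation a p -> cU c U -> cBminus c X -> cBminus c Y.
Proof.
  move=> hp hU [W [U' [w [u [hW [hU' hc]]]]]].
  have hw : inflation w by exists U', u.
  have [P [f [i [hpo _]]]] := inflation_pushout a hw.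
  have [p' [hi _]] := pushout_conf hc hpo.
  have [r [hf _]] := pushout_conf hp (pushout_sym hpo).
  have hP : cU c P := U_extension hf (proj1 hW) hU.
  have [V [U2 [v [q [hV [hU2 hv]]]]]] := cotorsion_left c P.
  have hWV : cW c V by split=> //; apply: (U_extension hv).
  have hiv : inflation v by exists U2, q.
  have [Q [e [k [hpo2 _]]]] := inflation_pushout p' hiv.
  have [s [hk _]] := pushout_conf hv hpo2.
  exists V, Q, (v ∘ i), e; split=> //; split; last exact: (noether_conf hi hiv hpo2).
  exact: (U_extension hk).
Qed.

(** A retract need not be a direct summand in an exact category; the vanishing
    of Ext¹ passes to retracts all the same. *)
Lemma U_retract X Y (r : hom Y X) (s : hom X Y) : r ∘ s ≈ idm X -> cU c Y -> cU c X.
Proof.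
  move=> e hY; apply: (U_of_ext (c := c)) => V hV; apply/ext1_zero_section => E i p hp.
  have [t ht] := U_lift r hY hV hp.
  by exists (t ∘ s); rewrite comp_assoc ht.
Qed.

(** This exchange property is what makes σ⁺ and σ⁻ commute.  Both U -> X and
    W -> Y lift along the deflations with kernel V; the lifts differ on U by a
    morphism U -> V, which extends to W and so can be absorbed. *)
Lemma plus_like_pullback X Y Y' P V (a : hom X Y) (g : hom Y' Y) (j : hom V Y')
    (g' : hom P X) (a' : hom P Y') :
  plus_like a -> conflation j g -> cV c V -> is_pullback g a a' g' -> plus_like a'.
Proof.
  move=> [U [W [U0 [w [q [u [b [hU [hW [hU0 [hc hpo]]]]]]]]]]] hj hV hpb.
  have [p [hp ep]] := pushout_conf hc hpo.
  have hdg : deflation g by exists V, j.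
  have ha' := noether_conf_op hp hdg hpb.
  have [j' [hj' _]] := pullback_conf hj hpb.
  have [u' hu'] := U_lift u hU hV hj'.
  have [b' hb'] := U_lift b (proj1 hW) hV hj.
  have [|d hd] := @conf_lift _ _ _ _ U _ _ (a' ∘ u' - b' ∘ w) hj.
  { rewrite hsub_comp_r !comp_assoc hb' (proj1 hpb) -(comp_assoc a) hu' (proj1 hpo).
    exact/hsub_eq0. }
  have [e he] := V_extend d hU0 hV hc.
  exists U, W, U0, w, q, u', (b' + j ∘ e); do 4! split=> //.
  apply: (pushout_of_conflations hc ha').
  - by rewrite comp_addl -comp_assoc he hd hadd_comm -hadd_assoc hadd_oppl hadd_0r.
  - by rewrite -comp_assoc comp_addr comp_assoc (conf_comp0 hj) comp_0l hadd_0r hb'.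
Qed.

End PlusLike.

Section MinusLike.
Variables (B : ExactCategory) (c : CotorsionPair B).

Lemma op_plus_like (X Y : B) (g : hom Y X) :
  @plus_like (op_exact B) (op_cotorsion c) X Y g <-> minus_like c g.
Proof.
  split=> -[U [W [U0 [w [q [u [b [h1 [h2 [h3 [h4 h5]]]]]]]]]]];
    exists U, W, U0, w, q, u, b; split=> //; split; (exact/op_cW || split=> //).
Qed.

Lemma op_minus_like (X Y : B) (a : hom X Y) :
  @minus_like (op_exact B) (op_cotorsion c) Y X a <-> plus_like c a.
Proof.
  split=> -[U [W [U0 [w [q [u [b [h1 [h2 [h3 [h4 h5]]]]]]]]]]];
    exists U, W, U0, w, q, u, b; split=> //; split; (exact/op_cW || split=> //).
Qed.

Lemma op_cBminus (X : B) : @cBminus (op_exact B) (op_cotorsion c) X <-> cBplus c X.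
Proof.
  split.
  - by move=> [W [U [w [u [/op_cW hW [hU hc]]]]]]; exists U, W, u, w.
  - by move=> [V [W [v [w [hV [/op_cW hW hc]]]]]]; exists W, V, w, v.
Qed.

Lemma minus_data_like (X : B) (d : MinusData c X) : minus_like c (minus_gamma d).
Proof. apply/op_plus_like; exact: (plus_data_like (plus_op_of_minus d)). Qed.

Lemma minus_like_conf (Y X : B) (g : hom Y X) : minus_like c g ->
  exists (V : B) (i : hom V Y), cV c V /\ conflation i g.
Proof. by move=> /op_plus_like /plus_like_conf. Qed.

Lemma minus_like_lift (X Y T : B) (g : hom Y X) (f : hom T X) :
  minus_like c g -> cBminus c T -> exists h : hom T Y, g ∘ h ≈ f.
Proof.
  move=> /op_plus_like h /op_cBplus hT.
  exact: (@plus_like_extend (op_exact B) (op_cotorsion c) X Y T g f h hT).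
Qed.

Lemma V_kernel_unique (X Y V T : B) (i : hom V Y) (g : hom Y X) (h h' : hom T Y) :
  conflation i g -> cV c V -> cBminus c T ->
  quot_eq (cW c) (g ∘ h) (g ∘ h') -> quot_eq (cW c) h h'.
Proof.
  move=> hi hV /op_cBplus hT /op_quot_eq e; apply/op_quot_eq.
  exact: (@U_cokernel_unique (op_exact B) (op_cotorsion c) X Y V T g i h h').
Qed.

Lemma Bplus_of_conf (V Y X : B) (i : hom V Y) (g : hom Y X) :
  conflation i g -> cV c V -> cBplus c Y -> cBplus c X.
Proof.
  move=> hi hV /op_cBminus hY; apply/op_cBminus.
  exact: (@Bminus_of_conf (op_exact B) (op_cotorsion c) X Y V g i).
Qed.

Lemma Bplus_extension (V Y X : B) (i : hom V Y) (g : hom Y X) :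
  conflation i g -> cV c V -> cBplus c X -> cBplus c Y.
Proof.
  move=> hi hV /op_cBminus hY; apply/op_cBminus.
  exact: (@Bminus_extension (op_exact B) (op_cotorsion c) X Y V g i).
Qed.

Lemma V_retract (X Y : B) (r : hom Y X) (s : hom X Y) : r ∘ s ≈ idm X -> cV c Y -> cV c X.
Proof. exact: (@U_retract (op_exact B) (op_cotorsion c) X Y s r). Qed.

(** Pasting of pullback squares. *)
Lemma minus_like_pullback (X X' Y P : B) (g : hom Y X) (x : hom X' X)
    (y : hom P Y) (g' : hom P X') :
  minus_like c g -> is_pullback g x y g' -> minus_like c g'.
Proof.
  move=> [V [W [V0 [w [q [v [b [hV [hW [hV0 [hc hpb]]]]]]]]]]] hpb'.
  exists V, W, V0, w, q, (v ∘ x), (b ∘ y); do 4! split=> //.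
  split; first by rewrite comp_assoc (proj1 hpb) -!comp_assoc (proj1 hpb').
  move=> T s t e; have [|z [[z1 z2] hz]] := proj2 hpb T s (x ∘ t).
  { by rewrite comp_assoc. }
  have [z' [[z1' z2'] hz']] := proj2 hpb' T z t z2.
  exists z'; split; first by split=> //; rewrite -comp_assoc z1' z1.
  move=> z2'' h1 h2; apply: hz' => //; apply: hz; first by rewrite comp_assoc.
  by rewrite comp_assoc (proj1 hpb') -comp_assoc h2.
Qed.

End MinusLike.

Lemma plus_like_pushout (B : ExactCategory) (c : CotorsionPair B) (X X' Y P : B)
    (a : hom X Y) (x : hom X X') (y : hom Y P) (a' : hom X' P) :
  plus_like c a -> is_pushout a x y a' -> plus_like c a'.
Proof.
  move=> /op_minus_like h hpo; apply/op_minus_like.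
  exact: (@minus_like_pullback (op_exact B) (op_cotorsion c) X X' Y P a x y a' h hpo).
Qed.

(** * The half exact functor on cokernels and kernels *)

Lemma zero_conflation (B : ExactCategory) (X : B) : conflation (hzero zobj X) (idm X).
Proof.
  have e1 : pr1 (zobj : B) X ≈ hzero _ _.
  { have [[k hk] _] := @zobj_zero B (zobj ⊕ X); by rewrite (hk (pr1 _ _)) (hk (hzero _ _)). }
  have i2 : is_iso (pr2 (zobj : B) X).
  { exists (in2 _ _); rewrite pr2_in2; split=> //.
    by rewrite -bip_id e1 comp_0r hadd_0l. }
  apply: (conf_iso (idm_iso _) i2 (idm_iso _) _ _ (conf_split _ _)) => //.
  by rewrite pr2_in1 comp_0l.
Qed.

Lemma cH_of_cW (B : ExactCategory) (c : CotorsionPair B) (X : B) : cW c X -> cH c X.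
Proof.
  move=> hX; have hc := zero_conflation X.
  have hc' : conflation (idm X) (hzero X zobj) := @zero_conflation (op_exact B) X.
  split.
  - exists zobj, X, (hzero _ _), (idm X); split=> //; exact: (proj1 (cV_additive c)).
  - exists X, zobj, (idm X), (hzero _ _); split=> //; split=> //; exact: (proj1 (cU_additive c)).
Qed.

Section QuotientMorphisms.
Variables (B : ExactCategory) (c : CotorsionPair B).

Local Notation Q := (quotW c).
Local Notation S := (sigma_sigma c).
Local Notation H := (half_exact c).

(** A morphism of B seen in B/W.  The underlying term is the same; the retyping
    makes composition and equality those of the quotient. *)
Definition to_quot (X Y : B) (f : hom X Y) : @hom Q X Y := f.

Lemma to_quot_heq (X Y : B) (f g : hom X Y) : f ≈ g -> to_quot f ≈ to_quot g.
Proof. exact: (quot_eq_heq (cW_additive c)). Qed.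

Definition minus_part (X : B) : Q := minus_obj (minus_data c X).
Definition gamma (X : B) : @hom Q (minus_part X) X := minus_gamma (minus_data c X).
Definition alpha (X : B) : @hom Q (minus_part X) (S X) := plus_alpha (plus_data c (minus_part X)).
Definition minus_map (X Y : B) (f : hom X Y) : @hom Q (minus_part X) (minus_part Y) :=
  fmap (sigma_minus c) (to_quot f).

Lemma gamma_natural (X Y : B) (f : hom X Y) : gamma Y ∘ minus_map f ≈ to_quot f ∘ gamma X.
Proof.
  exact: (@coreflector_mapE (quotW c) (cBminus c) (fun X => minus_obj (minus_data c X))
    (fun X => minus_obj_Bminus (minus_data c X)) (fun X => minus_gamma (minus_data c X))
    (@sigma_minus_lift B c) X Y f).
Qed.

Lemma alpha_natural (X Y : B) (f : hom X Y) : fmap S f ∘ alpha X ≈ alpha Y ∘ minus_map f.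
Proof.
  exact: (@reflector_mapE (quotW c) (cBplus c) (fun X => plus_obj (plus_data c X))
    (fun X => plus_obj_Bplus (plus_data c X)) (fun X => plus_alpha (plus_data c X))
    (@sigma_plus_extend B c) (minus_part X) (minus_part Y) (minus_map f)).
Qed.

Lemma minus_part_Bminus (X : B) : cBminus c (minus_part X).
Proof. exact: minus_obj_Bminus. Qed.

Lemma minus_part_Bplus (X : B) : cBplus c X -> cBplus c (minus_part X).
Proof.
  have [i hi] := minus_gamma_conf (minus_data c X).
  exact: (Bplus_extension hi (minus_hV0 _)).
Qed.

Lemma gamma_lift (X : B) (T : Q) (t : @hom Q T X) : cBminus c T ->
  exists u : @hom Q T (minus_part X), gamma X ∘ u ≈ t.
Proof. exact: (@sigma_minus_lift B c X T t). Qed.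

Lemma gamma_mono (X : B) (T : Q) (u u' : @hom Q T (minus_part X)) : cBminus c T ->
  gamma X ∘ u ≈ gamma X ∘ u' -> u ≈ u'.
Proof. exact: (@minus_unique B c X T (minus_data c X) u u'). Qed.

Lemma alpha_extend (X : B) (T : Q) (t : @hom Q (minus_part X) T) : cBplus c T ->
  exists u : @hom Q (S X) T, u ∘ alpha X ≈ t.
Proof. exact: (@sigma_plus_extend B c (minus_part X) T t). Qed.

Lemma alpha_epi (X : B) (T : Q) (u u' : @hom Q (S X) T) : cBplus c T ->
  u ∘ alpha X ≈ u' ∘ alpha X -> u ≈ u'.
Proof. exact: (@plus_unique B c (minus_part X) T (plus_data c (minus_part X)) u u'). Qed.

Lemma gamma_iso (X : B) : cBminus c X -> is_iso (gamma X).
Proof.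
  move=> hX; have [s hs] := gamma_lift (@idm Q X) hX.
  exists s; split=> //; apply: gamma_mono; first exact: minus_part_Bminus.
  by rewrite comp_assoc hs comp_idl comp_idr.
Qed.

Lemma alpha_iso (X : B) : cBplus c X -> is_iso (alpha X).
Proof.
  move=> /minus_part_Bplus hX; have [r hr] := alpha_extend (@idm Q (minus_part X)) hX.
  exists r; split=> //; apply: alpha_epi; first exact: (proj1 (sigma_sigma_H c X)).
  by rewrite -comp_assoc hr comp_idl comp_idr.
Qed.

(** On B⁻ the span X <- X⁻ -> H X can be read as a reflection X -> H X into B⁺,
    and on B⁺ as a coreflection H X -> X of X into B⁻. *)
Lemma unit_exists (X : B) : cBminus c X -> exists eta : @hom Q X (S X),
  eta ∘ gamma X ≈ alpha X /\
  (forall (T : Q) (t : @hom Q X T), cBplus c T -> exists u : @hom Q (S X) T, u ∘ eta ≈ t) /\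
  (forall (T : Q) (u u' : @hom Q (S X) T), cBplus c T -> u ∘ eta ≈ u' ∘ eta -> u ≈ u').
Proof.
  move=> /gamma_iso [s [s1 s2]]; exists (alpha X ∘ s); split; [|split].
  - by rewrite -comp_assoc s1 comp_idr.
  - move=> T t hT; have [u hu] := alpha_extend (t ∘ gamma X) hT; exists u.
    by rewrite comp_assoc hu -comp_assoc s2 comp_idr.
  - move=> T u u' hT e; apply: alpha_epi => //.
    by rewrite -(comp_idr (alpha X)) -s1 (comp_assoc (alpha X)) !(comp_assoc _ (alpha X ∘ s)) e.
Qed.

Lemma counit_exists (X : B) : cBplus c X -> exists eps : @hom Q (S X) X,
  eps ∘ alpha X ≈ gamma X /\
  (forall (T : Q) (t : @hom Q T X), cBminus c T -> exists u : @hom Q T (S X), eps ∘ u ≈ t) /\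
  (forall (T : Q) (u u' : @hom Q T (S X)), cBminus c T -> eps ∘ u ≈ eps ∘ u' -> u ≈ u').
Proof.
  move=> /alpha_iso [r [r1 r2]]; exists (gamma X ∘ r); split; [|split].
  - by rewrite -comp_assoc r1 comp_idr.
  - move=> T t hT; have [u hu] := gamma_lift t hT; exists (alpha X ∘ u).
    by rewrite -comp_assoc (comp_assoc r) r1 comp_idl.
  - move=> T u u' hT; rewrite -!comp_assoc => /(gamma_mono hT) e.
    by rewrite -(comp_idl u) -(comp_idl u') -r2 -!comp_assoc e.
Qed.

Lemma unit_natural (X Y : B) (f : hom X Y) (eX : @hom Q X (S X)) (eY : @hom Q Y (S Y)) :
  cBminus c X -> eX ∘ gamma X ≈ alpha X -> eY ∘ gamma Y ≈ alpha Y ->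
  fmap S f ∘ eX ≈ eY ∘ to_quot f.
Proof.
  move=> /gamma_iso [s [s1 s2]] hX hY.
  rewrite -(comp_idr (fmap S f ∘ eX)) -(comp_idr (eY ∘ to_quot f)) -s2 !comp_assoc.
  by rewrite -(comp_assoc _ eX) hX alpha_natural -(comp_assoc eY) -gamma_natural comp_assoc hY.
Qed.

Lemma counit_natural (X Y : B) (f : hom X Y) (eX : @hom Q (S X) X) (eY : @hom Q (S Y) Y) :
  cBplus c Y -> eX ∘ alpha X ≈ gamma X -> eY ∘ alpha Y ≈ gamma Y ->
  eY ∘ fmap S f ≈ to_quot f ∘ eX.
Proof.
  move=> hY eqX eqY; apply: alpha_epi => //.
  by rewrite -!comp_assoc alpha_natural eqX (comp_assoc eY) eqY gamma_natural.
Qed.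

Lemma heart_zero_mor (X Y : heart c) (f : hom X Y) :
  zero_mor f <-> @heq Q (proj1_sig X) (proj1_sig Y) f (to_quot (hzero _ _)).
Proof.
  have hz0 : cH c zobj := cH_of_cW (proj1 (cW_additive c)).
  pose Z : heart c := exist _ (zobj : quotW c) hz0.
  have hZ : is_zero Z.
  { move=> T; have [[k hk] [l hl]] := @zobj_zero B (proj1_sig T); split.
    - exists k => g; exact: (to_quot_heq (hk g)).
    - exists l => g; exact: (to_quot_heq (hl g)). }
  split.
  - move=> [Z' [hZ' [a [b e]]]].
    have [[k hk] _] := hZ' X.
    have ea : @heq Q _ _ a (to_quot (hzero (proj1_sig X) (proj1_sig Z'))).
    { have h1 := hk a; have h2 := hk (hzero (proj1_sig X) (proj1_sig Z')).
      exact: (quot_eq_trans (cW_additive c) h1 (quot_eq_sym h2)). }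
    have e' : @heq Q _ _ f (to_quot (b ∘ hzero (proj1_sig X) (proj1_sig Z'))).
    { apply: (quot_eq_trans (cW_additive c) e); exact: (quot_eq_compl b ea). }
    apply: (quot_eq_trans (cW_additive c) e'); apply: to_quot_heq; exact: comp_0r.
  - move=> e; exists Z; split=> //.
    exists (hzero _ _), (hzero _ _); apply: (quot_eq_trans (cW_additive c) e).
    apply: to_quot_heq; symmetry; exact: comp_0r.
Qed.

End QuotientMorphisms.

Section InvertedMorphisms.
Variables (B : ExactCategory) (c : CotorsionPair B).

Local Notation Q := (quotW c).
Local Notation S := (sigma_sigma c).
Local Notation H := (half_exact c).

Lemma half_exact_minus_like (X Y : B) (g : hom Y X) : minus_like c g -> is_iso (fmap H g).
Proof.
  move=> hg; have [V [i [hV hi]]] := minus_like_conf hg.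
  have im : @is_iso Q _ _ (minus_map c g).
  { have [n0 hn0] := minus_like_lift (gamma c X) hg (minus_part_Bminus c X).
    have [n hn] := gamma_lift (to_quot c n0) (minus_part_Bminus c X).
    have hgn0 : to_quot c g ∘ to_quot c n0 ≈ gamma c X := to_quot_heq c hn0.
    have e : gamma c X ∘ (minus_map c g ∘ n) ≈ gamma c X.
    { by rewrite comp_assoc gamma_natural -comp_assoc hn hgn0. }
    exists n; split.
    - apply: gamma_mono; first exact: minus_part_Bminus.
      apply: (V_kernel_unique hi hV (minus_part_Bminus c Y)).
      change (to_quot c g ∘ (gamma c Y ∘ (n ∘ minus_map c g)) ≈ to_quot c g ∘ (gamma c Y ∘ idm _)).
      rewrite (comp_assoc (gamma c Y)) hn !(comp_assoc (to_quot c g)) hgn0 comp_idr.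
      exact: gamma_natural.
    - apply: gamma_mono; first exact: minus_part_Bminus.
      by rewrite e comp_idr. }
  exact: (@functor_iso _ _ (sigma_plus c) _ _ (minus_map c g) im).
Qed.

Lemma half_exact_plus_like_Bminus (X Y : B) (a : hom X Y) :
  cBminus c X -> cBminus c Y -> plus_like c a -> is_iso (fmap H a).
Proof.
  move=> hX hY ha; have [U [p [hU hp]]] := plus_like_conf ha.
  have [eX [gX [exX unX]]] := unit_exists hX; have [eY [gY [exY unY]]] := unit_exists hY.
  have nat := unit_natural a hX gX gY.
  have hSX : cBplus c (S X) := proj1 (sigma_sigma_H c X).
  have hSY : cBplus c (S Y) := proj1 (sigma_sigma_H c Y).
  have [e he] := plus_like_extend eX ha hSX.
  have [k hk] := exY _ (to_quot c e) hSX.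
  have hea : to_quot c e ∘ to_quot c a ≈ eX := to_quot_heq c he.
  change (@is_iso Q _ _ (fmap S a)); exists k; split.
  - apply: unX => //; rewrite -comp_assoc nat comp_assoc hk comp_idl; exact: hea.
  - apply: unY => //; apply: (U_cokernel_unique hp hU hSY).
    change (fmap S a ∘ k ∘ eY ∘ to_quot c a ≈ idm _ ∘ eY ∘ to_quot c a).
    by rewrite -(comp_assoc _ k) hk -comp_assoc hea comp_idl.
Qed.

(** Pull a back along Y⁻ -> Y.  By the exchange property the result has the same
    shape; it now lies between objects of B⁻, where H is a reflection. *)
Lemma half_exact_plus_like (X Y : B) (a : hom X Y) : plus_like c a -> is_iso (fmap H a).
Proof.
  move=> ha; have hg := minus_data_like (minus_data c Y).
  set g := minus_gamma _ in hg; have [V [j [hV hj]]] := minus_like_conf hg.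
  have hdg : deflation g by exists V, j.
  have [P [a' [g' [hpb _]]]] := deflation_pullback a hdg.
  have ha' := plus_like_pullback ha hj hV hpb.
  have hg' := minus_like_pullback hg hpb.
  have [U [p [hU hp]]] := plus_like_conf ha'.
  have hY := minus_obj_Bminus (minus_data c Y).
  have hP := Bminus_of_conf hp hU hY.
  apply: (is_iso_of_comp_r (half_exact_minus_like hg')).
  apply: (@is_iso_heq _ _ _ (fmap H g ∘ fmap H a')).
  - by rewrite -!fmap_comp; apply: fmap_heq; apply: (proj1 hpb).
  - apply: is_iso_comp; first exact: half_exact_minus_like.
    exact: half_exact_plus_like_Bminus.
Qed.

Lemma half_exact_comp_W (X W Y : B) (b : hom W Y) (w : hom X W) :
  cW c W -> zero_mor (fmap H (b ∘ w)).
Proof.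
  move=> hW; apply/heart_zero_mor.
  exact: (@half_exact_0 B c X X W Y b w (half_exact_K (cW_cK hW))).
Qed.

(** The composite M -> X -> T factors through an object of W, and its first
    factor extends from M to the middle term since Ext¹(U, W) = 0. *)
Lemma pushout_factor (M X W U C T : B) (f : hom M X) (w : hom M W) (q : hom W U)
    (b : hom W C) (p : hom X C) (t : hom X T) :
  cU c U -> conflation w q -> is_pushout w f b p ->
  quot_eq (cW c) (t ∘ f) (hzero M T) -> exists u : hom C T, u ∘ p ≈ t.
Proof.
  move=> hU hc hpo [Z [hZ [x [y]]]]; rewrite hsub_0r => e.
  have [x' hx'] := V_extend x hU (proj2 hZ) hc.
  have [|u [[_ hu] _]] := proj2 hpo T (y ∘ x') t; first by rewrite -comp_assoc hx' e.
  by exists u.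
Qed.

Lemma pullback_factor (N X W V D T : B) (f : hom X N) (w : hom W N) (q : hom V W)
    (b : hom D W) (d : hom D X) (t : hom T X) :
  cV c V -> conflation q w -> is_pullback w f b d ->
  quot_eq (cW c) (f ∘ t) (hzero T N) -> exists u : hom T D, d ∘ u ≈ t.
Proof.
  move=> hV hc hpb [Z [hZ [x [y]]]]; rewrite hsub_0r => e.
  have [y' hy'] := U_lift y (proj1 hZ) hV hc.
  have [|u [[_ hu] _]] := proj2 hpb T (y' ∘ x) t; first by rewrite comp_assoc hy' e.
  by exists u.
Qed.

Lemma half_exact_cokernel_Bminus (M X W U C : B) (f : hom M X) (w : hom M W) (q : hom W U)
    (b : hom W C) (p : hom X C) :
  cBminus c M -> cBminus c X -> cBminus c C -> cW c W -> cU c U ->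
  conflation w q -> is_pushout w f b p -> is_cokernel (fmap H p) (fmap H f).
Proof.
  move=> hM hX hC hW hU hc hpo; have [r [hr _]] := pushout_conf hc hpo.
  split.
  { apply: (zero_mor_heq _ (half_exact_comp_W b w hW)); rewrite -fmap_comp.
    exact: (fmap_heq H (proj1 hpo)). }
  have [eM [gM [exM unM]]] := unit_exists hM.
  have [eX [gX [exX unX]]] := unit_exists hX.
  have [eC [gC [exC unC]]] := unit_exists hC.
  have natf := unit_natural f hM gM gX; have natp := unit_natural p hX gX gC.
  move=> T t /heart_zero_mor ht.
  have hT : cBplus c (proj1_sig T) := proj1 (proj2_sig T).
  have {}ht : @comp Q _ _ _ t (fmap S f) ≈ to_quot c (hzero _ _) := ht.
  pose t0 : @hom Q (S X) (proj1_sig T) := t.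
  have [|u0 hu0] := @pushout_factor M X W U C (proj1_sig T) f w q b p (t0 ∘ eX) hU hc hpo.
  { change (t0 ∘ eX ∘ to_quot c f ≈ to_quot c (hzero _ _)).
    rewrite -comp_assoc -natf comp_assoc ht.
    change (to_quot c (hzero (S M) (proj1_sig T) ∘ (eM : @hom B M (S M))) ≈ to_quot c (hzero _ _)).
    apply: to_quot_heq; exact: comp_0l. }
  have {}hu0 : to_quot c u0 ∘ to_quot c p ≈ t0 ∘ eX := to_quot_heq c hu0.
  have [u hu] := exC _ (to_quot c u0) hT.
  have uS : u ∘ fmap S p ≈ t0.
  { by apply: unX => //; rewrite -comp_assoc natp comp_assoc hu. }
  exists u; split; first exact: uS.
  move=> u' hu'; change (@heq Q (S C) (proj1_sig T) u' u); apply: unC => //.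
  have {}hu' : @comp Q _ _ _ u' (fmap S p) ≈ t0 := hu'.
  apply: (U_cokernel_unique hr hU hT).
  change ((u' : @hom Q (S C) (proj1_sig T)) ∘ eC ∘ to_quot c p ≈ u ∘ eC ∘ to_quot c p).
  by rewrite -!comp_assoc -natp !comp_assoc hu' uS.
Qed.

Lemma half_exact_kernel_Bplus (N X W V D : B) (f : hom X N) (w : hom W N) (q : hom V W)
    (b : hom D W) (d : hom D X) :
  cBplus c N -> cBplus c X -> cBplus c D -> cW c W -> cV c V ->
  conflation q w -> is_pullback w f b d -> is_kernel (fmap H d) (fmap H f).
Proof.
  move=> hN hX hD hW hV hc hpb; have [r [hr _]] := pullback_conf hc hpb.
  split.
  { apply: (zero_mor_heq _ (half_exact_comp_W w b hW)); rewrite -fmap_comp.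
    exact: (fmap_heq H (proj1 hpb)). }
  have [eN [gN [exN unN]]] := counit_exists hN.
  have [eX [gX [exX unX]]] := counit_exists hX.
  have [eD [gD [exD unD]]] := counit_exists hD.
  have natf := counit_natural f hN gX gN; have natd := counit_natural d hX gD gX.
  move=> T t /heart_zero_mor ht.
  have hT : cBminus c (proj1_sig T) := proj2 (proj2_sig T).
  have {}ht : @comp Q _ _ _ (fmap S f) t ≈ to_quot c (hzero _ _) := ht.
  pose t0 : @hom Q (proj1_sig T) (S X) := t.
  have [|u0 hu0] := @pullback_factor N X W V D (proj1_sig T) f w q b d (eX ∘ t0) hV hc hpb.
  { change (to_quot c f ∘ (eX ∘ t0) ≈ to_quot c (hzero _ _)).
    rewrite comp_assoc -natf -comp_assoc ht.
    change (to_quot c ((eN : @hom B (S N) N) ∘ hzero (proj1_sig T) (S N)) ≈ to_quot c (hzero _ _)).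
    apply: to_quot_heq; exact: comp_0r. }
  have {}hu0 : to_quot c d ∘ to_quot c u0 ≈ eX ∘ t0 := to_quot_heq c hu0.
  have [u hu] := exD _ (to_quot c u0) hT.
  have uS : fmap S d ∘ u ≈ t0.
  { by apply: unX => //; rewrite comp_assoc natd -comp_assoc hu. }
  exists u; split; first exact: uS.
  move=> u' hu'; change (@heq Q (proj1_sig T) (S D) u' u); apply: unD => //.
  have {}hu' : @comp Q _ _ _ (fmap S d) u' ≈ t0 := hu'.
  apply: (V_kernel_unique hr hV hT).
  change (to_quot c d ∘ (eD ∘ (u' : @hom Q (proj1_sig T) (S D))) ≈ to_quot c d ∘ (eD ∘ u)).
  by rewrite !comp_assoc -natd -!comp_assoc hu' uS.
Qed.

End InvertedMorphisms.

(** The pushout squares that compute cokernels pull back along C⁻ -> C; this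
    reduces the computation to objects of B⁻. *)
Lemma pushout_along_deflation (B : ExactCategory) (c : CotorsionPair B)
    (M X W U C C' V : B) (f : hom M X) (w : hom M W) (q : hom W U) (b : hom W C)
    (p : hom X C) (j : hom V C') (g : hom C' C) :
  cW c W -> cV c V -> conflation w q -> is_pushout w f b p -> conflation j g ->
  exists (X' : B) (f' : hom M X') (b' : hom W C') (p' : hom X' C') (g' : hom X' X),
    is_pushout w f' b' p' /\ is_pullback g p p' g' /\ g' ∘ f' ≈ f.
Proof.
  move=> hW hV hc hpo hj; have [r [hr er]] := pushout_conf hc hpo.
  have hdg : deflation g by exists V, j.
  have [X' [p' [g' [hpb _]]]] := deflation_pullback p hdg.
  have hp' := noether_conf_op hr hdg hpb.
  have [b' hb'] := U_lift b (proj1 hW) hV hj.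
  have [|f' [[f1 f2] _]] := proj2 hpb M (b' ∘ w) f.
  { by rewrite comp_assoc hb' (proj1 hpo). }
  exists X', f', b', p', g'; split=> //.
  apply: (pushout_of_conflations hc hp'); first by rewrite f1.
  by rewrite -comp_assoc hb'.
Qed.

Lemma pullback_along_inflation (B : ExactCategory) (c : CotorsionPair B)
    (N X W V D D' U : B) (f : hom X N) (w : hom W N) (q : hom V W) (b : hom D W)
    (d : hom D X) (r : hom D' U) (a : hom D D') :
  cW c W -> cU c U -> conflation q w -> is_pullback w f b d -> conflation a r ->
  exists (X' : B) (f' : hom X' N) (b' : hom D' W) (d' : hom D' X') (a' : hom X X'),
    is_pullback w f' b' d' /\ is_pushout a d d' a' /\ f' ∘ a' ≈ f.
Proof.
  move=> /op_cW; exact: (@pushout_along_deflation (op_exact B) (op_cotorsion c)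
    N X W V D D' U f w q b d r a).
Qed.

Section ExactnessOfH.
Variables (B : ExactCategory) (c : CotorsionPair B).
Local Notation H := (half_exact c).

Theorem half_exact_cokernel (M X W U C : B) (f : hom M X) (w : hom M W) (q : hom W U)
    (b : hom W C) (p : hom X C) :
  cW c W -> cU c U -> conflation w q -> is_pushout w f b p ->
  is_cokernel (fmap H p) (fmap H f).
Proof.
  move=> hW hU hc hpo; have hM : cBminus c M by exists W, U, w, q.
  have hg := minus_data_like (minus_data c C); set g := minus_gamma _ in hg.
  have [V [j [hV hj]]] := minus_like_conf hg.
  have [X' [f' [b' [p' [g' [hpo' [hpb ef]]]]]]] := pushout_along_deflation hW hV hc hpo hj.
  have [r [hr _]] := pushout_conf hc hpo'.
  have hC' := minus_obj_Bminus (minus_data c C).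
  have hX' := Bminus_of_conf hr hU hC'.
  have hg' := minus_like_pullback hg hpb.
  apply: (@cokernel_iso _ _ _ _ _ _ _ (fmap H f') (fmap H p') _ _ (idm _) (fmap H g') (fmap H g)).
  - exact: idm_iso.
  - exact: half_exact_minus_like.
  - exact: half_exact_minus_like.
  - by rewrite comp_idr -fmap_comp; apply: fmap_heq.
  - by rewrite -!fmap_comp; apply: fmap_heq; apply: (proj1 hpb).
  - exact: (half_exact_cokernel_Bminus hM hX' hC' hW hU hc hpo').
Qed.

(** H is σ⁺σ⁻ here as in [half_exact_cokernel], so this is not formally dual to
    it: the reduction to B⁺ pushes out along D -> D⁺ and rests on the fact that
    H inverts morphisms of this shape. *)
Theorem half_exact_kernel (N X W V D : B) (f : hom X N) (w : hom W N) (q : hom V W)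
    (b : hom D W) (d : hom D X) :
  cW c W -> cV c V -> conflation q w -> is_pullback w f b d ->
  is_kernel (fmap H d) (fmap H f).
Proof.
  move=> hW hV hc hpb; have hN : cBplus c N by exists V, W, q, w.
  have ha := plus_data_like (plus_data c D); set a := plus_alpha _ in ha.
  have [U [r [hU hr]]] := plus_like_conf ha.
  have [X' [f' [b' [d' [a' [hpb' [hpo ef]]]]]]] := pullback_along_inflation hW hU hc hpb hr.
  have [s [hs _]] := pullback_conf hc hpb'.
  have hD' := plus_obj_Bplus (plus_data c D).
  have hX' := Bplus_of_conf hs hV hD'.
  have ha' := plus_like_pushout ha hpo.
  have [x [x1 x2]] := half_exact_plus_like ha.
  have [y [y1 y2]] := half_exact_plus_like ha'.
  have sq : fmap H d' ∘ fmap H a ≈ fmap H a' ∘ fmap H d.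
  { by rewrite -!fmap_comp; apply: fmap_heq; apply: (proj1 hpo). }
  apply: (@kernel_iso _ _ _ _ _ _ _ (fmap H d') (fmap H f') _ _ x y (idm _)).
  - by exists (fmap H a).
  - by exists (fmap H a').
  - exact: idm_iso.
  - by rewrite -(comp_idr (fmap H d')) -x2 (comp_assoc (fmap H d')) sq !comp_assoc y1 comp_idl.
  - rewrite comp_idl -(comp_idr (fmap H f')) -y2 (comp_assoc (fmap H f')) -fmap_comp.
    by rewrite (fmap_heq H ef).
  - exact: (half_exact_kernel_Bplus hN hX' hD' hW hV hc hpb').
Qed.

Lemma heart_is_zero (X : heart c) :
  is_zero X <-> quot_eq (cW c) (idm (proj1_sig X : B)) (hzero _ _).
Proof.
  split.
  - move=> hX; exact: (proj1 (heart_zero_mor _) (zero_mor_src (idm X) hX)).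
  - move=> e; apply: is_zero_of_id; apply/heart_zero_mor; exact: e.
Qed.

Lemma quot_zero_retract (X : B) : quot_eq (cW c) (idm X) (hzero _ _) -> cW c X.
Proof.
  move=> [Z [hZ [a [b]]]]; rewrite hsub_0r => /(fun e => symmetry e) e.
  split; [exact: (U_retract e (proj1 hZ)) | exact: (V_retract e (proj2 hZ))].
Qed.

(** H X lies in W when it is zero in the quotient.  The defining pushout of
    H X = (X⁻)⁺ then presents W⁰ ⊕ X⁻ as an extension of objects of U. *)
Lemma minus_part_U (X : B) : is_zero (H X) -> cU c (minus_part c X).
Proof.
  move=> /heart_is_zero /quot_zero_retract [hU _].
  set d := plus_data c (minus_part c X).
  have {}hU : cU c (plus_obj d) := hU.
  have hw : inflation (plus_w d) by exists (plus_U0 d), (plus_q d); exact: plus_conf2.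
  have hc := pushout_conflation hw (plus_po d).
  have hsum := U_extension hc (plus_hU d) hU.
  apply: (U_retract (r := pr2 _ _) (s := in2 (plus_W0 d) _)) hsum; exact: pr2_in2.
Qed.

(** The pullback that defines X⁻ is a conflation X⁻ ↣ W₀ ⊕ X ↠ V. *)
Theorem half_exact_zero (X : B) : is_zero (H X) <-> cK c X.
Proof.
  split.
  - move=> /minus_part_U; set d := minus_data c X => hU.
    have hw : deflation (minus_w d) by exists (minus_V0 d), (minus_q d); exact: minus_conf2.
    have hc := pullback_conflation hw (minus_pb d).
    have hs := swap_iso X (minus_W0 d); have [s' [_ [s1 _]]] := iso_inv_r hs.
    exists (minus_W0 d), (minus_obj d), (minus_V d).
    exists ((in1 X (minus_W0 d) ∘ pr2 (minus_W0 d) X + in2 X (minus_W0 d) ∘ pr1 (minus_W0 d) X) ∘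
      (in1 _ _ ∘ minus_b d + in2 _ _ ∘ minus_gamma d)).
    exists ((minus_v d ∘ pr2 _ _ - minus_w d ∘ pr1 _ _) ∘ s').
    split=> //; split; first exact: minus_hV.
    apply: (conf_iso (idm_iso _) hs (idm_iso _) _ _ hc); first by rewrite comp_idr.
    by rewrite comp_idl -comp_assoc s1 comp_idr.
  - move=> hX; apply/heart_is_zero.
    apply: (quot_eq_trans (cW_additive c) (quot_eq_sym (fmap_id H X))).
    exact: half_exact_K.
Qed.

End ExactnessOfH.

(** * Balancedness of the heart *)

Section SplitSquare.
Variables (B : ExactCategory) (c : CotorsionPair B).
Local Notation H := (half_exact c).

(** The conflation D ↣ W' ⊕ M ↠ N extends along M ↣ W to D ↣ W' ⊕ W ↠ C, which
    splits because Ext¹(C, D) = 0.  The retraction restricts to W' ⊕ M, and it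
    factors through W there on M.  So the section N -> W' ⊕ M of the first
    conflation yields an inverse of m modulo W. *)
Lemma quot_iso_of_U_V (M N W U C W' V D : B) (m : hom M N) (w : hom M W) (q : hom W U)
    (b : hom W C) (p : hom N C) (w' : hom W' N) (q' : hom V W') (b' : hom D W') (d : hom D M) :
  cW c W -> cW c W' -> cU c C -> cV c D ->
  conflation w q -> is_pushout w m b p -> conflation q' w' -> is_pullback w' m b' d ->
  @is_iso (quotW c) M N m.
Proof.
  move=> hW hW' hC hD hw hpo hw' hpb.
  have hdw : deflation w' by exists V, q'.
  have hie := pullback_conflation hdw hpb.
  set i := (_ + _) in hie; set e := (_ - _) in hie.
  pose k := in1 W' W ∘ pr1 W' M + in2 W' W ∘ (w ∘ pr2 W' M).
  have k1 : k ∘ in1 _ _ ≈ in1 _ _.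
  { by rewrite comp_addl -!comp_assoc pr1_in1 pr2_in1 !comp_0r comp_idr hadd_0r. }
  have k2 : k ∘ in2 _ _ ≈ in2 _ _ ∘ w.
  { by rewrite comp_addl -!comp_assoc pr1_in2 pr2_in2 !comp_0r comp_idr hadd_0l. }
  have e1 : e ∘ in1 _ _ ≈ - w'.
  { by rewrite hsub_comp_l -!comp_assoc pr1_in1 pr2_in1 !comp_0r comp_idr hadd_0l. }
  have e2 : e ∘ in2 _ _ ≈ m.
  { by rewrite hsub_comp_l -!comp_assoc pr1_in2 pr2_in2 !comp_0r comp_idr hsub_0r. }
  have ext (X Y T : B) (s t : hom (X ⊕ Y) T) :
    s ∘ in1 _ _ ≈ t ∘ in1 _ _ -> s ∘ in2 _ _ ≈ t ∘ in2 _ _ -> s ≈ t.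
  { move=> h1 h2; rewrite -(comp_idr s) -(comp_idr t) -bip_id !comp_addr !comp_assoc.
    by rewrite h1 h2. }
  have hk : inflation k.
  { apply: (@pushout_inflation B M W _ _ w (in2 W' M) (in2 W' W) k).
    - by exists U, q.
    - split; first by rewrite k2.
      move=> T x y exy; exists (y ∘ in1 _ _ ∘ pr1 _ _ + x ∘ pr2 _ _); split; first split.
      + by rewrite comp_addl -!comp_assoc pr1_in2 pr2_in2 !comp_0r comp_idr hadd_0l.
      + apply: ext; rewrite -comp_assoc ?k1 ?k2 comp_addl -!comp_assoc.
        * by rewrite pr1_in1 pr2_in1 comp_0r comp_idr hadd_0r.
        * rewrite !(comp_assoc (pr1 _ _)) !(comp_assoc (pr2 _ _)) pr1_in2 pr2_in2.
          by rewrite comp_0l !comp_0r comp_idl hadd_0l.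
      + move=> z h1 h2; apply: ext; rewrite comp_addl -!comp_assoc.
        * by rewrite pr1_in1 pr2_in1 comp_0r comp_idr hadd_0r -k1 comp_assoc h2.
        * by rewrite pr1_in2 pr2_in2 !comp_0r comp_idr hadd_0l. }
  pose g := b ∘ pr2 W' W - p ∘ w' ∘ pr1 W' W.
  have g1 : g ∘ in1 _ _ ≈ - (p ∘ w').
  { by rewrite hsub_comp_l -!comp_assoc pr1_in1 pr2_in1 !comp_0r comp_idr hadd_0l. }
  have g2 : g ∘ in2 _ _ ≈ b.
  { by rewrite hsub_comp_l -!comp_assoc pr1_in2 pr2_in2 !comp_0r comp_idr hsub_0r. }
  have hg : is_pushout k e g p.
  { split.
    - apply: ext; rewrite -!comp_assoc ?k1 ?k2 ?e1 ?e2.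
      + by rewrite g1 comp_oppr.
      + by rewrite comp_assoc g2 (proj1 hpo).
    - move=> T x y exy.
      have [|z [[z1 z2] hz]] := proj2 hpo T (x ∘ in2 _ _) y.
      { by rewrite -comp_assoc -k2 comp_assoc exy -comp_assoc e2. }
      exists z; split; first split=> //.
      + apply: ext; rewrite -comp_assoc ?g1 ?g2 //.
        by rewrite comp_oppr comp_assoc z2 -comp_oppr -e1 comp_assoc -exy -comp_assoc k1.
      + by move=> z' h1 h2; apply: hz => //; rewrite -h1 -comp_assoc g2. }
  have hki := noether_conf hie hk hg.
  have [rho hrho] := V_extend (idm D) hC hD hki.
  have [|s hs] := @conf_factor B _ _ _ _ _ _ (idm _ - i ∘ (rho ∘ k)) hie.
  { by rewrite hsub_comp_l -!comp_assoc hrho comp_idl comp_idr; apply/hsub_eq0. }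
  have es : e ∘ s ≈ idm N.
  { apply: (defl_epi hie); rewrite -comp_assoc hs hsub_comp_r comp_assoc (conf_comp0 hie).
    by rewrite comp_0l hsub_0r comp_idl comp_idr. }
  have eM : pr2 _ _ ∘ s ∘ m - idm M ≈ - (pr2 _ _ ∘ i ∘ (rho ∘ in2 _ _)) ∘ w.
  { rewrite -e2 -!comp_assoc (comp_assoc s) hs hsub_comp_l hsub_comp_r comp_idl pr2_in2.
    rewrite (hadd_comm (idm M)) -hadd_assoc hadd_oppr hadd_0r comp_oppl.
    by rewrite -!comp_assoc k2. }
  have eN : m ∘ (pr2 _ _ ∘ s) - idm N ≈ w' ∘ (pr1 _ _ ∘ s).
  { rewrite -es hsub_comp_l hopp_add hopp_opp -!comp_assoc hadd_assoc.
    by rewrite hadd_oppr hadd_0l. }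
  exists (pr2 _ _ ∘ s); split.
  - by exists W; split=> //; exists w, (- (pr2 _ _ ∘ i ∘ (rho ∘ in2 _ _))).
  - by exists W'; split=> //; exists (pr1 _ _ ∘ s), w'.
Qed.

Lemma Bminus_K_U (X : B) : cBminus c X -> cK c X -> cU c X.
Proof.
  move=> hX /half_exact_zero /minus_part_U hU.
  have [s hs] := minus_lift (minus_data c X) (idm X) hX.
  exact: (U_retract hs hU).
Qed.

Lemma heart_unit (X : B) (hX : cH c X) : exists eta : @hom (quotW c) X (sigma_sigma c X),
  eta ∘ gamma c X ≈ alpha c X /\ is_iso eta.
Proof.
  have [eta [h1 _]] := unit_exists (proj2 hX); exists eta; split=> //.
  apply: (is_iso_of_comp_r (gamma_iso (proj2 hX))).
  exact: (is_iso_heq (symmetry h1) (alpha_iso (proj1 hX))).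
Qed.

End SplitSquare.

Section HeartBalanced.
Variables (B : ExactCategory) (c : CotorsionPair B).
Local Notation H := (half_exact c).

Lemma Bplus_K_V (X : B) : cBplus c X -> cK c X -> cV c X.
Proof.
  move=> /op_cBminus hX [Y [U [V [i [p [hU [hV hc]]]]]]].
  apply: (@Bminus_K_U (op_exact B) (op_cotorsion c) X hX).
  by exists Y, V, U, p, i.
Qed.

Lemma heart_morphism (X Y : heart c) (m : hom X Y) :
  exists (eX : hom (H (proj1_sig X)) X) (eY : hom (H (proj1_sig Y)) Y),
    is_iso eX /\ is_iso eY /\ m ∘ eX ≈ eY ∘ @fmap _ _ H (proj1_sig X) (proj1_sig Y) m.
Proof.
  have [eX [gX [eX' [iX iX']]]] := heart_unit (proj2_sig X).
  have [eY [gY [eY' [iY iY']]]] := heart_unit (proj2_sig Y).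
  have nat := @unit_natural _ c (proj1_sig X) (proj1_sig Y) m eX eY (proj2 (proj2_sig X)) gX gY.
  exists eX', eY'; split; first by exists eX.
  split; first by exists eY.
  have {}nat : fmap (sigma_sigma c) (m : @hom B (proj1_sig X) (proj1_sig Y)) ∘ eX
    ≈ eY ∘ (m : @hom (quotW c) (proj1_sig X) (proj1_sig Y)) := nat.
  change ((m : @hom (quotW c) (proj1_sig X) (proj1_sig Y)) ∘ eX' ≈
    eY' ∘ fmap (sigma_sigma c) (m : @hom B (proj1_sig X) (proj1_sig Y))).
  rewrite -(comp_idl (_ ∘ eX')) -iY -!comp_assoc (comp_assoc eY) -nat -!comp_assoc iX'.
  by rewrite comp_idr.
Qed.

(** A zero cokernel puts the pushout object of m in U, and a zero kernel puts
    its pullback object in V. *)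
Theorem heart_balanced (X Y : heart c) (m : hom X Y) : zmono m -> zepi m -> is_iso m.
Proof.
  move=> hmono hepi; have [eX [eY [iX [iY sq]]]] := heart_morphism m.
  move: (proj2_sig X) (proj2_sig Y) => [hX1 hX2] [hY1 hY2].
  have [W [U [w [q [hW [hU hw]]]]]] := hX2.
  have [V [W' [q' [w' [hV [hW' hw']]]]]] := hY1.
  pose f : @hom B (proj1_sig X) (proj1_sig Y) := m.
  have hiw : inflation w by exists U, q.
  have hdw : deflation w' by exists V, q'.
  have [C [b [p [hpo _]]]] := inflation_pushout f hiw.
  have [D [d [b' [hpb _]]]] := deflation_pullback f hdw.
  have hcok := half_exact_cokernel hW hU hw hpo.
  have hker := half_exact_kernel hW' hV hw' hpb.
  have [r [hr _]] := pushout_conf hw hpo.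
  have [j [hj _]] := pullback_conf hw' hpb.
  apply: (quot_iso_of_U_V hW hW' _ _ hw hpo hw' hpb).
  - apply: Bminus_K_U; first exact: (Bminus_extension hr hU hY2).
    apply/half_exact_zero; apply: (cokernel_of_zepi_zero hcok).
    move=> T t ht; case: iX iY => [eX' [x1 x2]] [eY' [y1 y2]].
    have {}ht : zero_mor (t ∘ eY' ∘ m).
    { apply: (@zero_mor_heq _ _ _ (t ∘ fmap H f ∘ eX')); last exact: zero_mor_compr.
      rewrite -(comp_idr (t ∘ eY' ∘ m)) -x2 (comp_assoc _ eX) -(comp_assoc _ m) sq.
      by rewrite -!comp_assoc (comp_assoc eY') y1 comp_idl. }
    apply: (zero_mor_heq _ (zero_mor_compr eY (hepi _ _ ht))).
    by rewrite -comp_assoc y1 comp_idr.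
  - apply: Bplus_K_V; first exact: (Bplus_extension hj hV hX1).
    apply/half_exact_zero; apply: (kernel_of_zmono_zero hker).
    move=> T t ht; case: iX iY => [eX' [x1 x2]] [eY' [y1 y2]].
    have {}ht : zero_mor (m ∘ (eX ∘ t)).
    { apply: (@zero_mor_heq _ _ _ (eY ∘ (fmap H f ∘ t))); last exact: zero_mor_compl.
      by rewrite !comp_assoc sq. }
    apply: (zero_mor_heq _ (zero_mor_compl eX' (hmono _ _ ht))).
    by rewrite comp_assoc x1 comp_idl.
Qed.

End HeartBalanced.

(** * Heart functors *)

(** The properties of B -> H/W on which the comparison of two hearts rests.  The
    target A is an arbitrary category, so that the opposite of an instance is
    again an instance. *)
Record heart_functor (B : ExactCategory) (c : CotorsionPair B) (A : Category)
    (F : Functor B A) : Prop := {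
  hf_cokernel : forall (M X W U C : B) (f : hom M X) (w : hom M W) (q : hom W U)
      (b : hom W C) (p : hom X C),
    cW c W -> cU c U -> conflation w q -> is_pushout w f b p ->
    is_cokernel (fmap F p) (fmap F f);
  hf_kernel : forall (N X W V D : B) (f : hom X N) (w : hom W N) (q : hom V W)
      (b : hom D W) (d : hom D X),
    cW c W -> cV c V -> conflation q w -> is_pullback w f b d ->
    is_kernel (fmap F d) (fmap F f);
  hf_minus : forall (X : B) (d : MinusData c X), is_iso (fmap F (minus_gamma d));
  hf_plus : forall (X : B) (d : PlusData c X), is_iso (fmap F (plus_alpha d));
  hf_balanced : forall (X Y : A) (m : hom X Y), zmono m -> zepi m -> is_iso m;
  hf_zero : forall X : B, is_zero (F X) <-> cK c X;
  hf_rep : forall (X Y : A) (m : hom X Y),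
    exists (M N : B) (f : hom M N) (eX : hom (F M) X) (eY : hom (F N) Y),
      (is_iso eX /\ is_iso eY /\ m ∘ eX ≈ eY ∘ fmap F f) /\ cBminus c M /\ cBplus c N
}.

Theorem half_exact_heart_functor (B : ExactCategory) (c : CotorsionPair B) :
  heart_functor c (half_exact c).
Proof.
  split.
  - exact: half_exact_cokernel.
  - exact: half_exact_kernel.
  - move=> X d; apply: half_exact_minus_like; exact: minus_data_like.
  - move=> X d; apply: half_exact_plus_like; exact: plus_data_like.
  - exact: heart_balanced.
  - exact: half_exact_zero.
  - move=> X Y m; have [eX [eY h]] := heart_morphism m.
    exists (proj1_sig X), (proj1_sig Y), m, eX, eY; split=> //.
    split; [exact: (proj2 (proj2_sig X)) | exact: (proj1 (proj2_sig Y))].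
Qed.

Lemma op_cK (B : ExactCategory) (c : CotorsionPair B) (X : B) :
  @cK (op_exact B) (op_cotorsion c) X <-> cK c X.
Proof.
  by split=> -[Y [U [V [i [p [hU [hV hc]]]]]]]; exists Y, V, U, p, i.
Qed.

Lemma op_heart_functor (B : ExactCategory) (c : CotorsionPair B) (A : Category)
    (F : Functor B A) :
  heart_functor c F ->
  @heart_functor (op_exact B) (op_cotorsion c) (op_cat A) (op_functor F).
Proof.
  move=> h; split.
  - move=> M X W U C f w q b p /op_cW hW hU hc hpo; apply/op_is_cokernel.
    exact: (hf_kernel h hW hU hc hpo).
  - move=> N X W V D f w q b d /op_cW hW hV hc hpb; apply/op_is_kernel.
    exact: (hf_cokernel h hW hV hc hpb).
  - move=> X d; apply/op_is_iso.
    exact: (hf_plus h (MkPlusData (minus_hU d) (minus_hV d) (proj1 (op_cW c _) (minus_hW0 d))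
      (minus_hV0 d) (minus_conf1 d) (minus_conf2 d) (minus_pb d))).
  - move=> X d; apply/op_is_iso; exact: (hf_minus h (minus_of_plus_op d)).
  - move=> X Y m /op_zmono hm /op_zepi hm'; apply/op_is_iso; exact: (hf_balanced h hm' hm).
  - move=> X; split.
    + move=> /op_is_zero /(hf_zero h) hK; exact: (proj2 (op_cK c X) hK).
    + move=> /op_cK hK; apply/op_is_zero; exact: (proj2 (hf_zero h X) hK).
  - move=> X Y m.
    have [M [N [f [eX [eY [[[x [x1 x2]] [[y [y1 y2]] sq]] [hM hN]]]]]]] := hf_rep h (m : @hom A Y X).
    exists N, M, f, y, x; split; last first.
    { split; [exact: (proj2 (op_cBminus c N) hN) | exact: (proj2 (op_cBplus c M) hM)]. }
    split; first by exists eY.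
    split; first by exists eX.
    change (y ∘ m ≈ fmap F f ∘ x).
    rewrite -(comp_idl (fmap F f)) -y1 -(comp_assoc y) -sq.
    by rewrite -!comp_assoc x2 comp_idr.
Qed.

(** * Exactness of a heart functor on conflations *)

Section ZeroOnK.
Variables (B : ExactCategory) (c : CotorsionPair B).

Lemma conf_add_zero (X Y Z : B) (i : hom X Y) (p : hom Y Z) :
  conflation i p -> conflation (in1 Y zobj ∘ i) (p ∘ pr1 Y zobj).
Proof.
  move=> hc.
  have e2 : pr2 Y zobj ≈ hzero _ _.
  { have [[k hk] _] := @zobj_zero B (Y ⊕ zobj); by rewrite (hk (pr2 _ _)) (hk (hzero _ _)). }
  have i1 : is_iso (in1 Y zobj).
  { exists (pr1 _ _); rewrite pr1_in1; split=> //.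
    by rewrite -bip_id e2 comp_0r hadd_0r. }
  apply: (conf_iso (idm_iso _) i1 (idm_iso _) _ _ hc); first by rewrite comp_idr.
  by rewrite comp_idl -comp_assoc pr1_in1 comp_idr.
Qed.

Lemma cK_of_conf (X U V : B) (i : hom U X) (p : hom X V) :
  cU c U -> cV c V -> conflation i p -> cK c X.
Proof.
  move=> hU hV hc; exists zobj, U, V, (in1 _ _ ∘ i), (p ∘ pr1 _ _).
  split=> //; split=> //; exact: conf_add_zero.
Qed.

Lemma cU_cK (X : B) : cU c X -> cK c X.
Proof.
  move=> hX; apply: (cK_of_conf hX (proj1 (cV_additive c))).
  exact: (@zero_conflation (op_exact B) X).
Qed.

Lemma cV_cK (X : B) : cV c X -> cK c X.
Proof.
  move=> hX; apply: (cK_of_conf (proj1 (cU_additive c)) hX); exact: zero_conflation.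
Qed.

(** Such an extension splits because Ext¹(U, V) = 0. *)
Lemma cK_of_VU (X U V : B) (i : hom V X) (p : hom X U) :
  cU c U -> cV c V -> conflation i p -> cK c X.
Proof.
  move=> hU hV hc; have [s es] := U_lift (idm U) hU hV hc.
  have [r [r1 [r2 r3]]] := section_complement hc es.
  apply: (cK_of_conf hU hV (i := s) (p := r)).
  have hb : is_iso (s ∘ pr1 U V + i ∘ pr2 U V).
  { exists (in1 _ _ ∘ p + in2 _ _ ∘ r); split.
    - rewrite comp_addl !comp_addr -!comp_assoc.
      rewrite !(comp_assoc p) !(comp_assoc r) es (conf_comp0 hc) r1 r2.
      by rewrite !comp_0l !comp_0r !comp_idl hadd_0l hadd_0r bip_id.
    - rewrite comp_addl !comp_addr -!comp_assoc.
      rewrite !(comp_assoc (pr1 _ _)) !(comp_assoc (pr2 _ _)).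
      rewrite pr1_in1 pr1_in2 pr2_in1 pr2_in2 !comp_0l !comp_0r !comp_idl hadd_0l hadd_0r.
      by rewrite hadd_comm. }
  apply: (conf_iso (idm_iso _) hb (idm_iso _) _ _ (conf_split U V)).
  - by rewrite comp_addl -!comp_assoc pr1_in1 pr2_in1 comp_0r hadd_0r.
  - by rewrite comp_addr !comp_assoc r1 r2 comp_0l hadd_0l.
Qed.

End ZeroOnK.

Section RightExactness.
Variables (B : ExactCategory) (c : CotorsionPair B) (A : Category) (F : Functor B A).
Hypothesis hF : heart_functor c F.

(** The cokernel of F i is F C, for C the pushout of X ↣ V along i.  It differs
    from F Z only by the kernel V of C ↠ Z. *)
Lemma hf_cokernel_conflation (X Y Z : B) (i : hom X Y) (p : hom Y Z) : conflation i p ->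
  exists (V C : B) (j : hom Y C) (k : hom V C) (e : hom C Z),
    cV c V /\ conflation k e /\ e ∘ j ≈ p /\ is_cokernel (fmap F j) (fmap F i).
Proof.
  move=> hc; have [d] := minus_inhabited c X.
  have hv : inflation (minus_v d) by exists (minus_U d), (minus_u d); exact: minus_conf1.
  have [C [k [j [hpo _]]]] := inflation_pushout i hv.
  have [r [hj er]] := pushout_conf (minus_conf1 d) hpo.
  have [e [hk ee]] := pushout_conf hc (pushout_sym hpo).
  exists (minus_V d), C, j, k, e; split; first exact: minus_hV.
  split=> //; split=> //.
  have hdw : deflation (minus_w d).
  { by exists (minus_V0 d), (minus_q d); exact: minus_conf2. }
  have hw := noether_conf_op (minus_conf1 d) hdw (minus_pb d).
  have hpo' : is_pushout (minus_b d) (i ∘ minus_gamma d) (k ∘ minus_w d) j.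
  { apply: (pushout_of_conflations hw hj).
    - by rewrite -comp_assoc (proj1 (minus_pb d)) !comp_assoc (proj1 hpo).
    - by rewrite comp_assoc er. }
  have := hf_cokernel hF (minus_hW0 d) (minus_hU d) hw hpo'.
  apply: (cokernel_iso (hf_minus hF d) (idm_iso _) (idm_iso _)).
  - by rewrite comp_idl fmap_comp.
  - by rewrite comp_idl comp_idr.
Qed.

(** In [hf_cokernel_conflation] with Z = U, the extension V ↣ C ↠ U splits, so
    that F C is zero. *)
Lemma zepi_of_cokernel_U (X Y U : B) (i : hom X Y) (p : hom Y U) :
  conflation i p -> cU c U -> zepi (fmap F i).
Proof.
  move=> hc hU; have [V [C [j [k [e [hV [hk [_ hj]]]]]]]] := hf_cokernel_conflation hc.
  apply: (zepi_of_cokernel_zero hj); apply/(hf_zero hF); exact: (cK_of_VU hU hV hk).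
Qed.

End RightExactness.

Section Cokernels.
Variables (B : ExactCategory) (c : CotorsionPair B) (A : Category) (F : Functor B A).
Hypothesis hF : heart_functor c F.

Lemma zmono_of_kernel_V (V Y Z : B) (i : hom V Y) (p : hom Y Z) :
  conflation i p -> cV c V -> zmono (fmap F p).
Proof.
  move=> hc hV; apply/op_zepi.
  exact: (zepi_of_cokernel_U (op_heart_functor hF) hc hV).
Qed.

Lemma hf_zepi_of_zero (X Y Z : B) (i : hom X Y) (p : hom Y Z) :
  conflation i p -> is_zero (F Z) -> zepi (fmap F i).
Proof.
  move=> hc hZ; have [V [C [j [k [e [hV [hk [_ hj]]]]]]]] := hf_cokernel_conflation hF hc.
  apply: (zepi_of_cokernel_zero hj); apply: is_zero_of_id.
  apply: (zmono_of_kernel_V hk hV); exact: zero_mor_tgt.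
Qed.

(** In the notation of [hf_cokernel_conflation], F C -> F Z is a monomorphism
    because its kernel V is killed, and an epimorphism because F p is. *)
Lemma hf_cokernel_of_zepi (X Y Z : B) (i : hom X Y) (p : hom Y Z) :
  conflation i p -> zepi (fmap F p) -> is_cokernel (fmap F p) (fmap F i).
Proof.
  move=> hc hp; have [V [C [j [k [e [hV [hk [ep hj]]]]]]]] := hf_cokernel_conflation hF hc.
  have he : is_iso (fmap F e).
  { apply: (hf_balanced hF); first exact: (zmono_of_kernel_V hk hV).
    apply: (@zepi_of_comp _ _ _ _ _ (fmap F j)); apply: zepi_heq hp.
    by rewrite -fmap_comp (fmap_heq F ep). }
  apply: (cokernel_iso (idm_iso _) (idm_iso _) he _ _ hj).
  - by rewrite comp_idl comp_idr.
  - by rewrite comp_idr -fmap_comp (fmap_heq F ep).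
Qed.

End Cokernels.

Lemma hf_zmono_of_zero (B : ExactCategory) (c : CotorsionPair B) (A : Category)
    (F : Functor B A) (hF : heart_functor c F) (X Y Z : B) (i : hom X Y) (p : hom Y Z) :
  conflation i p -> is_zero (F X) -> zmono (fmap F p).
Proof.
  move=> hc /op_is_zero hX; apply/op_zepi.
  exact: (hf_zepi_of_zero (op_heart_functor hF) hc hX).
Qed.

(** * Two cotorsion pairs *)

Section TwoPairs.
Variables (B : ExactCategory) (c c' : CotorsionPair B) (A : Category) (F : Functor B A).
Hypothesis hF : heart_functor c F.
Hypothesis hK : forall X, cK c' X -> cK c X.

(** The kernel of X⁻ -> X and the cokernel of X⁻ ↣ W₀ ⊕ X both lie in the V of
    the second pair, which F kills. *)
Lemma hf_minus_other (X : B) (d : MinusData c' X) : is_iso (fmap F (minus_gamma d)).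
Proof.
  have [j hj] := minus_gamma_conf d.
  have zero X' : cK c' X' -> is_zero (F X') by move=> h; apply/(hf_zero hF); apply: hK.
  apply: (hf_balanced hF).
  - by apply: (hf_zmono_of_zero hF hj); apply: zero; apply: cV_cK; apply: minus_hV0.
  - have hw : deflation (minus_w d) by exists (minus_V0 d), (minus_q d); exact: minus_conf2.
    have hc := pullback_conflation hw (minus_pb d).
    have h1 : zepi (fmap F (pr2 (minus_W0 d) X)).
    { by apply: (zepi_split (s := fmap F (in2 _ _))); rewrite -fmap_comp -fmap_id;
        apply: fmap_heq; exact: pr2_in2. }
    have h2 := hf_zepi_of_zero hF hc (zero _ (cV_cK (minus_hV d))).
    apply: zepi_heq (zepi_comp h1 h2); rewrite -fmap_comp; apply: fmap_heq.
    by rewrite comp_addr !comp_assoc pr2_in1 pr2_in2 comp_0l comp_idl hadd_0l.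
Qed.

(** In the conflation M ↣ W ⊕ N ↠ C given by the pushout, F does not see W, and
    F N -> F C is an epimorphism because F kills U. *)
Lemma hf_cokernel_other (M N W U C : B) (f : hom M N) (w : hom M W) (q : hom W U)
    (b : hom W C) (p : hom N C) :
  cW c' W -> cU c' U -> conflation w q -> is_pushout w f b p ->
  is_cokernel (fmap F p) (fmap F f).
Proof.
  move=> hW hU hc hpo.
  have zero X' : cK c' X' -> is_zero (F X') by move=> h; apply/(hf_zero hF); apply: hK.
  have hw : inflation w by exists U, q.
  have [r [hr _]] := pushout_conf hc hpo.
  have hp : zepi (fmap F p) := hf_zepi_of_zero hF hr (zero _ (cU_cK hU)).
  have hj := pushout_conflation hw hpo.
  set j := (_ - _) in hj; set e := (_ + _) in hj.
  have e2 : e ∘ in2 _ _ ≈ p.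
  { by rewrite comp_addl -!comp_assoc pr1_in2 pr2_in2 comp_0r comp_idr hadd_0l. }
  have j2 : pr2 _ _ ∘ j ≈ f.
  { by rewrite hsub_comp_r !comp_assoc pr2_in1 pr2_in2 comp_0l comp_idl hsub_0r. }
  have he : zepi (fmap F e).
  { apply: (@zepi_of_comp _ _ _ _ _ (fmap F (in2 _ _))); apply: zepi_heq hp.
    by rewrite -fmap_comp (fmap_heq F e2). }
  have i2 : is_iso (fmap F (in2 W N)).
  { apply: (hf_balanced hF).
    - apply: (@zmono_split _ _ _ _ (fmap F (pr2 W N))).
      by rewrite -fmap_comp -fmap_id; apply: fmap_heq; exact: pr2_in2.
    - exact: (hf_zepi_of_zero hF (conf_split_op W N) (zero _ (cW_cK hW))). }
  have F2 : fmap F (pr2 W N) ∘ fmap F (in2 W N) ≈ idm _.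
  { by rewrite -fmap_comp -fmap_id; apply: fmap_heq; exact: pr2_in2. }
  have p2 : is_iso (fmap F (pr2 W N)).
  { by apply: (is_iso_of_comp_r i2); apply: (is_iso_heq (symmetry F2)). }
  have F2' : fmap F (in2 W N) ∘ fmap F (pr2 W N) ≈ idm _.
  { case: i2 => [g [g1 g2]]; rewrite -(comp_idr (fmap F (pr2 W N))) -g2.
    by rewrite (comp_assoc (fmap F (pr2 _ _))) F2 comp_idl g2. }
  apply: (cokernel_iso (idm_iso _) p2 (idm_iso _) _ _ (hf_cokernel_of_zepi hF hj he)).
  - by rewrite comp_idr -fmap_comp (fmap_heq F j2).
  - by rewrite comp_idl -(fmap_heq F e2) fmap_comp -comp_assoc F2' comp_idr.
Qed.

End TwoPairs.

Section TwoPairsOp.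
Variables (B : ExactCategory) (c c' : CotorsionPair B) (A : Category) (F : Functor B A).
Hypothesis hF : heart_functor c F.
Hypothesis hK : forall X, cK c' X -> cK c X.

Let hKop : forall X : op_exact B, cK (op_cotorsion c') X -> cK (op_cotorsion c) X.
Proof. by move=> X /op_cK hX; apply/op_cK; apply: hK. Qed.

Lemma hf_plus_other (X : B) (d : PlusData c' X) : is_iso (fmap F (plus_alpha d)).
Proof.
  apply/op_is_iso.
  have hW0 := proj2 (op_cW c' _) (plus_hW0 d).
  exact: (hf_minus_other (op_heart_functor hF) hKop
    (@MkMinusData (op_exact B) (op_cotorsion c') X _ _ _ _ _ _ _ _ _ _ _
      (plus_hV d) (plus_hU d) hW0 (plus_hU0 d) (plus_conf1 d) (plus_conf2 d) (plus_po d))).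
Qed.

End TwoPairsOp.

(** * Comparison of two heart functors *)

Lemma naturally_isomorphic_op (C D : Category) (F G : Functor C D) :
  naturally_isomorphic F G -> naturally_isomorphic (op_functor F) (op_functor G).
Proof.
  move=> /naturally_isomorphic_sym [eta [hi hn]]; exists eta; split.
  - by move=> X; apply/op_is_iso.
  - by move=> X Y f; symmetry; exact: (hn Y X f).
Qed.

Section ComparisonCokernel.
Variables (B : ExactCategory) (c1 c2 : CotorsionPair B) (A1 A2 : Category).
Variables (F1 : Functor B A1) (F2 : Functor B A2) (T : Functor A2 A1).
Hypothesis hF1 : heart_functor c1 F1.
Hypothesis hF2 : heart_functor c2 F2.
Hypothesis hK : forall X, cK c2 X -> cK c1 X.
Hypothesis hT : naturally_isomorphic (functor_comp T F2) F1.

(** Every morphism of A2 is F2 f up to isomorphism, and one pushout in B computes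
    the cokernels of both F2 f and F1 f. *)
Lemma hf_morphism_cokernel (X Y : A2) (m : hom X Y) :
  exists (Q : A2) (q : hom Y Q), is_cokernel q m /\ is_cokernel (fmap T q) (fmap T m).
Proof.
  have [M [N [f [eX [eY [[iX [iY sq]] [[W [U [w [q [hW [hU hw]]]]]] _]]]]]]] := hf_rep hF2 m.
  have hiw : inflation w by exists U, q.
  have [C [b [p [hpo _]]]] := inflation_pushout f hiw.
  have h2 := hf_cokernel hF2 hW hU hw hpo.
  have h1 := hf_cokernel_other hF1 hK hW hU hw hpo.
  have [eta [hi hn]] := naturally_isomorphic_sym hT.
  have [y [y1 y2]] := iY.
  have ep : idm (F2 C) ∘ fmap F2 p ≈ fmap F2 p ∘ y ∘ eY.
  { by rewrite -comp_assoc y1 comp_idl comp_idr. }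
  exists (F2 C), (fmap F2 p ∘ y); split.
  - exact: (cokernel_iso iX iY (idm_iso _) (symmetry sq) ep h2).
  - have hT2 : is_cokernel (fmap T (fmap F2 p)) (fmap T (fmap F2 f)).
    { exact: (cokernel_iso (hi M) (hi N) (hi C) (hn M N f) (hn N C p) h1). }
    apply: (cokernel_iso (functor_iso T iX) (functor_iso T iY) (idm_iso _) _ _ hT2).
    + by rewrite -!fmap_comp; apply: fmap_heq; symmetry.
    + by rewrite comp_idl -fmap_comp; apply: fmap_heq; rewrite -ep comp_idl.
Qed.

Lemma comparison_cokernel (X Y Q : A2) (m : hom X Y) (q : hom Y Q) :
  is_cokernel q m -> is_cokernel (fmap T q) (fmap T m).
Proof.
  move=> hq; have [Q' [q' [hq' hT']]] := hf_morphism_cokernel m.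
  have [e [ie ee]] := cokernel_unique hq' hq.
  apply: (cokernel_iso (idm_iso _) (idm_iso _) (functor_iso T ie) _ _ hT').
  - by rewrite comp_idl comp_idr.
  - by rewrite comp_idr -fmap_comp; apply: fmap_heq.
Qed.

End ComparisonCokernel.

Section ComparisonExact.
Variables (B : ExactCategory) (c1 c2 : CotorsionPair B) (A1 A2 : Category).
Variables (F1 : Functor B A1) (F2 : Functor B A2) (T : Functor A2 A1).
Hypothesis hF1 : heart_functor c1 F1.
Hypothesis hF2 : heart_functor c2 F2.
Hypothesis hK : forall X, cK c2 X -> cK c1 X.
Hypothesis hT : naturally_isomorphic (functor_comp T F2) F1.

Let hKop : forall X : op_exact B, cK (op_cotorsion c2) X -> cK (op_cotorsion c1) X.
Proof. by move=> X /op_cK hX; exact: (proj2 (op_cK c1 X) (hK hX)). Qed.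

Let hTop : naturally_isomorphic (functor_comp (op_functor T) (op_functor F2)) (op_functor F1).
Proof. exact: (naturally_isomorphic_op hT). Qed.

Lemma hf_morphism_kernel (X Y : A2) (m : hom X Y) :
  exists (K : A2) (k : hom K X), is_kernel k m /\ is_kernel (fmap T k) (fmap T m).
Proof.
  have [K [k [h1 h2]]] := hf_morphism_cokernel (op_heart_functor hF1) (op_heart_functor hF2)
    hKop hTop (m : @hom (op_cat A2) Y X).
  exists K, k; split; apply/op_is_cokernel; [exact: h1 | exact: h2].
Qed.

Lemma comparison_kernel (X Y K : A2) (m : hom X Y) (k : hom K X) :
  is_kernel k m -> is_kernel (fmap T k) (fmap T m).
Proof.
  move=> /op_is_cokernel hk; apply/op_is_cokernel.
  exact: (comparison_cokernel (op_heart_functor hF1) (op_heart_functor hF2) hKop hTop hk).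
Qed.

Variable S : A2 -> Prop.
Hypothesis hS : forall X, S X <-> is_zero (T X).

Theorem comparison_serre : serre_subcategory S.
Proof.
  split.
  - exists (F2 zobj); apply/hS; have [eta [hi _]] := naturally_isomorphic_sym hT.
    apply: (is_zero_iso (hi zobj)); apply/(hf_zero hF1); apply: cU_cK.
    exact: (proj1 (cU_additive c1)).
  - move=> X Y Z f g [/comparison_kernel hk /(comparison_cokernel hF1 hF2 hK hT) hq].
    rewrite !hS; split.
    + move=> hY; split; apply: is_zero_of_id.
      * by apply: (kernel_zmono hk); apply: zero_mor_tgt.
      * by apply: (cokernel_zepi hq); apply: zero_mor_src.
    + move=> [hX hZ]; apply: is_zero_of_id; apply: (zmono_of_kernel_zero hk hX).
      exact: zero_mor_tgt.
Qed.

Theorem comparison_serre_iso (X Y : A2) (m : hom X Y) :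
  serre_iso S m <-> is_iso (fmap T m).
Proof.
  split.
  - move=> [[K [k [/comparison_kernel hk /hS hKz]]] [Q [q [hq /hS hQ]]]].
    apply: (hf_balanced hF1); first exact: (zmono_of_kernel_zero hk hKz).
    exact: (zepi_of_cokernel_zero (comparison_cokernel hF1 hF2 hK hT hq) hQ).
  - move=> [n [n1 n2]]; split.
    + have [K [k [hk hTk]]] := hf_morphism_kernel m; exists K, k; split=> //.
      apply/hS; apply: (kernel_of_zmono_zero hTk); exact: (zmono_split n1).
    + have [Q [q [hq hTq]]] := hf_morphism_cokernel hF1 hF2 hK hT m; exists Q, q; split=> //.
      apply/hS; apply: (cokernel_of_zepi_zero hTq); exact: (zepi_split n2).
Qed.

End ComparisonExact.

(** * Functors on a localization *)

Section LocalizationFunctor.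
Variables (C E : Category) (Sigma : forall X Y : C, hom X Y -> Prop) (G : Functor C E).
Hypothesis hG : forall (X Y : C) (s : hom X Y), Sigma s -> is_iso (fmap G s).

Definition loc_inverse (X Y : C) (s : hom X Y) (hs : Sigma s) : hom (G Y) (G X) :=
  proj1_sig (constructive_indefinite_description _ (hG hs)).

(** An opaque choice of inverses is harmless, inverses being unique. *)
Fixpoint loc_map (X Y : C) (z : zigzag Sigma X Y) : hom (G X) (G Y) :=
  match z in zigzag _ X Y return hom (G X) (G Y) with
  | zz_mor _ f => fmap G f
  | zz_inv hs => loc_inverse hs
  | zz_comp z2 z1 => loc_map z2 ∘ loc_map z1
  end.

Definition loc_functor : Functor (localization Sigma) E.
Proof using hG.
  refine {| fobj := (fun X => G X) : localization Sigma -> E; fmap := loc_map |}.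
  - move=> X Y f g; elim=> {X Y f g} /=.
    + by [].
    + by move=> X Y p q _ e; symmetry.
    + by move=> X Y p q r _ e1 _ e2; rewrite e1.
    + by move=> X Y Z p p' q q' _ -> _ ->.
    + by move=> *; apply: comp_assoc.
    + by move=> X Y p; rewrite fmap_id comp_idl.
    + by move=> X Y p; rewrite fmap_id comp_idr.
    + by move=> X Y f g; apply: fmap_heq.
    + by move=> *; apply: fmap_comp.
    + move=> X Y s hs; rewrite fmap_id /loc_inverse.
      by case: constructive_indefinite_description => g [].
    + move=> X Y s hs; rewrite fmap_id /loc_inverse.
      by case: constructive_indefinite_description => g [].
  - by move=> X; apply: fmap_id.
  - by move=> X Y Z g f.
Defined.

End LocalizationFunctor.

Section LocalizationProjection.
Variables (C : Category) (Sigma : forall X Y : C, hom X Y -> Prop).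

Definition loc_proj : Functor C (localization Sigma).
Proof.
  refine {| fobj := (fun X => X) : C -> localization Sigma;
            fmap := fun X Y f => zz_mor Sigma f |}.
  - exact: zz_mor_heq.
  - by [].
  - exact: zz_mor_comp.
Defined.

Lemma loc_proj_iso (X Y : C) (s : hom X Y) : Sigma s -> is_iso (fmap loc_proj s).
Proof. by move=> hs; exists (zz_inv hs); split; [apply: zz_inv_l | apply: zz_inv_r]. Qed.

(** Naturality with respect to a morphism implies naturality with respect to its
    inverse, so the morphisms of C suffice. *)
Lemma loc_natural (E : Category) (P R : Functor (localization Sigma) E)
    (eta : forall X : C, hom (P X) (R X)) :
  (forall (X Y : C) (f : hom X Y),
    eta Y ∘ fmap P (fmap loc_proj f) ≈ fmap R (fmap loc_proj f) ∘ eta X) ->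
  forall (X Y : localization Sigma) (z : hom X Y), eta Y ∘ fmap P z ≈ fmap R z ∘ eta X.
Proof.
  move=> h X Y; elim=> {X Y}.
  - exact: h.
  - move=> X Y s hs; pose si : @hom (localization Sigma) Y X := zz_inv hs.
    have e1 : fmap R si ∘ fmap R (fmap loc_proj s) ≈ idm _.
    { rewrite -fmap_comp -fmap_id; apply: fmap_heq; exact: zz_inv_l. }
    have e2 : fmap P (fmap loc_proj s) ∘ fmap P si ≈ idm _.
    { rewrite -fmap_comp -fmap_id; apply: fmap_heq; exact: zz_inv_r. }
    rewrite -(comp_idl (eta X)) -e1 -(comp_assoc (fmap R si)) -h.
    by rewrite -!comp_assoc e2 comp_idr.
  - move=> X Y Z z2 h2 z1 h1.
    change (eta Z ∘ fmap P ((z2 : @hom (localization Sigma) _ _) ∘ z1) ≈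
      fmap R ((z2 : @hom (localization Sigma) _ _) ∘ z1) ∘ eta X).
    by rewrite !fmap_comp comp_assoc h2 -!comp_assoc h1.
Qed.

End LocalizationProjection.

(** * The hearts of two cotorsion pairs *)

Lemma naturally_isomorphic_precomp (C D E : Category) (P : Functor C D) (F G : Functor D E) :
  naturally_isomorphic F G ->
  naturally_isomorphic (functor_comp F P) (functor_comp G P).
Proof.
  move=> [eta [hi hn]]; exists (fun X => eta (P X)); split=> [X | X Y f]; first exact: hi.
  exact: (hn _ _ (fmap P f)).
Qed.

Lemma naturally_isomorphic_postcomp (C D E : Category) (P : Functor D E) (F G : Functor C D) :
  naturally_isomorphic F G ->
  naturally_isomorphic (functor_comp P F) (functor_comp P G).
Proof.
  move=> [eta [hi hn]]; exists (fun X => fmap P (eta X)); split=> [X | X Y f].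
  - exact: (functor_iso P (hi X)).
  - rewrite /= -!fmap_comp; apply: fmap_heq; exact: hn.
Qed.

Section OneHeart.
Variables (B : ExactCategory) (c : CotorsionPair B).

(** H, as an endofunctor of B/W. *)
Definition quot_endo : Functor (quotW c) (quotW c) :=
  functor_comp (heart_incl c) (h_functor (@cW_cK B c)).

(** The two halves of X <- X⁻ -> H X are natural in B/W, and K inverts both. *)
Lemma inverting_natural (E : Category) (K : Functor (quotW c) E) :
  (forall X, is_iso (fmap K (gamma c X))) -> (forall X, is_iso (fmap K (alpha c X))) ->
  naturally_isomorphic (functor_comp K quot_endo) K.
Proof.
  move=> hg ha; pose inv X := constructive_indefinite_description _ (ha X).
  exists (fun X => fmap K (gamma c X) ∘ proj1_sig (inv X)); split.
  - move=> X; apply: is_iso_comp => //; case: (inv X) => r [r1 r2] /=.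
    by exists (fmap K (alpha c X)).
  - move=> X Y f; case: (inv X) (inv Y) => [r [r1 r2]] [s [s1 s2]].
    pose Sf : @hom (quotW c) (sigma_sigma c X) (sigma_sigma c Y) := fmap (sigma_sigma c) f.
    change (fmap K (gamma c Y) ∘ s ∘ fmap K Sf ≈ fmap K f ∘ (fmap K (gamma c X) ∘ r)).
    have e1 : fmap K Sf ∘ fmap K (alpha c X) ≈ fmap K (alpha c Y) ∘ fmap K (minus_map c f).
    { rewrite -!fmap_comp; apply: fmap_heq; exact: alpha_natural. }
    have e2 : fmap K (gamma c Y) ∘ fmap K (minus_map c f) ≈ fmap K f ∘ fmap K (gamma c X).
    { rewrite -!fmap_comp; apply: fmap_heq; exact: gamma_natural. }
    rewrite comp_assoc -e2 -!comp_assoc; apply: comp_heq => //.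
    rewrite -(comp_idr (fmap K Sf)) -r2.
    by rewrite !comp_assoc -(comp_assoc s) e1 !comp_assoc s1 comp_idl.
Qed.

Lemma beta_self :
  naturally_isomorphic (beta (ci := c) (cj := c) (@cW_cK B c)) (functor_id (heart c)).
Proof.
  have h (X : heart c) : exists e : @hom (quotW c) (sigma_sigma c (proj1_sig X)) (proj1_sig X),
    is_iso e /\ e ∘ alpha c (proj1_sig X) ≈ gamma c (proj1_sig X).
  { have [eta [e [r [r1 r2]]]] := heart_unit (proj2_sig X); exists r; split; first by exists eta.
    by rewrite -e comp_assoc r1 comp_idl. }
  pose eta X := constructive_indefinite_description _ (h X).
  exists (fun X => proj1_sig (eta X)); split.
  - by move=> X; case: (eta X) => e [].
  - move=> X Y f; case: (eta X) (eta Y) => [e [_ he]] [e' [_ he']] /=.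
    exact: (counit_natural f (proj1 (proj2_sig Y)) he he').
Qed.

End OneHeart.

Section TwoHearts.
Variables (B : ExactCategory) (c1 c2 : CotorsionPair B).
Variable hW1 : forall X : B, cW c1 X -> cK c2 X.
Variable hW2 : forall X : B, cW c2 X -> cK c1 X.
Hypothesis hK : forall X : B, cK c2 X -> cK c1 X.

(** H₁ inverts both halves of the span X <- X⁻ -> H₂ X of the second pair. *)
Lemma beta_half_exact :
  naturally_isomorphic (functor_comp (beta hW2) (half_exact c2)) (half_exact c1).
Proof.
  have h1 := half_exact_heart_functor c1.
  have h : naturally_isomorphic (functor_comp (h_functor hW2) (quot_endo c2)) (h_functor hW2).
  { apply: inverting_natural => X.
    - exact: (hf_minus_other h1 hK).
    - exact: (hf_plus_other h1 hK). }
  exact: (naturally_isomorphic_precomp (quot_proj (cW_additive c2)) h).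
Qed.

Theorem beta_beta :
  naturally_isomorphic (functor_comp (beta hW2) (beta hW1)) (functor_id (heart c1)).
Proof.
  have h : naturally_isomorphic (functor_comp (beta hW2) (h_functor hW1))
    (h_functor (@cW_cK B c1)) := beta_half_exact.
  apply: naturally_isomorphic_trans (beta_self c1).
  exact: (naturally_isomorphic_precomp (heart_incl c1) h).
Qed.

Let S (X : heart c2) : Prop := cK c1 (proj1_sig X).

Let hS (X : heart c2) : S X <-> is_zero (beta hW2 X).
Proof. by rewrite /S -half_exact_zero. Qed.

Theorem heart_serre : serre_subcategory S.
Proof.
  exact: (comparison_serre (half_exact_heart_functor c1) (half_exact_heart_functor c2) hK
    beta_half_exact hS).
Qed.

Lemma heart_serre_iso (X Y : heart c2) (m : hom X Y) :
  serre_iso S m <-> is_iso (fmap (beta hW2) m).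
Proof.
  exact: (comparison_serre_iso (half_exact_heart_functor c1) (half_exact_heart_functor c2) hK
    beta_half_exact hS).
Qed.

Lemma half_exact_serre_iso (X Y : B) (f : hom X Y) :
  is_iso (fmap (half_exact c1) f) -> serre_iso S (fmap (half_exact c2) f).
Proof.
  move=> hf; apply/heart_serre_iso; have [eta [hi hn]] := beta_half_exact.
  apply: (is_iso_of_comp_l (hi Y)); apply: (is_iso_heq (symmetry (hn X Y f))).
  exact: is_iso_comp.
Qed.

(** The functor H₂ followed by the localization inverts both halves of the span
    Y <- Y⁻ -> H₁ Y of the first pair, whose outer terms become Y and
    β₁₂ β₂₁ Y. *)
Theorem heart_localization : equivalent_categories (serre_localization S) (heart c1).
Proof.
  have hs (X Y : heart c2) (s : hom X Y) (h : serre_iso S s) := proj1 (heart_serre_iso s) h.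
  pose F : Functor (serre_localization S) (heart c1) := loc_functor hs.
  pose P : Functor (heart c2) (serre_localization S) := loc_proj (@serre_iso _ S).
  exists F, (functor_comp P (beta hW1)); split; last exact: beta_beta.
  have h1 := half_exact_heart_functor c1.
  have hloc : naturally_isomorphic (functor_comp (functor_comp P (h_functor hW1)) (quot_endo c1))
    (functor_comp P (h_functor hW1)).
  { apply: inverting_natural => X.
    - apply: (@loc_proj_iso _ (@serre_iso _ S)); apply: half_exact_serre_iso.
      exact: (hf_minus h1).
    - apply: (@loc_proj_iso _ (@serre_iso _ S)); apply: half_exact_serre_iso.
      exact: (hf_plus h1). }
  have h2 : naturally_isomorphic
    (functor_comp P (functor_comp (beta hW1) (h_functor hW2)))
    (functor_comp P (h_functor (@cW_cK B c2))) := hloc.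
  have h3 := naturally_isomorphic_precomp (heart_incl c2) h2.
  have h4 : naturally_isomorphic
    (functor_comp P (functor_comp (beta hW1) (beta hW2))) P :=
    naturally_isomorphic_trans h3 (naturally_isomorphic_postcomp P (beta_self c2)).
  have [eta [hi hn]] := h4.
  exists eta; split; first exact: hi.
  exact: (@loc_natural _ (@serre_iso _ S) _ (functor_comp (functor_comp P (beta hW1)) F)
    (functor_id _) eta hn).
Qed.

End TwoHearts.

Theorem theorem1p4 (B : ExactCategory)
    (hKS : krull_schmidt B) (hP : enough_projectives B) (hI : enough_injectives B)
    (c1 c2 : CotorsionPair B)
    (hW1 : forall X : B, cW c1 X -> cK c2 X)
    (hK : forall X : B, cK c2 X -> cK c1 X) :
  naturally_isomorphic
    (functor_comp (beta (ci := c2) (cj := c1) (fun X hX => hK X (cW_cK hX)))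
                  (beta (ci := c1) (cj := c2) hW1))
    (functor_id (heart c1)) /\
  serre_subcategory (A := heart c2) (fun X => cK c1 (proj1_sig X)) /\
  equivalent_categories
    (serre_localization (A := heart c2) (fun X => cK c1 (proj1_sig X)))
    (heart c1).
Proof.
  split; first exact: beta_beta.
  split; first exact: (heart_serre (fun X hX => hK X (cW_cK hX)) hK).
  exact: (heart_localization hW1 (fun X hX => hK X (cW_cK hX)) hK).
Qed.
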